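(* Let $k$ be a number field and let $E_0$ be an elliptic curve over $k$ given by $y^2=x^3+Ax+B$, and assume $A\neq0$. Put $\delta_{E_0}=4A^3+27B^2$. The Weierstrass form of the Cayleyan curve $Ca(E_0)$ is given by $$Ca(E_0):\ -3y^2=x^3-18Bx^2+3\delta_{E_0}x.$$ Moreover, the curve $C$ given by $$C:\ Y^2=-(3X^2+4A)(X^3+AX+B)$$ is a curve of genus $2$ admitting two morphisms $\psi_1:C\to E_0$ and $\psi_2:C\to Ca(E_0)$ of degree $3$. The maps $\psi_1$ and $\psi_2$ are given by $$\psi_1:(X,Y)\mapsto(x,y)=\left(-\frac{X^3+4B}{3X^2+4A},\ \frac{(X^3+4AX-8B)Y}{(3X^2+4A)^2}\right),$$ $$\psi_2:(X,Y)\mapsto(x,y)=\left(\frac{\delta_{E_0}}{3(X^3+AX+B)},\ \frac{\delta_{E_0}(3X^2+A)Y}{9(X^3+AX+B)^2}\right).$$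
   Context: For the plane cubic $E_0: y^2z=x^3+Axz^2+Bz^3$ with $A\ne0$, the Hessian curve is $He(E_0):3Ax^2z+9Bxz^2+3xy^2-A^2z^3=0$, a nonsingular cubic. For $a\in He(E_0)$ the polar conic $a_0F_x+a_1F_y+a_2F_z=0$ of $E_0:F=0$ has a unique singular point $\iota(a)\in He(E_0)$, and $\iota$ is a fixed-point-free involution of $He(E_0)$. The Cayleyan $Ca(E_0)$ is the image of $He(E_0)$ in the dual projective plane under $a\mapsto\overline{a\,\iota(a)}$ (the line joining $a$ and $\iota(a)$). In dual coordinates $(\xi:\eta:\zeta)$ it is the cubic $A\xi^3+9B\xi\eta^2+3\xi\zeta^2-6A\eta^2\zeta=0$, and its origin is the inflection point $(0:1:0)$. The curve $C$ means the smooth projective curve with the given affine equation. *)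

(* Defs.v *)
From HB Require Import structures.
From mathcomp Require Import all_boot all_order all_algebra all_field.
From mathcomp Require Import mpoly.

Set Implicit Arguments.
Unset Strict Implicit.
Unset Printing Implicit Defensive.

Import GRing.Theory.
Local Open Scope ring_scope.

(** Points of P^(n-1) are represented by nonzero row vectors with [n] entries,
    up to [proj_eq]. *)

Definition proj_eq (S : fieldType) (n : nat) (v w : 'rV[S]_n) : Prop :=
  exists2 c : S, c != 0 & w = c *: v.

Definition pt3 (S : fieldType) (x y z : S) : 'rV[S]_3 :=
  \row_(i < 3) [:: x; y; z]`_i.

Definition ev (R S : fieldType) (e : R -> S) (n : nat) (p : {mpoly R[n]})
  (v : 'rV[S]_n) : S := mmap e (v 0) p.

Definition evs (R S : fieldType) (e : R -> S) (n m : nat)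
  (phi : 'rV[{mpoly R[n]}]_m) (v : 'rV[S]_n) : 'rV[S]_m :=
  \row_(j < m) ev e (phi 0 j) v.

Definition forms (R : fieldType) (n m : nat) (phi : 'rV[{mpoly R[n]}]_m)
  : Prop := exists d : nat, forall j, phi 0 j \is d.-homog.

(** Projective varieties over [k], as sets of points with coordinates in an
    algebraically closed extension [s : k -> K]. *)

Section Varieties.

Context (k : fieldType) (K : closedFieldType) (s : {rmorphism k -> K}).

Definition zeros (n : nat) (eqs : seq {mpoly k[n]}) (P : 'rV[K]_n) : Prop :=
  P != 0 /\ forall p, p \in eqs -> ev s p P = 0.

Definition jacobian (n : nat) (eqs : seq {mpoly k[n]}) (P : 'rV[K]_n)
  : 'M[K]_(size eqs, n) :=
  \matrix_(i < size eqs, j < n) ev s (eqs`_i)^`M(j) P.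

(* Jacobian criterion for a curve in P^(n-1): the rank is (n-1) - 1. *)
Definition nonsingular (n : nat) (eqs : seq {mpoly k[n]}) : Prop :=
  forall P, zeros eqs P -> (\rank (jacobian eqs P)).+2 = n.

Definition irreducible (n : nat) (V : 'rV[K]_n -> Prop) : Prop :=
  (exists P, V P) /\
  forall (d e : nat) (F G : {mpoly K[n]}),
    F \is d.-homog -> G \is e.-homog ->
    (forall P, V P -> ev idfun F P * ev idfun G P = 0) ->
    (forall P, V P -> ev idfun F P = 0) \/ (forall P, V P -> ev idfun G P = 0).

Definition infinite (n : nat) (V : 'rV[K]_n -> Prop) : Prop :=
  forall r : seq 'rV[K]_n,
    exists2 P, V P & forall Q, Q \in r -> ~ proj_eq Q P.

(* Being infinite gives dimension at least 1 and the Jacobian criterion gives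
   tangent spaces of dimension 1, so the scheme defined by [eqs] is a smooth
   (in particular reduced) curve. *)
Definition smooth_projective_curve (n : nat) (eqs : seq {mpoly k[n]}) : Prop :=
  [/\ forall p, p \in eqs -> exists d : nat, p \is d.-homog,
      irreducible (zeros eqs),
      infinite (zeros eqs)
    & nonsingular eqs].

(** Morphisms over [k]: maps given, locally on the source, by tuples of forms
    of equal degree with coefficients in [k]. *)

Definition represents (n m : nat) (V : 'rV[K]_n -> Prop)
  (f : 'rV[K]_n -> 'rV[K]_m) (phi : 'rV[{mpoly k[n]}]_m) : Prop :=
  forms phi /\
  forall Q, V Q -> evs s phi Q != 0 -> proj_eq (f Q) (evs s phi Q).

Definition morphism (n m : nat) (V : 'rV[K]_n -> Prop) (W : 'rV[K]_m -> Prop)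
  (f : 'rV[K]_n -> 'rV[K]_m) : Prop :=
  forall P, V P ->
    W (f P) /\ exists2 phi, represents V f phi & evs s phi P != 0.

Definition isomorphism (n m : nat) (V : 'rV[K]_n -> Prop)
  (W : 'rV[K]_m -> Prop) (f : 'rV[K]_n -> 'rV[K]_m) : Prop :=
  morphism V W f /\
  exists g : 'rV[K]_m -> 'rV[K]_n,
    [/\ morphism W V g,
        forall P, V P -> proj_eq (g (f P)) P
      & forall Q, W Q -> proj_eq (f (g Q)) Q].

Definition pointed_isomorphism (n m : nat)
  (V : 'rV[K]_n -> Prop) (O : 'rV[K]_n)
  (W : 'rV[K]_m -> Prop) (O' : 'rV[K]_m) (f : 'rV[K]_n -> 'rV[K]_m) : Prop :=
  [/\ isomorphism V W f, V O, W O' & proj_eq (f O) O'].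

(** Function fields. *)

(* The field generated over [k] by the ratios of the coordinates of the point
   [v], as the set of values at [v] of homogeneous rational functions. *)
Definition point_field (L : fieldType) (e : k -> L) (n : nat) (v : 'rV[L]_n)
  (h : L) : Prop :=
  exists (d : nat) (F G : {mpoly k[n]}),
    [/\ F \is d.-homog, G \is d.-homog, ev e G v != 0
      & h = ev e F v / ev e G v].

(* k(V), given with its tautological generic point: F/G is the rational
   function [ev ff_emb F ff_gen / ev ff_emb G ff_gen].  For irreducible V it
   exists and is unique up to k-isomorphism. *)
Record function_field (n : nat) (V : 'rV[K]_n -> Prop) := FunctionField {
  ff_sort :> fieldType;
  ff_emb : {rmorphism k -> ff_sort};
  ff_gen : 'rV[ff_sort]_n;
  ff_vanish : forall (d : nat) (G : {mpoly k[n]}), G \is d.-homog ->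
    (ev ff_emb G ff_gen = 0 <-> forall P, V P -> ev s G P = 0);
  ff_full : forall h : ff_sort, point_field ff_emb ff_gen h
}.

(* [L : M] = d, for a subfield M of L. *)
Definition extension_degree (L : fieldType) (M : L -> Prop) (d : nat) : Prop :=
  exists b : 'rV[L]_d, forall h : L,
    exists! c : 'rV[L]_d,
      (forall i, M (c 0 i)) /\ h = \sum_(i < d) c 0 i * b 0 i.

(* deg f = [k(V) : f^* k(W)].  If the forms phi represent f, then f^* k(W)
   consists of the (F \o phi) / (G \o phi), i.e. it is the field of the point
   [phi(ff_gen)].  A finite degree forces f to be nonconstant, hence dominant
   when V and W are curves. *)
Definition has_degree (n m : nat) (V : 'rV[K]_n -> Prop)
  (f : 'rV[K]_n -> 'rV[K]_m) (d : nat) : Prop :=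
  exists (L : function_field V) (phi : 'rV[{mpoly k[n]}]_m),
    [/\ represents V f phi, evs (ff_emb L) phi (ff_gen L) != 0
      & extension_degree
          (point_field (ff_emb L) (evs (ff_emb L) phi (ff_gen L))) d].

(** Genus: the dimension of the space of regular differential forms. *)

Definition regular_at (n : nat) (V : 'rV[K]_n -> Prop) (L : function_field V)
  (P : 'rV[K]_n) (h : L) : Prop :=
  exists (d : nat) (F G : {mpoly k[n]}),
    [/\ F \is d.-homog, G \is d.-homog, ev s G P != 0
      & h = ev (ff_emb L) F (ff_gen L) / ev (ff_emb L) G (ff_gen L)].

Definition derivation (L : fieldType) (e : k -> L) (D : L -> L) : Prop :=
  [/\ forall a, D (e a) = 0,
      forall x y, D (x + y) = D x + D y
    & forall x y, D (x * y) = D x * y + x * D y].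

(* In characteristic 0 the Kaehler differentials of k(V)/k form the dual of the
   finite dimensional k(V)-space of k-derivations; so a differential w is
   represented by its values [w D], and sum_i f_i dg_i by
   D |-> sum_i f_i * D g_i.  Values outside derivations are irrelevant.
   A differential is regular at P if it is sum_i f_i dg_i with f_i and g_i in
   the local ring at P. *)
Definition regular_differential (n : nat) (V : 'rV[K]_n -> Prop)
  (L : function_field V) (w : (L -> L) -> L) : Prop :=
  forall P, V P ->
    exists r : seq (L * L),
      (forall fg, fg \in r -> regular_at P fg.1 /\ regular_at P fg.2) /\
      forall D, derivation (ff_emb L) D -> w D = \sum_(fg <- r) fg.1 * D fg.2.

Definition has_genus (n : nat) (V : 'rV[K]_n -> Prop) (g : nat) : Prop :=
  exists (L : function_field V) (w : 'I_g -> (L -> L) -> L),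
    (forall i, regular_differential (w i)) /\
    forall v : (L -> L) -> L, regular_differential v ->
      exists! c : 'rV[k]_g, forall D, derivation (ff_emb L) D ->
        v D = \sum_(i < g) ff_emb L (c 0 i) * w i D.

End Varieties.

(** Plane cubics. *)

Section Cubics.

Context (k : fieldType) (A B : k).

Definition delta : k := 4 * A ^+ 3 + 27 * B ^+ 2.

Definition weierstrass_form : {mpoly k[3]} :=
  'X_1 ^+ 2 * 'X_2
  - ('X_0 ^+ 3 + A *: ('X_0 * 'X_2 ^+ 2) + B *: 'X_2 ^+ 3).

Definition hessian_form : {mpoly k[3]} :=
  (3 * A) *: ('X_0 ^+ 2 * 'X_2) + (9 * B) *: ('X_0 * 'X_2 ^+ 2)
  + 3 *: ('X_0 * 'X_1 ^+ 2) - A ^+ 2 *: 'X_2 ^+ 3.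

Definition cayleyan_weierstrass_form : {mpoly k[3]} :=
  - 3 *: ('X_1 ^+ 2 * 'X_2)
  - ('X_0 ^+ 3 - (18 * B) *: ('X_0 ^+ 2 * 'X_2)
     + (3 * delta) *: ('X_0 * 'X_2 ^+ 2)).

(* Smooth projective model of Y^2 = -(3 X^2 + 4 A) (X^3 + A X + B) in P^4: the
   closure of the image of (X, Y) |-> (1 : X : X^2 : X^3 : Y). *)
Definition curve_C_eqs : seq {mpoly k[5]} :=
  [:: 'X_0 * 'X_2 - 'X_1 ^+ 2;
      'X_0 * 'X_3 - 'X_1 * 'X_2;
      'X_1 * 'X_3 - 'X_2 ^+ 2;
      'X_4 ^+ 2 + (3 *: 'X_2 + (4 * A) *: 'X_0)
                  * ('X_3 + A *: 'X_1 + B *: 'X_0)].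

Context (K : closedFieldType) (s : {rmorphism k -> K}).

Definition curve_E0 : 'rV[K]_3 -> Prop := zeros s [:: weierstrass_form].

Definition hessian : 'rV[K]_3 -> Prop := zeros s [:: hessian_form].

Definition polar_conic (a : 'rV[K]_3) : {mpoly K[3]} :=
  \sum_(i < 3) a 0 i *: map_mpoly s weierstrass_form^`M(i).

Definition conic_singular_at (Q : {mpoly K[3]}) (b : 'rV[K]_3) : Prop :=
  [/\ b != 0, Q.@[b 0] = 0 & forall j, Q^`M(j).@[b 0] = 0].

(* [l] is the line l_0 x + l_1 y + l_2 z = 0 through the distinct points a and
   b. *)
Definition joining_line (a b l : 'rV[K]_3) : Prop :=
  [/\ ~ proj_eq a b, l != 0, \sum_(i < 3) l 0 i * a 0 i = 0
    & \sum_(i < 3) l 0 i * b 0 i = 0].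

(* Here b is iota(a). *)
Definition cayleyan (l : 'rV[K]_3) : Prop :=
  exists a b : 'rV[K]_3,
    [/\ hessian a, conic_singular_at (polar_conic a) b & joining_line a b l].

Definition cayleyan_weierstrass : 'rV[K]_3 -> Prop :=
  zeros s [:: cayleyan_weierstrass_form].

Definition curve_C : 'rV[K]_5 -> Prop := zeros s curve_C_eqs.

Definition affine_C (X Y : K) : Prop :=
  Y ^+ 2 = - (3 * X ^+ 2 + 4 * s A) * (X ^+ 3 + s A * X + s B).

Definition pt_C (X Y : K) : 'rV[K]_5 :=
  \row_(i < 5) [:: 1; X; X ^+ 2; X ^+ 3; Y]`_i.

(* (X, Y) |-> (1 : X : X^2 : X^3 : Y) identifies the affine curve with the open
   subset x_0 != 0 of the curve defined by [curve_C_eqs]. *)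
Definition affine_chart_C : Prop :=
  (forall X Y, affine_C X Y -> curve_C (pt_C X Y)) /\
  (forall P : 'rV[K]_5, curve_C P -> P 0 0 != 0 ->
     affine_C (P 0 1 / P 0 0) (P 0 4 / P 0 0) /\
     proj_eq (pt_C (P 0 1 / P 0 0) (P 0 4 / P 0 0)) P).

End Cubics.

(* Main.v *)
Require Import Defs.
From HB Require Import structures.
From mathcomp Require Import all_boot all_order all_algebra all_field.
From mathcomp Require Import mpoly.
From mathcomp Require Import ring zify.

Set Implicit Arguments.
Unset Strict Implicit.
Unset Printing Implicit Defensive.

Import GRing.Theory Num.Theory.
Local Open Scope ring_scope.

(** The equations of C in P^4 describe a double cover of a twisted cubic: its
    points are, up to a factor, the (1, x, x^2, x^3, y) with y^2 = f(x), where
    f = - (3 x^2 + 4 A)(x^3 + A x + B), and one point at infinity.  Around the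
    latter, u = 1/x and w = y/x^3 satisfy a similar equation w^2 = f_oo(u).  In
    each of the two charts a form restricts to a(x) + b(x) y with one-variable
    polynomials a and b, whatever the field in which it is evaluated
    ([ev_chart]).  This reduces the geometry of C to the algebra of the field
    k(X, Y) = k(X)(sqrt f(X)), which is the function field because f has odd
    degree ([hyperelliptic_exists], [vanish_on_curve]).  All conditions of
    nonvanishing come from delta <> 0 and A <> 0.  They make f separable, whence
    the Jacobian criterion ([curve_C_nonsingular]), and irreducibility follows
    from the existence of the function field over the algebraic numbers
    themselves ([curve_C_irreducible]).

    Genus.  The derivations of k(X, Y) form a line, spanned by D0 with D0 X = 2Y
    and D0 Y = f'(X), so a differential v is determined by h = v(D0).  Since D0
    preserves the local rings of the affine curve, regularity of v makes h an
    element of k[X] + k[X] Y ([local_everywhere]); regularity at infinity leaves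
    only h = a + b X ([infinity_pole_bound]).  Conversely dX/Y and X dX/Y are
    regular ([regular_basis]).

    Degrees.  For both maps the first coordinate generates the same field as a
    cubic fraction t = N(X)/D(X).  The second, y, is Y times a function of X, and
    y^2 is in k(t).  So the degree is [k(X) : k(t)] = 3, with basis 1, X, X^2:
    independence is a descent modulo N ([substitute_free]) and generation
    follows from a Bezout relation with N - t D ([cubic_span]).

    Cayleyan.  That b is the singular point of the polar conic of a amounts to
    three symmetric bilinear equations in a and b.  Solving them on a given line
    shows that the line joins such a pair if and only if its coordinates satisfy
    the dual cubic ([cayleyanE]); a linear change of coordinates then gives the
    Weierstrass form ([cayleyan_isomorphism]).  The maps psi1 and psi2 are
    morphisms because Y^2 = f(X) turns their formulas into a second tuple of
    forms, without zeros where the first one vanishes ([psi1_morphism],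
    [psi2_morphism]). *)

(** * Polynomials evaluated along ring morphisms *)

(** Certificates: after [apply: (eq_lin (u := u) h)] it remains to check that
    the goal is, up to a ring identity, [u] times the hypothesis [h]. *)
Lemma eq_lin (R : pzRingType) (u c d a b : R) :
  c = d -> a - b = u * (c - d) -> a = b.
Proof. by move=> -> /eqP; rewrite subrr mulr0 subr_eq0 => /eqP. Qed.

Definition peval (R S : comNzRingType) (e : {rmorphism R -> S}) (x : S)
  (p : {poly R}) : S := (map_poly e p).[x].

Section PEval.
Context (R S : comNzRingType) (e : {rmorphism R -> S}) (x : S).

Lemma peval_is_zmod_morphism : zmod_morphism (peval e x).
Proof. by move=> p q; rewrite /peval rmorphB hornerD hornerN. Qed.

Lemma peval_is_monoid_morphism : monoid_morphism (peval e x).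
Proof. by split=> [|p q]; rewrite /peval ?rmorph1 ?hornerC // rmorphM hornerM. Qed.

HB.instance Definition _ := GRing.isZmodMorphism.Build {poly R} S (peval e x)
  peval_is_zmod_morphism.
HB.instance Definition _ := GRing.isMonoidMorphism.Build {poly R} S (peval e x)
  peval_is_monoid_morphism.

Lemma pevalX : peval e x 'X = x.
Proof. by rewrite /peval map_polyX hornerX. Qed.

Lemma pevalC c : peval e x c%:P = e c.
Proof. by rewrite /peval map_polyC hornerC. Qed.

Lemma pevalZ c p : peval e x (c *: p) = e c * peval e x p.
Proof. by rewrite -mul_polyC rmorphM /= pevalC. Qed.

End PEval.

(** * The ring k[x, y] / (y^2 - f) *)

(** The pair (a, b) stands for the element a(x) + b(x) y.  Since [e], [x] and
    [y] vary freely, one pair is evaluated both at the points of a curve and at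
    its generic point. *)
Definition qeval (R S : comNzRingType) (e : {rmorphism R -> S}) (x y : S)
  (p : {poly R} * {poly R}) : S := peval e x p.1 + peval e x p.2 * y.

Definition qmul (R : comNzRingType) (f : {poly R}) (p q : {poly R} * {poly R}) :=
  (p.1 * q.1 + p.2 * q.2 * f, p.1 * q.2 + p.2 * q.1).

Lemma qevalM (R S : comNzRingType) (e : {rmorphism R -> S}) f x y p q :
  y ^+ 2 = peval e x f ->
  qeval e x y (qmul f p q) = qeval e x y p * qeval e x y q.
Proof.
by move=> yf; rewrite /qeval /qmul /= !(rmorphD, rmorphM) /= -yf; ring.
Qed.

Lemma mpoly_closed (R : comNzRingType) n (P : {mpoly R[n]} -> Prop) :
  (forall c, P c%:MP) -> (forall i, P 'X_i) ->
  (forall p q, P p -> P q -> P (p + q)) ->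
  (forall p q, P p -> P q -> P (p * q)) -> forall p, P p.
Proof.
move=> PC PX PD PM p; rewrite (mpolyE p); apply: big_ind => [||m _]; [|exact: PD|].
  by rewrite -mpolyC0; apply: PC.
rewrite -mul_mpolyC; apply: (PM) => //; rewrite mpolyXE_id; apply: big_ind.
- by rewrite -mpolyC1; apply: PC.
- exact: PM.
by move=> i _; elim: (m i) => [|j IH]; rewrite ?expr0 ?exprS -?mpolyC1; [apply: PC | apply: PM].
Qed.

(** One pair serves all fields [S] at once.  This is what transfers the
    vanishing of a form between the generic point and the geometric points. *)
Lemma mmap_qeval (R : comNzRingType) n (f : {poly R})
  (c : 'I_n -> {poly R} * {poly R}) (G : {mpoly R[n]}) :
  exists p, forall (S : comNzRingType) (e : {rmorphism R -> S}) x y,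
    y ^+ 2 = peval e x f ->
    mmap e (fun i => qeval e x y (c i)) G = qeval e x y p.
Proof.
elim/mpoly_closed: G => [a|i|p q [u Hu] [v Hv]|p q [u Hu] [v Hv]].
- by exists (a%:P, 0) => S e x y _; rewrite mmapC /qeval /= rmorph0 mul0r addr0 pevalC.
- by exists (c i) => S e x y _; rewrite mmapX mmap1U.
- exists (u.1 + v.1, u.2 + v.2) => S e x y yf.
  by rewrite rmorphD /= Hu // Hv // /qeval /= !rmorphD; ring.
- exists (qmul f u v) => S e x y yf.
  by rewrite rmorphM /= Hu // Hv // qevalM.
Qed.

(** * Fields k(x, y) with y^2 = f(x) *)

Local Notation tf := (@FracField.tofrac _).

Lemma fracP (R : idomainType) (r : {fraction R}) :
  exists a b, b != 0 /\ r = FracField.tofrac a / FracField.tofrac b.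
Proof.
elim/quotW: r => -[[a b] /= b0]; exists a, b; split=> //.
apply: (canRL (mulfK _)); first by rewrite tofrac_eq0.
rewrite /FracField.tofrac; unlock; rewrite -[LHS]FracField.pi_mul.
apply/eqmodP; rewrite /= FracField.equivfE /FracField.mulf /=.
by rewrite !numden_Ratio ?mulf_neq0 ?oner_neq0 //= !mulr1 mulrC.
Qed.

Lemma peval_unique (R S : comNzRingType) (e : {rmorphism R -> S})
  (i : {rmorphism {poly R} -> S}) :
  (forall c, i c%:P = e c) -> forall p, peval e (i 'X) p = i p.
Proof.
move=> ie; elim/poly_ind=> [|p c IH]; first by rewrite !rmorph0.
by rewrite !rmorphD !rmorphM /= IH pevalX pevalC ie.
Qed.

(** Freeness of 1, y over k[x] says that x is transcendental over k and that y
    is not in k(x). *)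
Record hyperelliptic (k L : fieldType) (e : {rmorphism k -> L}) (f : {poly k})
  (x y : L) : Prop := Hyperelliptic {
  hyp_eq : y ^+ 2 = peval e x f;
  hyp_free : forall p, qeval e x y p = 0 -> p = (0, 0)
}.

Definition spans_field (k L : fieldType) (e : {rmorphism k -> L}) (x y : L) :=
  forall h : L, exists p (c : {poly k}),
    peval e x c != 0 /\ h = qeval e x y p / peval e x c.

(** Compare the parities of the degrees. *)
Lemma sqr_eq_odd (k : fieldType) (f a b : {poly k}) :
  ~~ odd (size f) -> f != 0 -> a ^+ 2 = b ^+ 2 * f -> b = 0.
Proof.
move=> of_ f0 E; apply/eqP; case: (eqVneq b 0) => // b0.
have a0 : a != 0 by rewrite -sqrf_eq0 E mulf_neq0 // expf_neq0.
have /(congr1 odd) := congr1 (fun p : {poly k} => size p) E.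
rewrite size_mul ?expf_neq0 // !expr2 !size_mul ?mulf_neq0 //.
have [sa [sb sf]] : [/\ 0 < size a, 0 < size b & 0 < size f]%N.
  by rewrite !size_poly_gt0.
case: (size a) sa => // i _; case: (size b) sb => // j _.
case: (size f) sf of_ => // l _ /=.
by rewrite !(addnS, addSn) /= !oddD !addbb /= => /negbNE ->.
Qed.

(** Adjoin a root of T^2 - d, which is irreducible since it is quadratic without
    roots. *)
Lemma quadratic_extension (F : fieldType) (d : F) :
  (forall r, r ^+ 2 != d) ->
  exists (L : fieldType) (i : {rmorphism F -> L}) (z : L),
    [/\ z ^+ 2 = i d,
        forall u v, i u + i v * z = 0 -> u = 0 /\ v = 0
      & forall h, exists u v, h = i u + i v * z].
Proof.
move=> nosqrt.
suff [L [i [z [zd span]]]] : exists (L : fieldType) (i : {rmorphism F -> L}) (z : L),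
    z ^+ 2 = i d /\ forall h, exists q, h = peval i z q.
  exists L, i, z; split=> // [u v E|h].
    suff v0 : v = 0.
      by move: E; rewrite v0 rmorph0 mul0r addr0 => /eqP; rewrite fmorph_eq0 => /eqP.
    apply/eqP; case: (eqVneq v 0) => // v0.
    have iv0 : i v != 0 by rewrite fmorph_eq0.
    have [] := negP (nosqrt (- u / v)); rewrite -(inj_eq (fmorph_inj i)) -zd rmorphXn.
    rewrite fmorph_div rmorphN; apply/eqP; congr (_ ^+ 2).
    by apply/(canLR (mulfK iv0))/eqP; rewrite eq_sym -addr_eq0 addrC mulrC E.
  have [q ->] := span h; elim/poly_ind: q => [|q c [u [v IH]]].
    by exists 0, 0; rewrite !rmorph0 mul0r addr0.
  exists (v * d + c), u; rewrite !rmorphD !rmorphM /= pevalX pevalC IH -zd.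
  by ring.
pose p : {poly F} := 'X^2 - d%:P.
have noroot r : ~~ root p r.
  by rewrite rootE /p hornerD hornerN hornerXn hornerC subr_eq0.
have szp : size p = 3.
  by rewrite size_polyDl ?size_polyXn // size_polyN ltnS (leq_trans (size_polyC_leq1 _)).
have irr : irreducible_poly p by apply: cubic_irreducible; rewrite ?szp.
have [L _ [z pz full]] := irredp_FAdjoin irr.
exists L, (in_alg L), z; split=> [|h].
  move: pz; rewrite rootE /p rmorphB /= map_polyXn map_polyC hornerD hornerN.
  by rewrite hornerXn hornerC subr_eq0 => /eqP.
have : h \in <<1; z>>%VS by rewrite full memvf.
by case/Fadjoin1_polyP => q ->; exists q.
Qed.

Lemma hyperelliptic_exists (k : fieldType) (f : {poly k}) :
  ~~ odd (size f) -> f != 0 ->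
  exists (L : fieldType) (e : {rmorphism k -> L}) (x y : L),
    hyperelliptic e f x y /\ spans_field e x y.
Proof.
move=> of_ f0.
have [|L [i [z [zf free span]]]] := @quadratic_extension _ (tf f).
  move=> r; apply/negP; have [a [b [b0 ->]]] := fracP r.
  rewrite expr_div_n => /eqP /(congr1 (fun u => u * tf b ^+ 2)).
  rewrite divfK ?expf_neq0 ?tofrac_eq0 //.
  move/eqP; rewrite -!rmorphXn -rmorphM /= tofrac_eq => /eqP E.
  by move: b0; rewrite (sqr_eq_odd of_ f0 (b := b) (a := a)) ?eqxx // E mulrC.
pose e : {rmorphism k -> L} := (i \o (tf \o polyC))%FUN.
have pevalE q : peval e (i (tf 'X)) q = i (tf q).
  exact: (@peval_unique _ _ e (i \o tf)%FUN).
exists L, e, (i (tf 'X)), z; split; first split; first by rewrite pevalE.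
  move=> [a b]; rewrite /qeval /= !pevalE => /free[/eqP + /eqP].
  by rewrite !tofrac_eq0 => /eqP -> /eqP ->.
move=> h; have [u [v ->]] := span h.
have [a [b [b0 ->]]] := fracP u; have [c [d [d0 ->]]] := fracP v.
exists (a * d, c * b), (b * d).
rewrite /qeval /= !pevalE !fmorph_div !rmorphM /=.
have b1 : i (tf b) != 0 by rewrite fmorph_eq0 tofrac_eq0.
have d1 : i (tf d) != 0 by rewrite fmorph_eq0 tofrac_eq0.
split; first exact: mulf_neq0.
field; exact/andP.
Qed.

(** * Derivations of k(x, y) *)

(** The derivation of k[x, y] / (y^2 - f) with x |-> 2y and y |-> f'.  It is
    2y d/dx, scaled so as to have no denominator: it preserves the coordinate
    ring, hence every local ring of the affine curve. *)
Definition qder (R : comNzRingType) (f : {poly R}) (p : {poly R} * {poly R}) :=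
  ((f * p.2^`()) *+ 2 + p.2 * f^`(), p.1^`() *+ 2).

Lemma qevalD (R S : comNzRingType) (e : {rmorphism R -> S}) x y p q :
  qeval e x y (p.1 + q.1, p.2 + q.2) = qeval e x y p + qeval e x y q.
Proof. by rewrite /qeval /= !rmorphD; ring. Qed.

Lemma qevalN (R S : comNzRingType) (e : {rmorphism R -> S}) x y p :
  qeval e x y (- p.1, - p.2) = - qeval e x y p.
Proof. by rewrite /qeval /= !rmorphN; ring. Qed.

Lemma qeval_poly (R S : comNzRingType) (e : {rmorphism R -> S}) x y c :
  qeval e x y (c, 0) = peval e x c.
Proof. by rewrite /qeval /= rmorph0 mul0r addr0. Qed.

Lemma qeval_derM (R S : comNzRingType) (e : {rmorphism R -> S}) f x y p q :
  y ^+ 2 = peval e x f ->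
  qeval e x y (qder f (qmul f p q)) =
  qeval e x y (qder f p) * qeval e x y q + qeval e x y p * qeval e x y (qder f q).
Proof.
move=> yf; rewrite /qeval /qder /qmul /= !(derivD, derivM).
by rewrite !(rmorphMn, rmorphD, rmorphM) /= -yf; ring.
Qed.

Section Derivations.
Context (k L : fieldType) (e : {rmorphism k -> L}) (f : {poly k}) (x y : L).
Hypotheses (two0 : 2 != 0 :> L) (f0 : f != 0) (H : hyperelliptic e f x y).

Let yf := hyp_eq H.

Lemma qeval_inj p q : qeval e x y p = qeval e x y q -> p = q.
Proof.
move/eqP; rewrite -subr_eq0 -qevalN -qevalD => /eqP/(hyp_free H)[] /eqP + /eqP.
by rewrite !subr_eq0; case: p q => [a b] [c d] /= /eqP -> /eqP ->.
Qed.

Lemma peval_inj p q : peval e x p = peval e x q -> p = q.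
Proof. by rewrite -!(qeval_poly _ x y) => /qeval_inj[]. Qed.

Lemma hyp_x_neq0 : x != 0.
Proof.
apply/eqP => x0; have /(hyp_free H)[] : qeval e x y ('X, 0) = 0.
  by rewrite qeval_poly pevalX.
by move/eqP; rewrite polyX_eq0.
Qed.

Lemma hyp_y_neq0 : y != 0.
Proof.
apply: contra f0 => /eqP y0; apply/eqP/peval_inj.
by rewrite -yf y0 rmorph0 expr0n.
Qed.

Lemma derivation_peval D p : derivation e D ->
  D (peval e x p) = peval e x p^`() * D x.
Proof.
case=> D0 DD DM; elim/poly_ind: p => [|p c IH].
  by rewrite deriv0 !rmorph0 mul0r -[RHS](D0 0) rmorph0.
rewrite derivD derivM derivX derivC addr0 mulr1.
rewrite !rmorphD !rmorphM /= !pevalX !pevalC DD DM IH D0; ring.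
Qed.

(** Differentiating y^2 = f(x) gives 2y dy = f'(x) dx, so every derivation
    is a multiple of the one given by [qder]. *)
Lemma derivation_qeval D p : derivation e D ->
  2 * y * D (qeval e x y p) = D x * qeval e x y (qder f p).
Proof.
move=> dD; have [D0 DD DM] := dD.
have Dy : 2 * y * D y = peval e x f^`() * D x.
  by rewrite -(derivation_peval f dD) -yf expr2 DM; ring.
rewrite /qeval /qder /= DD DM !derivation_peval //.
rewrite !(rmorphMn, rmorphD, rmorphM) /= -yf.
by apply: (eq_lin (u := peval e x p.2) Dy); ring.
Qed.

(** The k-derivations of k(x, y) form a line: a derivation is determined by
    its value at x. *)
Lemma derivation_proportional D D' h : spans_field e x y ->
  derivation e D -> derivation e D' -> D' x * D h = D x * D' h.
Proof.
move=> span dD dD'; have [p [c [c0 hE]]] := span h.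
have E : h * peval e x c = qeval e x y p by rewrite hE divfK.
have [D0 DD DM] := dD; have [D0' DD' DM'] := dD'.
have yq := hyp_y_neq0; have y2 : 2 * y != 0 by rewrite mulf_neq0.
apply: (mulfI (mulf_neq0 y2 c0)).
have := derivation_qeval p dD; have := derivation_qeval p dD'.
rewrite -E DM DM' (derivation_peval c dD) (derivation_peval c dD').
move=> E1 E2; apply: (eq_lin (u := D' x) E2).
apply: (eq_lin (u := - D x) E1); ring.
Qed.

Let den_num (h : L) (mp : ({poly k} * {poly k}) * ({poly k} * {poly k})) :=
  (qeval e x y mp.1 != 0) && (h * qeval e x y mp.1 == qeval e x y mp.2).

(** The quotient rule forces the value at h = p / m, and freeness of 1, y
    makes it independent of the chosen fraction. *)
Lemma hyperelliptic_derivation : spans_field e x y ->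
  exists D, derivation e D /\ D x = 2 * y.
Proof.
move=> span; have ex h : exists mp, den_num h mp.
  have [p [c [c0 hE]]] := span h; exists ((c, 0), p).
  by rewrite /den_num /= qeval_poly c0 hE divfK /=.
pose D h := let mp := xchoose (ex h) in
  (qeval e x y (qder f mp.2) - h * qeval e x y (qder f mp.1)) / qeval e x y mp.1.
have DE h m p : qeval e x y m != 0 -> h * qeval e x y m = qeval e x y p ->
    D h * qeval e x y m + h * qeval e x y (qder f m) = qeval e x y (qder f p).
  move=> m0 hm; rewrite /D; set mp := xchoose _.
  have /andP[n0 /eqP hn] : den_num h mp := xchooseP _.
  case: mp n0 hn => n q /= n0 hn.
  have /(congr1 (fun u => qeval e x y (qder f u))) : qmul f p n = qmul f q m.
    by apply: qeval_inj; rewrite !qevalM // -hm -hn; ring.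
  rewrite !qeval_derM // -hm -hn => E.
  apply: (mulfI n0); apply: (eq_lin (u := 1) (esym E)); field; exact: n0.
have Dq p : D (qeval e x y p) = qeval e x y (qder f p).
  have := DE (qeval e x y p) (1, 0) p; rewrite qeval_poly rmorph1 oner_eq0 mulr1.
  move=> /(_ isT erefl) <-; rewrite /qder /= !deriv0 derivC.
  by rewrite !(mulr0, mul0r, mul0rn, addr0) /qeval /= !rmorph0 mul0r addr0 !mulr0 addr0 mulr1.
have num h : exists m p, qeval e x y m != 0 /\ h * qeval e x y m = qeval e x y p.
  by have [[m p] /andP[m0 /eqP E]] := ex h; exists m, p.
exists D; split; first split=> [a|u v|u v].
- rewrite -[e a](pevalC e x) -(qeval_poly e x y) Dq /qder /= deriv0 derivC.
  by rewrite !(mulr0, mul0r, mul0rn, addr0) /qeval /= !rmorph0 mul0r addr0.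
- have [m [p [m0 mp]]] := num u; have [n [q [n0 nq]]] := num v.
  have := DE (u + v) (qmul f m n) ((qmul f p n).1 + (qmul f q m).1, (qmul f p n).2 + (qmul f q m).2).
  rewrite qevalD !qevalM // mulf_neq0 // -mp -nq => /(_ isT).
  have -> : qeval e x y (qder f ((qmul f p n).1 + (qmul f q m).1, (qmul f p n).2 + (qmul f q m).2)) = qeval e x y (qder f (qmul f p n)) + qeval e x y (qder f (qmul f q m)).
    rewrite -qevalD; congr qeval; rewrite /qder /= !derivD; congr pair; last ring.
    by ring.
  rewrite !qeval_derM // -(DE _ _ _ m0 mp) -(DE _ _ _ n0 nq) -mp -nq => E.
  apply: (mulIf (mulf_neq0 m0 n0)); apply: (addIr ((u + v) *
   (qeval e x y (qder f m) * qeval e x y n + qeval e x y m * qeval e x y (qder f n)))).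
  by rewrite E; [ring | ring].
- have [m [p [m0 mp]]] := num u; have [n [q [n0 nq]]] := num v.
  have := DE (u * v) (qmul f m n) (qmul f p q).
  rewrite !qevalM // mulf_neq0 // -mp -nq => /(_ isT).
  rewrite !qeval_derM // -(DE _ _ _ m0 mp) -(DE _ _ _ n0 nq) -mp -nq => E.
  apply: (mulIf (mulf_neq0 m0 n0)); apply: (addIr ((u * v) *
   (qeval e x y (qder f m) * qeval e x y n + qeval e x y m * qeval e x y (qder f n)))).
  by rewrite E; [ring | ring].
have -> : x = qeval e x y ('X, 0) by rewrite qeval_poly pevalX.
rewrite Dq /qder /qeval /= derivX deriv0 !(mulr0, mul0r, mul0rn, addr0, add0r) rmorph0 add0r.
by rewrite rmorphMn rmorph1.
Qed.

End Derivations.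

(** * Local rings of an affine hyperelliptic curve *)

(** The local ring at the point (x0, y0), written without division: as m does
    not vanish there, freeness makes m(x, y) nonzero in L. *)
Definition local_at (k L K : fieldType) (e : {rmorphism k -> L})
  (s : {rmorphism k -> K}) (x y : L) (x0 y0 : K) (h : L) : Prop :=
  exists m p, qeval s x0 y0 m != 0 /\ h * qeval e x y m = qeval e x y p.

Section LocalRings.
Context (k L K : fieldType) (e : {rmorphism k -> L}) (s : {rmorphism k -> K}).
Context (f : {poly k}) (x y : L) (x0 y0 : K).
Hypotheses (f0 : f != 0) (H : hyperelliptic e f x y).
Hypothesis y0f : y0 ^+ 2 = peval s x0 f.

Let yf := hyp_eq H.
Local Notation loc := (local_at e s x y x0 y0).

Lemma local_qeval p : loc (qeval e x y p).
Proof.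
exists (1, 0), p; rewrite !qeval_poly !rmorph1 oner_eq0 mulr1; by split.
Qed.

Lemma local_gens : loc x /\ loc y.
Proof.
have := local_qeval ('X, 0); have := local_qeval (0, 1).
by rewrite qeval_poly pevalX /qeval /= rmorph0 rmorph1 mul1r add0r.
Qed.

Lemma localD g h : loc g -> loc h -> loc (g + h).
Proof.
move=> [m [p [m0 mp]]] [n [q [n0 nq]]]; exists (qmul f m n).
exists ((qmul f p n).1 + (qmul f q m).1, (qmul f p n).2 + (qmul f q m).2).
rewrite qevalD !qevalM // mulf_neq0 // -mp -nq; split=> //; ring.
Qed.

Lemma localM g h : loc g -> loc h -> loc (g * h).
Proof.
move=> [m [p [m0 mp]]] [n [q [n0 nq]]]; exists (qmul f m n), (qmul f p q).
rewrite !qevalM // mulf_neq0 // -mp -nq; split=> //; ring.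
Qed.

(** By the quotient rule, and because [qder] maps pairs to pairs. *)
Lemma local_derivation D h : 2 != 0 :> L -> derivation e D -> D x = 2 * y ->
  loc h -> loc (D h).
Proof.
move=> two0 dD Dx [m [p [m0 mp]]].
have y2 : 2 * y != 0 by rewrite mulf_neq0 // (hyp_y_neq0 f0 H).
have Dq r : D (qeval e x y r) = qeval e x y (qder f r).
  by apply: (mulfI y2); rewrite (derivation_qeval H r dD) Dx.
exists (qmul f m m), ((qmul f (qder f p) m).1 - (qmul f p (qder f m)).1,
  (qmul f (qder f p) m).2 - (qmul f p (qder f m)).2).
split; first by rewrite qevalM // mulf_neq0.
rewrite (qevalD e x y _ (- (qmul f p (qder f m)).1, - (qmul f p (qder f m)).2)).
rewrite qevalN !qevalM // -mp -!Dq -mp; case: dD => _ _ ->; ring.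
Qed.

End LocalRings.

(** The norm from k(x, y) to k(x); it clears y from denominators. *)
Lemma qconj_norm (R S : comNzRingType) (e : {rmorphism R -> S}) f x y m :
  y ^+ 2 = peval e x f ->
  qeval e x y m * qeval e x y (m.1, - m.2) = peval e x (m.1 ^+ 2 - m.2 ^+ 2 * f).
Proof.
move=> yf; rewrite /qeval /= !(rmorphB, rmorphN, rmorphM, rmorphXn) /= -yf; ring.
Qed.

Lemma root_gcdp_map (k : fieldType) (s : {rmorphism k -> algC})
  (p q : {poly k}) z :
  peval s z p = 0 -> peval s z q = 0 -> peval s z (gcdp p q) = 0.
Proof.
by rewrite /peval gcdp_map => /rootP zp /rootP zq; apply/rootP; rewrite root_gcd zp.
Qed.

(** Write h = p / c with c in k[x].  At a root z of c, regularity at both points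
    (z, y0) and (z, -y0) makes z a common root of both components of p, so
    that h has a denominator of smaller degree.  The coordinate ring is thus
    the intersection of its local rings. *)
Lemma local_everywhere (k L : fieldType) (e : {rmorphism k -> L})
  (s : {rmorphism k -> algC}) f x y h :
  hyperelliptic e f x y -> spans_field e x y ->
  (forall x0 y0 : algC, y0 ^+ 2 = peval s x0 f -> local_at e s x y x0 y0 h) ->
  exists p, h = qeval e x y p.
Proof.
move=> H span loc; have yf := hyp_eq H.
suff descent n p (c : {poly k}) : (size c <= n)%N -> c != 0 ->
    h * peval e x c = qeval e x y p -> exists q, h = qeval e x y q.
  have [p [c [c0 hE]]] := span h; apply: (descent (size c) p c) => //.
    by apply: contraNneq c0 => ->; rewrite rmorph0.
  by rewrite hE divfK.
elim: n p c => [|n IH] p c; first by rewrite leqn0 size_poly_eq0 => ->.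
move=> szc c0 hc.
have [/size_poly1P[u u0 cE]|] := boolP (size c == 1%N).
  exists (u^-1 *: p.1, u^-1 *: p.2).
  have eu0 : e u != 0 by rewrite fmorph_eq0.
  rewrite /qeval /= !pevalZ -mulrA -mulrDr -/(qeval e x y p) -hc cE pevalC fmorphV.
  by field.
rewrite -(size_map_poly s) => /closed_rootP[z /rootP zc].
have zpm y0 : y0 ^+ 2 = peval s z f -> qeval s z y0 p = 0 /\
    (y0 = 0 -> peval s z p.2 = 0).
  move=> y0f; have [m [r [m0 hm]]] := loc z y0 y0f.
  have E : qmul f p m = qmul f r (c, 0).
    by apply: (qeval_inj H); rewrite !qevalM // qeval_poly -hc -hm; ring.
  have p0 : qeval s z y0 p = 0.
    apply/eqP; have := congr1 (qeval s z y0) E; rewrite !qevalM // qeval_poly.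
    rewrite [peval s z c]zc mulr0 => /eqP.
    by rewrite mulf_eq0 (negbTE m0) orbF.
  (* At a branch point y0 = 0 only the coefficients of y carry information. *)
  split=> // y00; have /(congr1 (fun q => peval s z q.2)) := E.
  rewrite /= mulr0 add0r !rmorphD !rmorphM /= [peval s z c]zc mulr0.
  move: m0 p0; rewrite /qeval y00 !mulr0 !addr0 => m0 -> /eqP.
  by rewrite mul0r add0r mulf_eq0 (negbTE m0) orbF => /eqP.
pose y0 := sqrtC (peval s z f).
have y0f : y0 ^+ 2 = peval s z f by rewrite sqrtCK.
have [zp p2y] := zpm y0 y0f.
have [zp' _] := zpm (- y0) (etrans (sqrrN _) y0f).
have two0 : 2 != 0 :> algC by rewrite pnatr_eq0.
have z1 : peval s z p.1 = 0.
  apply: (mulfI two0); rewrite mulr0 -[RHS]addr0 -{1}zp -zp' /qeval; ring.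
have z2 : peval s z p.2 = 0.
  move/eqP: zp; rewrite /qeval z1 add0r mulf_eq0 => /orP[/eqP //|/eqP].
  exact: p2y.
(* z is a root of g, so dividing by g lowers the degree of c *)
pose g := gcdp (gcdp p.1 p.2) c.
have zg : peval s z g = 0 by do 2!apply: root_gcdp_map => //.
have g0 : g != 0 by rewrite gcdp_eq0 (negbTE c0) andbF.
have sg : (1 < size g)%N.
  rewrite -(size_map_poly s); apply: (root_size_gt1 (a := z)).
    by rewrite map_poly_eq0.
  exact/rootP.
have gc : g %| c by apply: dvdp_gcdr.
have gp1 : g %| p.1 by apply: dvdp_trans (dvdp_gcdl _ _) (dvdp_gcdl _ _).
have gp2 : g %| p.2 by apply: dvdp_trans (dvdp_gcdl _ _) (dvdp_gcdr _ _).
apply: (IH (p.1 %/ g, p.2 %/ g) (c %/ g)).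
- rewrite size_divp // -ltnS (leq_trans _ szc) // ltn_subrL.
  by rewrite size_poly_gt0 c0 andbT -subn1 subn_gt0.
- by rewrite dvdp_div_eq0.
have eg0 : peval e x g != 0.
  by apply: contra g0 => /eqP E; apply/eqP/(peval_inj H); rewrite E rmorph0.
apply: (mulIf eg0); rewrite -mulrA -rmorphM /= divpK // hc /qeval /=.
rewrite mulrDl -rmorphM /= divpK // mulrAC -rmorphM /= divpK //.
Qed.

(** * Forms evaluated at points *)

Section Eval.
Context (R S : fieldType) (e : {rmorphism R -> S}) (n : nat) (v : 'rV[S]_n).
Implicit Types p q : {mpoly R[n]}.

Lemma ev0 : ev e 0 v = 0. Proof. exact: mmap0. Qed.
Lemma evD p q : ev e (p + q) v = ev e p v + ev e q v. Proof. exact: mmapD. Qed.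
Lemma evN p : ev e (- p) v = - ev e p v. Proof. exact: mmapN. Qed.
Lemma evM p q : ev e (p * q) v = ev e p v * ev e q v. Proof. exact: rmorphM. Qed.
Lemma evXn p m : ev e (p ^+ m) v = ev e p v ^+ m. Proof. exact: rmorphXn. Qed.
Lemma evZ c p : ev e (c *: p) v = e c * ev e p v. Proof. exact: mmapZ. Qed.
Lemma evC c : ev e c%:MP v = e c. Proof. exact: mmapC. Qed.
Lemma ev1 : ev e 1 v = 1. Proof. by rewrite -mpolyC1 evC rmorph1. Qed.
Lemma evX i : ev e 'X_i v = v 0 i.
Proof. by rewrite /ev mmapX mmap1U. Qed.

Definition evE := (ev0, evD, evN, evM, evXn, evZ, evC, ev1, evX).

Lemma ev_scale d G c : G \is d.-homog -> ev e G (c *: v) = c ^+ d * ev e G v.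
Proof.
move=> /dhomogP hG; rewrite /ev /mmap mulr_sumr; apply: eq_big_seq => m mG.
have := hG m mG; rewrite /= mdegE => <-; rewrite mulrCA; congr (_ * _).
rewrite /mmap1 -prodrXr -big_split /=.
by apply: eq_bigr => i _; rewrite mxE exprMn.
Qed.
End Eval.

(** * The two charts of C *)

(** The reversal X^n p(1/X), which exchanges the two charts. *)
Definition revp (R : nzRingType) n (p : {poly R}) : {poly R} :=
  \poly_(i < n.+1) p`_(n - i).

Lemma peval_revp (R S : fieldType) (e : {rmorphism R -> S}) (x : S) n (p : {poly R}) :
  x != 0 -> (size p <= n.+1)%N ->
  peval e x^-1 p * x ^+ n = peval e x (revp n p).
Proof.
move=> x0 sp; rewrite /peval (@horner_coef_wide _ n.+1) ?size_map_poly //.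
rewrite (@horner_coef_wide _ n.+1) ?size_map_poly ?size_poly // mulr_suml.
rewrite (reindex_inj rev_ord_inj) /=; apply: eq_bigr => i _.
rewrite !coef_map coef_poly ltn_ord subSS -mulrA; congr (_ * _).
have -> : x ^+ n = x ^+ (n - i) * x ^+ i by rewrite -exprD subnK // leq_ord.
rewrite mulrA -exprMn mulVf // expr1n mul1r.
by [].
Qed.

Lemma revp_eq0 (R : nzRingType) n (p : {poly R}) :
  (size p <= n.+1)%N -> revp n p = 0 -> p = 0.
Proof.
move=> sp /polyP r0; apply/polyP=> i; rewrite coef0.
have [lin|lni] := leqP i n; last by rewrite nth_default // (leq_trans sp).
by have := r0 (n - i)%N; rewrite coef0 coef_poly ltnS leq_subr subKn.
Qed.

(** The coordinates in the chart x_0 = 1 for [true], x_3 = 1 for [false]. *)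
Definition chart_coords (R : comNzRingType) (b : bool) (i : 'I_5) : {poly R} * {poly R} :=
  nth (0, 0) (if b then [:: (1, 0); ('X, 0); ('X ^+ 2, 0); ('X ^+ 3, 0); (0, 1)]
   else [:: ('X ^+ 3, 0); ('X ^+ 2, 0); ('X, 0); (1, 0); (0, 1)]) i.

Definition chart_pt (S : fieldType) (b : bool) (x y : S) : 'rV[S]_5 :=
  \row_(i < 5) (if b then [:: 1; x; x ^+ 2; x ^+ 3; y]
                else [:: x ^+ 3; x ^+ 2; x; 1; y])`_i.

Lemma chart_ptE (R S : fieldType) (e : {rmorphism R -> S}) b x y i :
  chart_pt b x y 0 i = qeval e x y (chart_coords R b i).
Proof.
rewrite mxE /chart_coords /qeval; case: b i => -[[|[|[|[|[|i]]]]] //=] _;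
by rewrite ?(rmorph1, rmorph0, rmorphXn, mul0r, mul1r, addr0, add0r) /= ?pevalX.
Qed.

Lemma ev_chart (R : fieldType) (f : {poly R}) b (G : {mpoly R[5]}) :
  exists p, forall (S : fieldType) (e : {rmorphism R -> S}) x y,
    y ^+ 2 = peval e x f -> ev e G (chart_pt b x y) = qeval e x y p.
Proof.
have [p Hp] := mmap_qeval f (chart_coords R b) G.
exists p => S e x y yf; rewrite -Hp // /ev /mmap; apply: eq_bigr => m _.
by congr (_ * _); apply: mmap1_eq => i; apply: chart_ptE.
Qed.

Section Curve.
Context (k : fieldType) (A B : k).

(** The second polynomial f_oo(u) = u^6 f(1/u) describes C near its point at
    infinity u = w = 0, where u = 1/x and w = y/x^3. *)
Definition chart_poly (b : bool) : {poly k} :=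
  if b then - (3 *: 'X^2 + (4 * A)%:P) * ('X^3 + A *: 'X + B%:P)
  else - (3 *: 'X + (4 * A) *: 'X^3) * (1 + A *: 'X^2 + B *: 'X^3).

Lemma chart_polyE (S : fieldType) (e : {rmorphism k -> S}) b x :
  peval e x (chart_poly b) =
  if b then - (3 * x ^+ 2 + 4 * e A) * (x ^+ 3 + e A * x + e B)
  else - (3 * x + 4 * e A * x ^+ 3) * (1 + e A * x ^+ 2 + e B * x ^+ 3).
Proof.
case: b; rewrite /chart_poly !(rmorphN, rmorphD, rmorphM) /= !(pevalZ, pevalC);
by rewrite !(rmorphXn, rmorphM, rmorph_nat, rmorph1) /= !pevalX.
Qed.

Lemma hyperelliptic_infinity (L : fieldType) (e : {rmorphism k -> L}) x y :
  hyperelliptic e (chart_poly true) x y ->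
  hyperelliptic e (chart_poly false) x^-1 (y / x ^+ 3).
Proof.
move=> H; have x0 := hyp_x_neq0 H.
split=> [|[a b]].
  rewrite chart_polyE expr_div_n (hyp_eq H) chart_polyE; field; exact: x0.
rewrite /qeval /= => E; pose n := maxn (size a) (size b).
have sa : (size a <= n.+1)%N by rewrite leqW // leq_maxl.
have sb : (size b <= n.+1)%N by rewrite leqW // leq_maxr.
have /(hyp_free H)[] : qeval e x y (revp n a * 'X^3, revp n b) = 0.
  rewrite /qeval /= rmorphM rmorphXn /= pevalX -!peval_revp //.
  rewrite -[RHS](mul0r (x ^+ n * x ^+ 3)) -E; field; exact: x0.
move/eqP; rewrite mulf_eq0 expf_eq0 polyX_eq0 orbF => /eqP.
by move=> /(revp_eq0 sa) -> /(revp_eq0 sb) ->.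
Qed.

Context (s : {rmorphism k -> algC}).

Lemma curve_CE (P : 'rV[algC]_5) : curve_C A B s P <->
  P != 0 /\ [/\ P 0 0 * P 0 2 = P 0 1 ^+ 2, P 0 0 * P 0 3 = P 0 1 * P 0 2,
    P 0 1 * P 0 3 = P 0 2 ^+ 2 &
    P 0 4 ^+ 2 = - (3 * P 0 2 + 4 * s A * P 0 0) * (P 0 3 + s A * P 0 1 + s B * P 0 0)].
Proof.
rewrite /curve_C /zeros /curve_C_eqs; split=> -[P0 H]; split=> //.
  split; [have := H ('X_0 * 'X_2 - 'X_1 ^+ 2) |have := H ('X_0 * 'X_3 - 'X_1 * 'X_2)
   |have := H ('X_1 * 'X_3 - 'X_2 ^+ 2)
   |have := H ('X_4 ^+ 2 + (3 *: 'X_2 + (4 * A) *: 'X_0)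
                  * ('X_3 + A *: 'X_1 + B *: 'X_0))];
   rewrite !inE eqxx ?orbT !evE => /(_ isT)/eqP.
  - by rewrite subr_eq0 => /eqP.
  - by rewrite subr_eq0 => /eqP.
  - by rewrite subr_eq0 => /eqP.
  - by rewrite addr_eq0 rmorphM !rmorph_nat mulNr => /eqP.
case: H => E1 E2 E3 E4 p; rewrite !inE => /or4P[]/eqP->; rewrite !evE.
- by rewrite E1 subrr.
- by rewrite E2 subrr.
- by rewrite E3 subrr.
- by rewrite E4 rmorphM !rmorph_nat mulNr addNr.
Qed.

End Curve.

Lemma chart_poly_derivE (k S : fieldType) (A B : k) (e : {rmorphism k -> S}) b x :
  peval e x (chart_poly A B b)^`() =
  if b then - ((3 * x ^+ 2 + e A) * (3 * x ^+ 2 + 4 * e A) + 6 * x * (x ^+ 3 + e A * x + e B))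
  else - ((3 + 12 * e A * x ^+ 2) * (1 + e A * x ^+ 2 + e B * x ^+ 3) + (3 * x + 4 * e A * x ^+ 3) * (2 * e A * x + 3 * e B * x ^+ 2)).
Proof.
case: b; rewrite /chart_poly !mulNr derivN derivM !derivD !derivZ !derivC !derivXn ?derivX.
 rewrite rmorphN rmorphD !rmorphM !rmorphD /= !pevalZ !rmorphMn /= !rmorphXn /= !pevalX !pevalC.
rewrite !(rmorphM, rmorphD) /= !pevalC !(rmorph1, rmorph0).
by ring.
rewrite rmorphN rmorphD !rmorphM !rmorphD /= !pevalZ !rmorphMn /= !rmorphXn /= !pevalX !rmorph1.
by rewrite rmorph0 !rmorphM !rmorph_nat; ring.
Qed.

(** * Points of C *)

Lemma row5_eq (S : Type) (v w : 'rV[S]_5) :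
  v 0 0 = w 0 0 -> v 0 1 = w 0 1 -> v 0 2 = w 0 2 -> v 0 3 = w 0 3 ->
  v 0 4 = w 0 4 -> v = w.
Proof.
move=> h0 h1 h2 h3 h4; apply/rowP => -[[|[|[|[|[|i]]]]] //= hi];
by [rewrite (_ : Ordinal hi = 0) //; apply: val_inj
   |rewrite (_ : Ordinal hi = 1) //; apply: val_inj
   |rewrite (_ : Ordinal hi = 2) //; apply: val_inj
   |rewrite (_ : Ordinal hi = 3) //; apply: val_inj
   |rewrite (_ : Ordinal hi = 4) //; apply: val_inj].
Qed.

Lemma chart_ptC (X Y : algC) : chart_pt true X Y = pt_C X Y.
Proof. by []. Qed.

Section CurvePoints.
Context (k : fieldType) (A B : k) (s : {rmorphism k -> algC}).
Local Notation C := (curve_C A B s).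

Lemma affine_CE (x y : algC) :
  affine_C A B s x y <-> y ^+ 2 = peval s x (chart_poly A B true).
Proof. by rewrite chart_polyE. Qed.

Lemma curve_C_chart b (x y c : algC) : c != 0 ->
  y ^+ 2 = peval s x (chart_poly A B b) -> C (c *: chart_pt b x y).
Proof.
move=> c0; rewrite chart_polyE => E; apply/curve_CE; split.
  rewrite scaler_eq0 negb_or c0; apply/eqP => /rowP E0.
  by case: b {E} E0 => [/(_ 0)|/(_ 3)]; rewrite !mxE /= => /eqP; rewrite oner_eq0.
by case: b E => E; split; rewrite !mxE /= ?exprMn ?E; ring.
Qed.

(** The first three equations cut out the cone over the twisted cubic; its
    vertex is excluded by the last one, and x_0 = 0 leaves a single point. *)
Lemma curve_C_points P : C P ->
  (P 0 0 != 0 /\ exists c x y : algC, [/\ c != 0, affine_C A B s x y &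
    P = c *: chart_pt true x y]) \/
  (P 0 0 = 0 /\ exists2 c : algC, c != 0 & P = c *: chart_pt false 0 0).
Proof.
move=> /curve_CE[P0 [E1 E2 E3 E4]].
have [p0|p0] := eqVneq (P 0 0) 0; [right|left]; split=> //.
  have p1 : P 0 1 = 0 by apply/eqP; rewrite -sqrf_eq0 -E1 p0 mul0r.
  have p2 : P 0 2 = 0 by apply/eqP; rewrite -sqrf_eq0 -E3 p1 mul0r.
  have p4 : P 0 4 = 0.
    by apply/eqP; rewrite -sqrf_eq0 E4 p0 p2 !mulr0 addr0 oppr0 mul0r.
  have PE : P = P 0 3 *: chart_pt false 0 0.
    by apply: row5_eq; rewrite !mxE /= ?p0 ?p1 ?p2 ?p4 ?mulr1 // ?expr0n /= ?mulr0.
  exists (P 0 3) => //; apply: contra_neq P0 => p3.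
  by rewrite PE p3 scale0r.
have p2 : P 0 2 = P 0 1 ^+ 2 / P 0 0 by rewrite -E1; field.
have p3 : P 0 3 = P 0 1 ^+ 3 / P 0 0 ^+ 2.
  by apply: (mulfI p0); rewrite E2 p2; field.
exists (P 0 0), (P 0 1 / P 0 0), (P 0 4 / P 0 0); split=> //.
  by rewrite /affine_C expr_div_n E4 p2 p3; field.
by apply: row5_eq; rewrite !mxE /= ?mulr1 ?p2 ?p3; field.
Qed.

Lemma affine_chart : affine_chart_C A B s.
Proof.
split=> [X Y XY|P CP P0].
  rewrite -chart_ptC -[chart_pt _ _ _]scale1r; apply: curve_C_chart (oner_neq0 _) _.
  exact/affine_CE.
have [[_ [c [x [y [c0 XY E]]]]]|[E _]] := curve_C_points CP; last by rewrite E eqxx in P0.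
have [-> ->] : P 0 1 / P 0 0 = x /\ P 0 4 / P 0 0 = y.
  by rewrite E !mxE /=; split; field.
by split=> //; exists c.
Qed.

Lemma affine_C_above (x : algC) : exists y, affine_C A B s x y.
Proof. by exists (sqrtC (peval s x (chart_poly A B true))); apply/affine_CE; rewrite sqrtCK. Qed.

Lemma curve_C_infinite : infinite C.
Proof.
move=> r; pose xs := [seq Q 0 1 / Q 0 0 | Q : 'rV[algC]_5 <- r].
have /closed_nonrootP[x] : \prod_(a <- xs) ('X - a%:P) != 0.
  by apply: monic_neq0; apply: monic_prod_XsubC.
rewrite root_prod_XsubC => xxs; have [y xy] := affine_C_above x.
exists (1 *: chart_pt true x y); first by apply: curve_C_chart (oner_neq0 _) _; apply/affine_CE.
move=> Q Qr [c c0 E]; case/negP: xxs; apply/mapP; exists Q => //.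
have -> : Q = c^-1 *: chart_pt true x y by rewrite -[chart_pt _ _ _]scale1r E scalerA mulVf ?scale1r.
by rewrite !mxE /=; field.
Qed.

(** From the generic point to all points: both restrictions of G to the charts
    are the zero pair.  Conversely, if a(x) + b(x) y vanishes at (x, y) and
    (x, -y) for every x, then a = 0 and b f = 0. *)
Lemma vanish_on_curve (L : fieldType) (i : {rmorphism k -> L}) X Y d (G : {mpoly k[5]}) :
  hyperelliptic i (chart_poly A B true) X Y -> chart_poly A B true != 0 ->
  G \is d.-homog ->
  (ev i G (chart_pt true X Y) = 0 <-> forall P, C P -> ev s G P = 0).
Proof.
move=> H f0 hG; have X0 := hyp_x_neq0 H.
have [p Hp] := ev_chart (chart_poly A B true) true G.
have [q Hq] := ev_chart (chart_poly A B false) false G.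
have H' := hyperelliptic_infinity H.
have ptE : chart_pt true X Y = X ^+ 3 *: chart_pt false X^-1 (Y / X ^+ 3).
  by apply: row5_eq; rewrite !mxE /=; field.
split=> [G0 P CP|G0].
  have p0 : p = (0, 0) by apply: (hyp_free H); rewrite -Hp // (hyp_eq H).
  have q0 : q = (0, 0).
    apply: (hyp_free H'); rewrite -Hq ?(hyp_eq H') //; apply/eqP.
    move/eqP: G0; rewrite ptE (ev_scale _ _ _ hG) mulf_eq0 => /orP[|//].
    by rewrite !expf_eq0 (negbTE X0) !andbF.
  have [[_ [c [x [y [c0 /affine_CE xy ->]]]]]|[_ [c c0 ->]]] := curve_C_points CP.
    by rewrite (ev_scale _ _ _ hG) Hp // p0 qeval_poly rmorph0 mulr0.
  rewrite (ev_scale _ _ _ hG) Hq ?q0 ?qeval_poly ?rmorph0 ?mulr0 //.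
  by rewrite chart_polyE; ring.
rewrite Hp ?(hyp_eq H) //.
have Gp x y : y ^+ 2 = peval s x (chart_poly A B true) -> qeval s x y p = 0.
  move=> xy; rewrite -Hp // G0 // -[chart_pt _ _ _]scale1r.
  exact: curve_C_chart (oner_neq0 _) xy.
have two0 : 2 != 0 :> algC by rewrite pnatr_eq0.
have Gp12 x : peval s x p.1 = 0 /\ peval s x (p.2 * chart_poly A B true) = 0.
  have [y /affine_CE xy] := affine_C_above x.
  have E1 := Gp x y xy; have E2 := Gp x (- y) (etrans (sqrrN _) xy).
  have z1 : peval s x p.1 = 0.
    apply: (mulfI two0); rewrite mulr0 -[RHS]addr0 -{1}E1 -E2 /qeval; ring.
  split=> //; rewrite rmorphM /= -xy expr2 mulrA; move: E1.
  by rewrite /qeval z1 add0r => ->; rewrite mul0r.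
have zero (r : {poly k}) : (forall x, peval s x r = 0) -> r = 0.
  move=> r0; apply/eqP; rewrite -(map_poly_eq0 s); apply/negPn/negP => /closed_nonrootP[x].
  by rewrite rootE [_.[_]]r0 eqxx.
have p1 : p.1 = 0 by apply: zero => x; case: (Gp12 x).
have /eqP : p.2 * chart_poly A B true = 0 by apply: zero => x; case: (Gp12 x).
rewrite mulf_eq0 (negbTE f0) orbF => /eqP p2.
by rewrite /qeval p1 p2 !rmorph0 mul0r addr0.
Qed.

End CurvePoints.

(** * The function field of C *)

Section FunctionField.
Context (k : fieldType) (A B : k).

(** The form of degree n in x_i0, x_i1 which becomes p(x) where
    (x_i0, x_i1) = (1, x). *)
Definition homogenize (i0 i1 : 'I_5) n (p : {poly k}) : {mpoly k[5]} :=
  \sum_(j < n.+1) p`_j *: ('X_i1 ^+ j * 'X_i0 ^+ (n - j)).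

Lemma homog_X (R : comNzRingType) n (i : 'I_n) : ('X_i : {mpoly R[n]}) \is 1.-homog.
Proof. by rewrite dhomogX /= mdeg1. Qed.

Lemma homogenize_homog i0 i1 n p : homogenize i0 i1 n p \is n.-homog.
Proof.
apply: rpred_sum => j _; apply: rpredZ.
have := dhomogM (dhomogMn j (homog_X k i1)) (dhomogMn (n - j) (homog_X k i0)).
by rewrite !mul1n subnKC // leq_ord.
Qed.

Definition chart_form (b : bool) n (p : {poly k} * {poly k}) : {mpoly k[5]} :=
  let: (i0, i1) := if b then (0, 1) else (3, 2) in
  homogenize i0 i1 n p.1 * 'X_i0 + homogenize i0 i1 n p.2 * 'X_4.

Lemma chart_form_homog b n p : chart_form b n p \is n.+1.-homog.
Proof.
have hX i0 i1 q j : homogenize i0 i1 n q * 'X_j \is n.+1.-homog.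
  by have := dhomogM (homogenize_homog i0 i1 n q) (homog_X k j); rewrite addn1.
by rewrite /chart_form; case: b; apply: rpredD; apply: hX.
Qed.

Lemma ev_chart_form (S : fieldType) (e : {rmorphism k -> S}) b n (p : {poly k} * {poly k}) x y :
  (size p.1 <= n.+1)%N -> (size p.2 <= n.+1)%N ->
  ev e (chart_form b n p) (chart_pt b x y) = qeval e x y p.
Proof.
have hom (q : {poly k}) : (size q <= n.+1)%N ->
    ev e (homogenize (if b then 0 else 3) (if b then 1 else 2) n q) (chart_pt b x y)
      = peval e x q.
  move=> sq; rewrite /homogenize /ev raddf_sum /= -!/(ev _ _ _).
  rewrite /peval (@horner_coef_wide _ n.+1) ?size_map_poly //.
  apply: eq_bigr => j _; rewrite -/(ev _ _ _) !evE coef_map; congr (_ * _).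
  by case: (b); rewrite !mxE /= expr1n mulr1.
move=> s1 s2; rewrite /chart_form /qeval -hom // -(hom p.2) //.
by case: (b); rewrite !evE; congr (_ + _ * _); rewrite ?mxE //= mulr1.
Qed.

(** The common degree makes the quotient of two pairs a rational function on C. *)
Lemma chart_forms b (p q : {poly k} * {poly k}) :
  exists (d : nat) (F G : {mpoly k[5]}), [/\ F \is d.-homog, G \is d.-homog
   & forall (S : fieldType) (e : {rmorphism k -> S}) x y,
     ev e F (chart_pt b x y) = qeval e x y p /\
     ev e G (chart_pt b x y) = qeval e x y q].
Proof.
pose n := maxn (maxn (size p.1) (size p.2)) (maxn (size q.1) (size q.2)).
exists n.+1, (chart_form b n p), (chart_form b n q).
split; try exact: chart_form_homog.
by move=> S e x y; rewrite !ev_chart_form // leqW // /n !leq_max leqnn ?orbT.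
Qed.

Context (s : {rmorphism k -> algC}).
Local Notation C := (curve_C A B s).

Definition curve_function_field (L : fieldType) (e : {rmorphism k -> L}) x y
  (f0 : chart_poly A B true != 0)
  (H : hyperelliptic e (chart_poly A B true) x y) (span : spans_field e x y) :
  function_field s C.
Proof.
refine (@FunctionField k algC s 5 C L e (chart_pt true x y) _ _).
  by move=> d G; apply: vanish_on_curve.
move=> h; have [p [c [c0 ->]]] := span h.
have [d [F [G [hF hG E]]]] := chart_forms true p (c, 0).
exists d, F, G; have [-> ->] := E L e x y.
by rewrite qeval_poly.
Defined.

(** In a chart, forms become pairs and pairs can be homogenized, so fractions of
    forms and fractions of pairs are the same functions. *)
Lemma regular_at_local (Lf : function_field s C) b x y c P x0 y0 c0 h :
  hyperelliptic (ff_emb Lf) (chart_poly A B b) x y -> c != 0 ->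
  ff_gen Lf = c *: chart_pt b x y ->
  c0 != 0 -> P = c0 *: chart_pt b x0 y0 -> y0 ^+ 2 = peval s x0 (chart_poly A B b) ->
  regular_at P h <-> local_at (ff_emb Lf) s x y x0 y0 h.
Proof.
move=> H cn0 genE c0n0 PE xy0; split.
  case=> d [F [G [hF hG GP hE]]].
  have [p Hp] := ev_chart (chart_poly A B b) b F.
  have [m Hm] := ev_chart (chart_poly A B b) b G.
  have m0 : qeval s x0 y0 m != 0.
    by move: GP; rewrite PE (ev_scale _ _ _ hG) Hm // mulf_eq0 negb_or => /andP[].
  have mL : qeval (ff_emb Lf) x y m != 0.
    apply: contra m0 => /eqP/(hyp_free H) ->.
    by rewrite qeval_poly rmorph0.
  exists m, p; split=> //; rewrite hE genE (ev_scale _ _ _ hG) (ev_scale _ _ _ hF).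
  rewrite Hm ?Hp ?(hyp_eq H) //; field; rewrite mL /=.
  by rewrite expf_neq0.
case=> m [p [m0 hm]]; have [d [F [G [hF hG E]]]] := chart_forms b p m.
have mL : qeval (ff_emb Lf) x y m != 0.
  apply: contra m0 => /eqP/(hyp_free H) ->.
  by rewrite qeval_poly rmorph0.
exists d, F, G; split=> //.
  rewrite PE (ev_scale _ _ _ hG); have [_ ->] := E _ s x0 y0.
  by rewrite mulf_neq0 ?expf_neq0.
rewrite genE (ev_scale _ _ _ hG) (ev_scale _ _ _ hF).
have [-> ->] := E _ (ff_emb Lf) x y; rewrite -hm; field.
by rewrite mL /= expf_neq0.
Qed.

Lemma size_quadratic_factor (c : k) : 3 != 0 :> k -> size (3 *: 'X^2 + c%:P) = 3%N.
Proof.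
move=> n3; rewrite size_polyDl; rewrite size_scale ?size_polyXn //.
by rewrite ltnS (leq_trans (size_polyC_leq1 _)).
Qed.

Lemma size_cubic_factor (a c : k) : size ('X^3 + a *: 'X + c%:P) = 4%N.
Proof.
rewrite -addrA size_polyDl ?size_polyXn //.
rewrite (leq_ltn_trans (size_polyD _ _)) // gtn_max.
by rewrite (leq_ltn_trans (size_scale_leq _ _)) ?size_polyX // (leq_ltn_trans (size_polyC_leq1 _)).
Qed.

Lemma size_chart_poly : 3 != 0 :> k -> size (chart_poly A B true) = 6%N.
Proof.
move=> n3; rewrite /chart_poly mulNr size_polyN size_mul;
  by rewrite -?size_poly_eq0 ?size_quadratic_factor ?size_cubic_factor.
Qed.

End FunctionField.

Section Smooth.
Context (k : fieldType) (A B : k) (s : {rmorphism k -> algC}).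
Local Notation C := (curve_C A B s).

Lemma natr_neq0 n : n.+1%:R != 0 :> k.
Proof. by rewrite -(fmorph_eq0 s) rmorph_nat pnatr_eq0. Qed.

Lemma chart_poly_neq0 : chart_poly A B true != 0.
Proof. by rewrite -size_poly_eq0 size_chart_poly // natr_neq0. Qed.

End Smooth.

(** The function field of C over the algebraically closed field itself is a
    field, and a form vanishes on C exactly when it vanishes at its generic
    point. *)
Lemma curve_C_irreducible (k : fieldType) (A B : k) (s : {rmorphism k -> algC}) :
  irreducible (curve_C A B s).
Proof.
have toK P : curve_C A B s P <-> curve_C (s A) (s B) idfun P.
  by rewrite !curve_CE.
split.
  have [y xy] := affine_C_above A B s 0; exists (pt_C 0 y).
  by have [+ _] := affine_chart A B s; apply.
pose id := (idfun : {rmorphism algC -> algC}).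
have f0 := chart_poly_neq0 (s A) (s B) id.
have [|//|L [i [X [Y [H span]]]]] := @hyperelliptic_exists _ (chart_poly (s A) (s B) true).
  by rewrite size_chart_poly // pnatr_eq0.
move=> d e F G hF hG FG.
have hFG := dhomogM hF hG.
have/eqP: ev i (F * G) (chart_pt true X Y) = 0.
  apply/(vanish_on_curve id H f0 hFG) => P CP; rewrite evM.
  by apply: FG; apply/toK.
rewrite evM mulf_eq0 => /orP[]/eqP E; [left|right] => P /toK CP.
  by apply: (vanish_on_curve id H f0 hF).1.
by apply: (vanish_on_curve id H f0 hG).1.
Qed.

(** * Smoothness of C *)

Lemma rank_kernel_line (F : fieldType) m n (J : 'M[F]_(m, n)) (u : 'rV[F]_m) :
  u != 0 -> u *m J = 0 -> (forall v, v *m J = 0 -> exists a, v = a *: u) ->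
  (\rank J).+1 = m.
Proof.
move=> u0 uJ span; have : \rank (kermx J) = 1%N.
  have -> : \rank (kermx J) = \rank u.
    apply: eqmx_rank; apply/andP; split; last exact/sub_kermxP.
    apply/row_subP => i; apply/sub_rVP/span.
    by apply/sub_kermxP/row_sub.
  by rewrite rank_rV u0.
by rewrite mxrank_ker => E; rewrite -addn1 -E subnKC // rank_leq_row.
Qed.

Lemma mderiv_var (R : comNzRingType) n (i j : 'I_n) :
  ('X_i : {mpoly R[n]})^`M(j) = (i == j)%:R%:MP.
Proof.
rewrite mderivX mnm1E; case: eqP => [->|_]; last by rewrite scale0r mpolyC0.
by rewrite scale1r (_ : (U_(j) - U_(j))%MM = 0%MM) ?mpolyX0 ?mpolyC1 //; apply/mnmP => l; rewrite mnmBE mnm0E subnn.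
Qed.

Definition mderivE := (mderivD, mderivN, mderivM, mderivZ, @mderiv_var).

Lemma rmorph_delta (k S : fieldType) (A B : k) (e : {rmorphism k -> S}) :
  e (delta A B) = 4 * e A ^+ 3 + 27 * e B ^+ 2.
Proof. by rewrite /delta !(rmorphD, rmorphXn, rmorph_nat, rmorphM). Qed.

(** The discriminant conditions, each proved by a division certificate. *)
Section Separable.
Context (F : fieldType) (A B x : F).
Hypothesis d0 : 4 * A ^+ 3 + 27 * B ^+ 2 != 0.
Hypothesis three0 : 3 != 0 :> F.

(** B - A x / 3 is the remainder of x^3 + A x + B modulo 3 x^2 + 4 A, and up
    to a constant also that of x^3 + 4 B and of x^3 + 4 A x - 8 B.  So at a
    root of 3 x^2 + 4 A none of these three cubics vanishes. *)
Lemma quadratic_cubic_coprime :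
  3 * x ^+ 2 + 4 * A = 0 -> B - A * x / 3 != 0.
Proof.
move=> q0; apply: contra d0 => /eqP E; apply/eqP.
apply: (eq_lin (u := 27 * (B + A * x / 3)) E).
by apply: (eq_lin (u := A ^+ 2) q0); field.
Qed.

Lemma cubic_separable :
  x ^+ 3 + A * x + B = 0 -> 3 * x ^+ 2 + A != 0.
Proof.
move=> f0; apply: contra d0 => /eqP E; apply/eqP.
apply: (eq_lin (u := 27 * (B - 2 * A * x / 3)) f0).
by apply: (eq_lin (u := 4 * A ^+ 2 - 9 * x * (B - 2 * A * x / 3)) E); field.
Qed.

(** The conclusion is about the derivative of (3 x^2 + 4 A)(x^3 + A x + B). *)
Lemma quintic_separable : 2 != 0 :> F -> A != 0 ->
  (3 * x ^+ 2 + 4 * A) * (x ^+ 3 + A * x + B) = 0 ->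
  (3 * x ^+ 2 + A) * (3 * x ^+ 2 + 4 * A) + 6 * x * (x ^+ 3 + A * x + B) != 0.
Proof.
move=> two0 A0 /eqP; rewrite mulf_eq0 => /orP[]/eqP E; rewrite E ?mulr0 ?add0r ?addr0.
  have h := quadratic_cubic_coprime E.
  rewrite (_ : x ^+ 3 + A * x + B = B - A * x / 3); last first.
    by apply: (eq_lin (u := x / 3) E); field.
  rewrite !mulf_neq0 // ?(natrM _ 2 3) ?mulf_neq0 //.
  apply: contra A0 => /eqP x0; move: E; rewrite x0 expr0n mulr0 add0r => /eqP.
  by rewrite mulf_eq0 (natrM _ 2 2) mulf_eq0 (negbTE two0).
rewrite mulf_neq0 ?cubic_separable //.
apply/eqP => q0; case/eqP: (quadratic_cubic_coprime q0).
by apply: (eq_lin (u := 1) E); apply: (eq_lin (u := - x / 3) q0); field.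
Qed.
End Separable.

Lemma row4_eq (S : Type) (v w : 'rV[S]_4) :
  v 0 0 = w 0 0 -> v 0 1 = w 0 1 -> v 0 2 = w 0 2 -> v 0 3 = w 0 3 -> v = w.
Proof.
move=> h0 h1 h2 h3; apply/rowP => -[[|[|[|[|i]]]] //= hi];
by [rewrite (_ : Ordinal hi = 0) //; apply: val_inj
   |rewrite (_ : Ordinal hi = 1) //; apply: val_inj
   |rewrite (_ : Ordinal hi = 2) //; apply: val_inj
   |rewrite (_ : Ordinal hi = 3) //; apply: val_inj].
Qed.

Lemma sum4 (R : nmodType) (F : 'I_4 -> R) :
  \sum_(i < 4) F i = F 0 + F 1 + F 2 + F 3.
Proof.
rewrite !big_ord_recr big_ord0 /= add0r.
by congr (F _ + F _ + F _ + F _); apply: val_inj.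
Qed.

Section Nonsingular.
Context (k : fieldType) (A B : k) (s : {rmorphism k -> algC}).
Hypotheses (A0 : A != 0) (d0 : delta A B != 0).

Definition jacobian_entries (P : 'rV[algC]_5) : seq (seq algC) :=
  let l := P 0 3 + s A * P 0 1 + s B * P 0 0 in
  let q := 3 * P 0 2 + 4 * s A * P 0 0 in
  [:: [:: P 0 2; - 2 * P 0 1; P 0 0; 0; 0];
      [:: P 0 3; - P 0 2; - P 0 1; P 0 0; 0];
      [:: 0; P 0 3; - 2 * P 0 2; P 0 1; 0];
      [:: 4 * s A * l + s B * q; s A * q; 3 * l; q; 2 * P 0 4]].

Lemma jacobian_curveE P (i : 'I_4) (j : 'I_5) :
  (jacobian s (curve_C_eqs A B) P : 'M_(4, 5)) i j = (nth [::] (jacobian_entries P) i)`_j.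
Proof.
rewrite mxE; case: i => -[|[|[|[|//]]]] hi; case: j => -[|[|[|[|[|//]]]]] hj.
all: rewrite /= ?expr2 !mderivE !evE ?(rmorphM, rmorph_nat) /=.
all: ring.
Qed.

Lemma curve_C_kernel (P : 'rV[algC]_5) (J : 'M[algC]_(4, 5)) (v : 'rV[algC]_4) :
  (forall i j, J i j = (nth [::] (jacobian_entries P) i)`_j) ->
  v *m J = 0 ->
  let l := P 0 3 + s A * P 0 1 + s B * P 0 0 in
  let q := 3 * P 0 2 + 4 * s A * P 0 0 in
  [/\ v 0 0 * P 0 2 + v 0 1 * P 0 3 + v 0 3 * (4 * s A * l + s B * q) = 0,
      - 2 * P 0 1 * v 0 0 - P 0 2 * v 0 1 + P 0 3 * v 0 2 + v 0 3 * (s A * q) = 0,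
      v 0 0 * P 0 0 - v 0 1 * P 0 1 - 2 * P 0 2 * v 0 2 + 3 * l * v 0 3 = 0,
      v 0 1 * P 0 0 + v 0 2 * P 0 1 + v 0 3 * q = 0
    & v 0 3 * (2 * P 0 4) = 0].
Proof.
move=> JE /rowP vJ l q.
have E (j : 'I_5) : \sum_(i < 4) v 0 i * (nth [::] (jacobian_entries P) i)`_j = 0.
  have := vJ j; rewrite !mxE => E; rewrite -[RHS]E.
  by apply: eq_bigr => i _; rewrite JE.
split; [rewrite -[RHS](E 0)|rewrite -[RHS](E 1)|rewrite -[RHS](E 2)|rewrite -[RHS](E 3)|rewrite -[RHS](E 4)].
all: rewrite sum4 /=.
all: rewrite /l /q; ring.
Qed.

(** The rank is found through the left kernel of the Jacobian matrix, which is
    spanned by the syzygy of the three quadrics of the twisted cubic.  A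
    relation which involves the last row would give a double root of the
    equation y^2 = f(x) of C. *)
Lemma curve_C_nonsingular : nonsingular s (curve_C_eqs A B).
Proof.
have sd : 4 * s A ^+ 3 + 27 * s B ^+ 2 != 0 by rewrite -rmorph_delta fmorph_eq0.
have [n2 n3] : 2 != 0 :> algC /\ 3 != 0 :> algC by rewrite !pnatr_eq0.
move=> P CP; congr S; pose J : 'M[algC]_(4, 5) := jacobian s (curve_C_eqs A B) P.
have JE i j : J i j = (nth [::] (jacobian_entries P) i)`_j by apply: jacobian_curveE.
change ((\rank J).+1 = 4%N).
have [[p0 [c [x [y [c0 xy PE]]]]]|[p0 [c c0 PE]]] := curve_C_points CP.
  (* The syzygy x_2 r_0 - x_1 r_1 + x_0 r_2 = 0 of the gradients of the
     quadrics, at the point (1, x, x^2, x^3, y). *)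
  apply: (@rank_kernel_line _ _ _ J (\row_i [:: x ^+ 2; - x; 1; 0]`_i)).
  - by apply/eqP => /rowP/(_ 2); rewrite !mxE /= => /eqP; rewrite oner_eq0.
  - apply/rowP => j; rewrite !mxE; under eq_bigr => i _ do rewrite mxE JE.
    rewrite !big_ord_recl big_ord0 /= PE; case: j => -[|[|[|[|[|//]]]]] hj /=;
    by rewrite !mxE /=; ring.
  move=> v /(curve_C_kernel JE)[]; rewrite PE !mxE /= => E0 E1 E2 E3 E4.
  have v3 : v 0 3 = 0.
    apply/eqP/negPn/negP => v3.
    have y0 : y = 0.
      apply/eqP; move/eqP: E4; rewrite !mulf_eq0 (negbTE v3) (negbTE n2).
      by rewrite (negbTE c0).
    have fq : (3 * x ^+ 2 + 4 * s A) * (x ^+ 3 + s A * x + s B) = 0.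
      by move: xy; rewrite /affine_C y0 expr0n /= mulNr => /esym/eqP; rewrite oppr_eq0 => /eqP.
    have [|] := negP (quintic_separable sd n3 n2 _ fq); first by rewrite fmorph_eq0.
    apply/eqP/(mulfI c0)/(mulfI v3); rewrite !mulr0.
    (* Contract with the tangent vector (0, 1, 2x, 3x^2, 0) of the cone, which
       kills the first three rows. *)
    apply: (eq_lin (u := 1) E1); apply: (eq_lin (u := 2 * x) E2).
    by apply: (eq_lin (u := 3 * x ^+ 2) E3); ring.
  exists (v 0 2); move: E2 E3; rewrite v3 !(mul0r, mulr0, addr0) => E2 E3.
  have v1 : v 0 1 = - x * v 0 2.
    by apply: (mulfI c0); apply: (eq_lin (u := 1) E3); ring.
  have v0 : v 0 0 = x ^+ 2 * v 0 2.
    by apply: (mulfI c0); apply: (eq_lin (u := 1) E2); rewrite v1; ring.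
  by apply: row4_eq; rewrite !mxE /= ?v0 ?v1 ?v3; ring.
apply: (@rank_kernel_line _ _ _ J (\row_i [:: 1; 0; 0; 0]`_i)).
- by apply/eqP => /rowP/(_ 0); rewrite !mxE /= => /eqP; rewrite oner_eq0.
- apply/rowP => j; rewrite !mxE; under eq_bigr => i _ do rewrite mxE JE.
  rewrite !big_ord_recl big_ord0 /= PE; case: j => -[|[|[|[|[|//]]]]] hj /=;
  by rewrite !mxE /=; ring.
move=> v /(curve_C_kernel JE)[]; rewrite PE !mxE /= => E0 E1 E2 _ _.
have v3 : v 0 3 = 0.
  by apply: (mulfI (mulf_neq0 n3 c0)); apply: (eq_lin (u := 1) E2); ring.
have v2 : v 0 2 = 0.
  by apply: (mulfI c0); apply: (eq_lin (u := 1) E1); rewrite v3; ring.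
have v1 : v 0 1 = 0.
  by apply: (mulfI c0); apply: (eq_lin (u := 1) E0); rewrite v3; ring.
exists (v 0 0); apply: row4_eq; rewrite !mxE /= ?v1 ?v2 ?v3; ring.
Qed.

Lemma curve_C_smooth : smooth_projective_curve s (curve_C_eqs A B).
Proof.
have hX n := homog_X k n.
split; [|exact: curve_C_irreducible|exact: curve_C_infinite|exact: curve_C_nonsingular].
have hXM (p q : {mpoly k[5]}) : p \is 1.-homog -> q \is 1.-homog -> p * q \is 2.-homog.
  by move=> hp hq; apply: (dhomogM hp hq).
have hX2 (p : {mpoly k[5]}) : p \is 1.-homog -> p ^+ 2 \is 2.-homog.
  by move=> hp; rewrite expr2 hXM.
have hZ c (p : {mpoly k[5]}) d : p \is d.-homog -> c *: p \is d.-homog.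
  exact: dhomogZ.
have hD (p q : {mpoly k[5]}) d : p \is d.-homog -> q \is d.-homog -> p + q \is d.-homog.
  exact: dhomogD.
have hN (p : {mpoly k[5]}) d : p \is d.-homog -> - p \is d.-homog by rewrite dhomogN.
move=> p; rewrite !inE => /or4P[]/eqP->; exists 2.
- by apply: (hD); [apply: (hXM)|apply: hN; apply: hX2].
- by apply: (hD); [apply: (hXM)|apply: hN; apply: (hXM)].
- by apply: (hD); [apply: (hXM)|apply: hN; apply: hX2].
apply: (hD); [exact: (hX2)|apply: (hXM)].
  by apply: (hD); apply: (hZ).
by apply: (hD); [apply: (hD) => //|]; apply: (hZ).
Qed.

End Nonsingular.

(** If delta = 0 then (-3B / 2A, 0) is a singular point of E0. *)
Lemma elliptic_delta (k : fieldType) (A B : k) (s : {rmorphism k -> algC}) :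
  A != 0 -> nonsingular s [:: weierstrass_form A B] -> delta A B != 0.
Proof.
move=> A0 ns; apply/eqP => d0; have A1 : s A != 0 by rewrite fmorph_eq0.
have sd : 4 * s A ^+ 3 + 27 * s B ^+ 2 = 0 by rewrite -rmorph_delta d0 rmorph0.
pose P := pt3 (- 3 * s B / (2 * s A)) 0 1.
have CP : zeros s [:: weierstrass_form A B] P.
  split; first by apply/eqP => /rowP/(_ 2); rewrite !mxE /= => /eqP; rewrite oner_eq0.
  move=> p; rewrite inE => /eqP ->; rewrite !evE !mxE /=.
  by apply: (eq_lin (u := s B / (8 * s A ^+ 3)) sd); field.
have := ns P CP; suff -> : \rank (jacobian s [:: weierstrass_form A B] P) = 0%N by [].
apply/eqP; rewrite mxrank_eq0; apply/eqP/matrixP => i j; rewrite !mxE.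
case: i => -[|//] hi; rewrite /= /weierstrass_form !exprS !expr0 !mulr1 !mderivE !evE !mxE /=.
case: j => -[|[|[|//]]] hj /=.
- by apply: (eq_lin (u := - (4 * s A ^+ 2)^-1) sd); field.
- by ring.
- by field.
Qed.

(** * The genus of C *)

Section Genus.
Context (k : fieldType) (A B : k) (s : {rmorphism k -> algC}).
Hypotheses (A0 : A != 0) (d0 : delta A B != 0).
Context (L : fieldType) (e : {rmorphism k -> L}) (X Y : L).
Hypothesis H : hyperelliptic e (chart_poly A B true) X Y.
Hypothesis span : spans_field e X Y.

Local Notation C := (curve_C A B s).
Let U := X^-1.
Let W := Y / X ^+ 3.
Let H' : hyperelliptic e (chart_poly A B false) U W := hyperelliptic_infinity H.
Let f0 := chart_poly_neq0 A B s.
Let Lf : function_field s C := curve_function_field s f0 H span.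

Lemma natrL_neq0 n : n.+1%:R != 0 :> L.
Proof. by rewrite -(rmorph_nat e) fmorph_eq0 (natr_neq0 s). Qed.

Let X0 : X != 0 := hyp_x_neq0 H.
Let Y0 : Y != 0 := hyp_y_neq0 f0 H.

Lemma regular_at_affine c x y h : c != 0 -> affine_C A B s x y ->
  @regular_at _ _ s _ C Lf (c *: chart_pt true x y) h <-> local_at e s X Y x y h.
Proof.
move=> c0 /affine_CE xy.
apply: (@regular_at_local _ _ _ s Lf true X Y 1 _ x y c) => //.
- exact: oner_neq0.
- by rewrite scale1r.
Qed.

Lemma gen_infinity : chart_pt true X Y = X ^+ 3 *: chart_pt false U W.
Proof. by apply: row5_eq; rewrite !mxE /= /U /W; field. Qed.

Lemma regular_at_infinity c h : c != 0 ->
  @regular_at _ _ s _ C Lf (c *: chart_pt false 0 0) h <-> local_at e s U W 0 0 h.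
Proof.
move=> c0; apply: (@regular_at_local _ _ _ s Lf false U W (X ^+ 3) _ 0 0 c) => //.
- by rewrite expf_neq0.
- exact: gen_infinity.
- by rewrite chart_polyE; ring.
Qed.

Lemma dvdp_mul_unit j (g c t : {poly k}) : c.[0] != 0 ->
  g * c = 'X^j * t -> 'X^j %| g.
Proof.
move=> c0 E; have : 'X^j %| g * c by rewrite E dvdp_mulr.
rewrite Gauss_dvdpl // coprimep_expl // coprimep_sym coprimepX.
by rewrite rootE.
Qed.

(** Multiplying a fraction for h / x at infinity, with h = p(x, y), by the
    conjugate of its denominator leaves a denominator in k[u] prime to u; then
    freeness of 1, w over k[u] bounds the degrees of the components of h
    separately.  Only h = a + b x remains. *)
Lemma infinity_pole_bound p :
  local_at e s U W 0 0 (- X^-1 * qeval e X Y p) -> p.2 = 0 /\ (size p.1 <= 2)%N.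
Proof.
case=> m [r [m0 hm]]; have m1 : m.1.[0] != 0.
  move: m0; rewrite /qeval mulr0 addr0.
  have -> : peval s 0 m.1 = s m.1.[0] by rewrite -horner_map rmorph0.
  by rewrite fmorph_eq0.
have WG := hyp_eq H'.
pose c := m.1 ^+ 2 - m.2 ^+ 2 * chart_poly A B false.
have c0 : c.[0] != 0.
  have G0 : (chart_poly A B false).[0] = 0.
    by have := chart_polyE A B idfun false 0; rewrite /peval map_poly_id // => ->; ring.
  by rewrite /c hornerD hornerN (hornerM (_ ^+ 2)) G0 mulr0 subr0 hornerM mulf_neq0.
pose t := qmul (chart_poly A B false) r (m.1, - m.2).
have hc : - X^-1 * qeval e X Y p * peval e U c = qeval e U W t.
  by rewrite -(qconj_norm m WG) mulrA hm (qevalM _ _ WG).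
(* the successor makes the exponent n - 1 of the last step meaningful *)
pose n := (maxn (size p.1) (size p.2)).+1.
have s1 : (size p.1 <= n.+1)%N by rewrite leqW // leqW // leq_maxl.
have s2 : (size p.2 <= n.+1)%N by rewrite leqW // leqW // leq_maxr.
have U0 : U != 0 by rewrite invr_eq0.
have UX : U^-1 = X by rewrite invrK.
pose a := revp n p.1; pose b := revp n p.2.
have aE : peval e X p.1 * U ^+ n = peval e U a by rewrite -peval_revp // UX.
have bE : peval e X p.2 * U ^+ n = peval e U b by rewrite -peval_revp // UX.
have [E1 E2] : (a * 'X^3 * c, b * c) = ('X^(n.+2) * (- t.1), 'X^(n.+2) * (- t.2)).
  apply: (qeval_inj H'); rewrite /qeval /= !(rmorphXn, rmorphN, rmorphM) /= !pevalX.
  have -> : U ^+ n.+2 = U * (U * U ^+ n) by rewrite -!exprS.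
  rewrite -aE -bE; apply: (eq_lin (u := - (U * (U * U ^+ n))) hc).
  move: (U ^+ n) => u; rewrite /qeval.
  move: (peval e U t.1) (peval e U t.2) (peval e U c) => t1 t2 c1.
  by rewrite /U /W; field.
have b0 : b = 0.
  apply/eqP; have := dvdp_mul_unit c0 E2; apply: contraLR => b0.
  apply/negP => /(dvdp_leq b0); rewrite size_polyXn => /leq_trans/(_ (size_poly _ _)).
  by rewrite ltnNge leqnSn.
split; first exact: revp_eq0 b0.
have /dvdpP[q] := dvdp_mul_unit c0 E1.
have -> : n.+2 = (n.-1 + 3)%N by rewrite addn3.
rewrite exprD (mulrA q) => /mulIf aq.
have {}aq : a = q * 'X^(n.-1) by apply: aq; rewrite expf_neq0 // polyX_eq0.
apply/leq_sizeP => i i2; have [ni|ni] := leqP i n; last by rewrite nth_default // (leq_trans s1).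
have : a`_(n - i) = 0.
  rewrite aq mulrC coefXnM; rewrite ifT // /n /= ltn_subLR //.
  by move: i2 ni; rewrite /n; case: (i) => [|[|j]] // _ _; rewrite addSn addSn !ltnS leq_addl.
by rewrite coef_poly ltnS leq_subr subKn.
Qed.

Let n2 : 2 != 0 :> L := natrL_neq0 1.

Lemma derivation_infinity D : derivation e D ->
  W * D X = - X ^+ 2 * (W * D U) /\
  2 * W * D W = peval e U (chart_poly A B false)^`() * D U.
Proof.
move=> dD; have [D0 DD DM] := dD; split.
  have D1 : D 1 = 0 by rewrite -(rmorph1 e) D0.
  have : D (X * U) = 0 by rewrite divff.
  rewrite DM => E; apply: (eq_lin (u := X * W) E); move: (D U) => DU.
  by rewrite /U; field.
by rewrite -(derivation_peval _ _ dD) -(hyp_eq H') expr2 DM; ring.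
Qed.

(** X^i dX / Y, for i < 2.  At a point with y = 0 it is rewritten with
    2 Y dY = f'(X) dX, and at infinity with 2 W dW = f_oo'(U) dU. *)
Lemma regular_basis (i : 'I_2) :
  @regular_differential _ _ s _ C Lf (fun D => X ^+ i * D X / Y).
Proof.
have sd : 4 * s A ^+ 3 + 27 * s B ^+ 2 != 0 by rewrite -rmorph_delta fmorph_eq0.
have [m2 m3] : 2 != 0 :> algC /\ 3 != 0 :> algC by rewrite !pnatr_eq0.
move=> P CP; have [[_ [c [x [y [c0 xy ->]]]]]|[_ [c c0 ->]]] := curve_C_points CP.
  have [y0|y0] := eqVneq y 0.
    pose F' := (chart_poly A B true)^`().
    have F'x : peval s x F' != 0.
      rewrite /F' chart_poly_derivE.
      rewrite oppr_eq0; apply: quintic_separable; rewrite ?fmorph_eq0 //.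
      by apply/eqP; rewrite -oppr_eq0 -mulNr -xy y0 expr0n.
    have F'X : peval e X F' != 0.
      apply: contra F'x => /eqP E; have -> : F' = 0 by apply: (peval_inj H); rewrite E rmorph0.
      by rewrite rmorph0.
    exists [:: (2 * X ^+ i / peval e X F', Y)]; split=> [fg|D dD].
      rewrite inE => /eqP -> /=; split; apply/(regular_at_affine _ c0 xy).
        exists (F', 0), (2 *: 'X^i, 0); rewrite !qeval_poly; split=> //.
        by rewrite pevalZ rmorphXn /= pevalX rmorph_nat divfK.
      exact: (local_gens _ _ _ _ _ _).2.
    have [_ _ DM] := dD.
    have E : 2 * Y * D Y = peval e X F' * D X.
      by rewrite -(derivation_peval _ _ dD) -(hyp_eq H) expr2 DM; ring.
    rewrite big_seq1 /=; apply: (mulfI F'X); apply: (mulfI Y0).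
    by apply: (eq_lin (u := - X ^+ i) E); field; rewrite F'X Y0.
  exists [:: (X ^+ i / Y, X)]; split=> [fg|D dD].
    rewrite inE => /eqP -> /=; split; apply/(regular_at_affine _ c0 xy).
      exists (0, 1), ('X^i, 0); rewrite /qeval /= !(rmorph0, rmorph1, rmorphXn) /= pevalX.
      by rewrite !mul0r !mul1r !add0r addr0 divfK.
    exact: (local_gens _ _ _ _ _ _).1.
  by rewrite big_seq1 /= mulrAC.
pose G' := (chart_poly A B false)^`().
have G'0 : peval s 0 G' != 0.
  have -> : peval s 0 G' = - 3 by rewrite /G' chart_poly_derivE; ring.
  by rewrite oppr_eq0.
have G'U : peval e U G' != 0.
  apply: contra G'0 => /eqP E; have -> : G' = 0 by apply: (peval_inj H'); rewrite E rmorph0.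
  by rewrite rmorph0.
exists [:: (- 2 * U ^+ (1 - i) / peval e U G', W)]; split=> [fg|D dD].
  rewrite inE => /eqP -> /=; split; apply/(regular_at_infinity _ c0).
    exists (G', 0), (- 2 *: 'X^(1 - i), 0); rewrite !qeval_poly; split=> //.
    by rewrite pevalZ rmorphXn /= pevalX rmorphN rmorph_nat divfK.
  exact: (local_gens _ _ _ _ _ _).2.
have [E1 E2] := derivation_infinity dD.
rewrite big_seq1 /=.
have W0 : W != 0 by rewrite mulf_neq0 // invr_eq0 expf_neq0.
have -> : D X = - X ^+ 2 * D U by apply: (mulfI W0); rewrite E1; ring.
apply: (mulfI G'U); apply: (mulfI W0).
have -> : U ^+ (1 - i) = U * X ^+ i.
  by case: i => -[|[|//]] hi; rewrite /= ?expr0 ?expr1 ?mulr1 // mulVf.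
apply: (eq_lin (u := U * X ^+ i) E2).
rewrite -/G'; move: (peval e U G') G'U (D U) => g g0 DU.
by rewrite /W /U; field; rewrite g0 Y0 X0.
Qed.

(** Let D0 be the derivation with D0 X = 2Y, and v a regular differential.
    Then v = v(D0) dX / 2Y.  As D0 preserves the local rings of the affine curve,
    v(D0) is regular there, hence polynomial in X and Y; as - D0 / X preserves
    the local ring at infinity, v(D0) / X is regular at infinity.  So v(D0) is
    a polynomial in X of degree at most 1. *)
Lemma curve_C_genus : has_genus s C 2.
Proof.
exists Lf, (fun (i : 'I_2) (D : L -> L) => X ^+ i * D X / Y).
split; first exact: regular_basis.
move=> v rv; have [D0 [dD0 D0X]] := hyperelliptic_derivation H span.
have [D00 D0D D0M] := dD0.
have [P CP] : exists P, C P by case: (curve_C_irreducible A B s).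
have vprop D D' : derivation e D -> derivation e D' -> D' X * v D = D X * v D'.
  move=> dD dD'; have [r [_ vE]] := rv P CP; rewrite !vE // !mulr_sumr.
  apply: eq_bigr => fg _; rewrite mulrCA [RHS]mulrCA; congr (_ * _).
  by apply: (derivation_proportional n2 f0 H fg.2 span dD dD').
have [p hp] : exists p, v D0 = qeval e X Y p.
  apply: (local_everywhere H span (s := s)) => x y /affine_CE xy.
  have CQ : C (1 *: chart_pt true x y).
    by apply: curve_C_chart (oner_neq0 _) _; apply/affine_CE.
  have [r [rr vE]] := rv _ CQ; rewrite vE //; move/affine_CE: (xy) => xy'.
  rewrite big_seq; apply: big_ind => [|g h lg lh|fg /rr[]].
  - by have := local_qeval e s X Y x y (0, 0); rewrite /qeval /= !rmorph0 mul0r addr0.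
  - exact: (localD H xy').
  move=> /(regular_at_affine _ (oner_neq0 _) xy) lf /(regular_at_affine _ (oner_neq0 _) xy) lg.
  by apply: (localM H xy' lf); apply: (local_derivation f0 H xy' n2 dD0 D0X).
(* the derivation of the chart at infinity: it maps U to 2W *)
have dD1 : derivation e (fun h => - X^-1 * D0 h).
  by split=> [a|x y|x y]; rewrite ?D00 ?D0D ?D0M; ring.
have vD1 : v (fun h => - X^-1 * D0 h) = - X^-1 * qeval e X Y p.
  have XY : D0 X != 0 by rewrite D0X mulf_neq0.
  by apply: (mulfI XY); rewrite -hp (vprop _ _ dD1 dD0); ring.
have [p2 p1] : p.2 = 0 /\ (size p.1 <= 2)%N.
  apply: infinity_pole_bound; rewrite -vD1.
  have CQ : C (1 *: chart_pt false 0 0).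
    by apply: curve_C_chart (oner_neq0 _) _; rewrite chart_polyE; ring.
  have y0f : 0 ^+ 2 = peval s 0 (chart_poly A B false) by rewrite chart_polyE; ring.
  have D1U : - X^-1 * D0 U = 2 * W.
    have [E _] := derivation_infinity dD0.
    have W0 : W != 0 by rewrite mulf_neq0 // invr_eq0 expf_neq0.
    apply: (mulfI W0); move: E; rewrite D0X => E.
    by apply: (eq_lin (u := - X ^- 3) E); rewrite /W; field.
  have [r [rr vE]] := rv _ CQ; rewrite vE //.
  have g0 : chart_poly A B false != 0.
    apply: contra Y0 => /eqP g0; have := hyp_eq H'; rewrite g0 rmorph0 => /eqP.
    by rewrite sqrf_eq0 mulf_eq0 invr_eq0 expf_eq0 (negbTE X0) andbF orbF.
  rewrite big_seq; apply: big_ind => [|g h lg lh|fg /rr[]].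
  - by have := local_qeval e s U W 0 0 (0, 0); rewrite /qeval /= !rmorph0 mul0r addr0.
  - exact: (localD H' y0f).
  move=> /(regular_at_infinity _ (oner_neq0 _)) lf /(regular_at_infinity _ (oner_neq0 _)) lg.
  by apply: (localM H' y0f lf); apply: (local_derivation g0 H' y0f n2 dD1 D1U).
have hE : v D0 = e p.1`_0 + e p.1`_1 * X.
  rewrite hp /qeval p2 rmorph0 mul0r addr0 /peval (@horner_coef_wide _ 2) ?size_map_poly //.
  by rewrite !big_ord_recl big_ord0 /= !coef_map expr0 expr1 mulr1 addr0.
have two : 2 != 0 :> k by apply: natr_neq0 s 1.
exists (\row_i (p.1`_i / 2)); split=> [D dD|c cE].
  have := vprop D D0 dD dD0; rewrite hE D0X => E.
  rewrite !big_ord_recl big_ord0 !mxE /= !fmorph_div !rmorph_nat.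
  have Y2 : 2 * Y != 0 by rewrite mulf_neq0.
  apply: (mulfI Y2); apply: (eq_lin (u := 1) E); field.
  by rewrite Y0 n2.
have := cE _ dD0; rewrite hE D0X !big_ord_recl big_ord0 /= => E.
have /(peval_inj H) pE : peval e X (p.1`_0 *: 1 + p.1`_1 *: 'X) =
    peval e X ((2 * c 0 ord0) *: 1 + (2 * c 0 (lift ord0 ord0)) *: 'X).
  rewrite !rmorphD /= !pevalZ !rmorph1 !pevalX mulr1 E !rmorphM !rmorph_nat; field.
  exact: Y0.
have c0 : p.1`_0 = 2 * c 0 ord0.
  by have := congr1 (fun r : {poly k} => r`_0) pE; rewrite !coefD !coefZ !coef1 !coefX /= !mulr1 !mulr0 !addr0.
have c1 : p.1`_1 = 2 * c 0 (lift ord0 ord0).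
  by have := congr1 (fun r : {poly k} => r`_1) pE; rewrite !coefD !coefZ !coef1 !coefX /= !mulr1 !mulr0 !add0r.
apply/rowP => i; rewrite mxE; case: i => -[|[|//]] hi /=.
  by rewrite c0 (_ : Ordinal hi = ord0); [field | apply: val_inj].
by rewrite c1 (_ : Ordinal hi = lift ord0 ord0); [field | apply: val_inj].
Qed.

End Genus.

(** The universal property of the fraction field. *)
Lemma fraction_lift (R : idomainType) (L : fieldType) (phi : {rmorphism R -> L}) :
  (forall a, phi a = 0 -> a = 0) ->
  exists sig : {rmorphism {fraction R} -> L}, forall a, sig (tf a) = phi a.
Proof.
move=> inj; have phi0 a : a != 0 -> phi a != 0 by apply: contra => /eqP/inj ->.
have ex (r : {fraction R}) : exists ab : R * R, (ab.2 != 0) && (r == tf ab.1 / tf ab.2).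
  by have [a [b [b0 ->]]] := fracP r; exists (a, b); rewrite b0 eqxx.
pose sig r := let ab := xchoose (ex r) in phi ab.1 / phi ab.2.
have sigE a b : b != 0 -> sig (tf a / tf b) = phi a / phi b.
  move=> b0; rewrite /sig; set ab := xchoose _.
  have := xchooseP (ex (tf a / tf b)); rewrite -/ab => /andP[d0 /eqP E].
  have tb : tf b != 0 by rewrite tofrac_eq0.
  have td : tf ab.2 != 0 by rewrite tofrac_eq0.
  have {}E : a * ab.2 = ab.1 * b.
    by apply/eqP; rewrite -tofrac_eq !rmorphM -eqr_div // E.
  by apply/eqP; rewrite eqr_div ?phi0 // -!rmorphM E mulrC.
have num r : exists a b, [/\ b != 0, r = tf a / tf b & sig r = phi a / phi b].
  by have [a [b [b0 ->]]] := fracP r; exists a, b; rewrite sigE.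
have sigB : zmod_morphism sig.
  move=> u v; have [a [b [b0 -> ->]]] := num u; have [c [d [dn0 -> ->]]] := num v.
  have -> : tf a / tf b - tf c / tf d = tf (a * d - c * b) / tf (b * d).
    by rewrite -mulNr addf_div ?tofrac_eq0 // rmorphB !rmorphM mulNr.
  rewrite sigE ?mulf_neq0 // rmorphB !rmorphM /=; field.
  by rewrite !phi0.
have sigM : monoid_morphism sig.
  split=> [|u v].
    have -> : 1 = tf 1 / tf 1 :> {fraction R} by rewrite rmorph1 divr1.
    by rewrite sigE ?oner_neq0 // rmorph1 divr1.
  have [a [b [b0 -> ->]]] := num u; have [c [d [dn0 -> ->]]] := num v.
  have -> : tf a / tf b * (tf c / tf d) = tf (a * c) / tf (b * d).
    by rewrite !rmorphM /= mulf_div.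
  by rewrite sigE ?mulf_neq0 // !rmorphM mulf_div.
pose s1 := GRing.isZmodMorphism.Build _ _ sig sigB.
pose s2 := GRing.isMonoidMorphism.Build _ _ sig sigM.
pose sg : {rmorphism {fraction R} -> L} := HB.pack sig s1 s2.
exists sg => a /=.
by have := sigE a 1 (oner_neq0 _); rewrite !rmorph1 !divr1.
Qed.

(** * Cubic extensions of rational function fields *)

Section CubicIndependence.
Context (k : fieldType) (N D : {poly k}).
Hypotheses (sN : size N = 4%N) (coND : coprimep N D).

(** The numerator D^n P(N / D). *)
Definition substitute n (P : {poly k}) : {poly k} :=
  \sum_(j < n.+1) P`_j *: (N ^+ j * D ^+ (n - j)).

Lemma substituteS n P :
  substitute n.+1 P = N * substitute n (drop_poly 1 P) + P`_0 *: D ^+ n.+1.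
Proof.
rewrite /substitute big_ord_recl /= subn0 mul1r addrC; congr (_ + _).
rewrite mulr_sumr; apply: eq_bigr => j _.
by rewrite coef_drop_poly addn1 /bump /= add1n subSS exprS -scalerAr mulrA.
Qed.

(** Infinite descent.  Modulo N only the constant terms of the P_i survive, so
    N divides D^n times a polynomial of degree at most 2; as N is a cubic prime
    to D, the constant terms vanish and one factor N cancels. *)
Lemma substitute_free n (P0 P1 P2 : {poly k}) :
  (size P0 <= n)%N -> (size P1 <= n)%N -> (size P2 <= n)%N ->
  substitute n P0 + substitute n P1 * 'X + substitute n P2 * 'X^2 = 0 ->
  [/\ P0 = 0, P1 = 0 & P2 = 0].
Proof.
elim: n P0 P1 P2 => [|n IH] P0 P1 P2.
  by rewrite !leqn0 !size_poly_eq0 => /eqP -> /eqP -> /eqP ->.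
move=> s0 s1 s2; rewrite !substituteS.
pose c := (P0`_0)%:P + P1`_0 *: 'X + P2`_0 *: 'X^2.
set S0 := substitute n _; set S1 := substitute n _; set S2 := substitute n _.
move=> E; have {}E : N * (S0 + S1 * 'X + S2 * 'X^2) + c * D ^+ n.+1 = 0.
  by rewrite -E /c -!mul_polyC; ring.
have c0 : c = 0.
  apply/eqP; have : N %| c.
    rewrite -(@Gauss_dvdpl _ _ (D ^+ n.+1)) ?coprimep_expr //.
    have -> : c * D ^+ n.+1 = N * - (S0 + S1 * 'X + S2 * 'X^2).
      by rewrite mulrN; apply/eqP; rewrite -addr_eq0 addrC E.
    exact: dvdp_mulr.
  apply: contraLR => cn0; apply/negP => /(dvdp_leq cn0); rewrite sN.
  apply/negP; rewrite -ltnNge ltnS; apply/leq_sizeP => i.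
  rewrite /c !(coefD, coefZ, coefC, coefX, coefXn).
  by case: i => [|[|[|i]]] // _; rewrite /= !mulr0 !addr0.
have [z0 z1 z2] : [/\ P0`_0 = 0, P1`_0 = 0 & P2`_0 = 0].
  have ci i : c`_i = 0 by rewrite c0 coef0.
  split; [move: (ci 0%N)|move: (ci 1%N)|move: (ci 2%N)];
  by rewrite /c !(coefD, coefZ, coefC, coefX, coefXn) /= !(mulr0, mulr1, addr0, add0r).
have sd (P : {poly k}) : (size P <= n.+1)%N -> (size (drop_poly 1 P) <= n)%N.
  by move=> sP; rewrite size_drop_poly leq_subLR add1n.
have dz (P : {poly k}) : P`_0 = 0 -> drop_poly 1 P = 0 -> P = 0.
  move=> p0 pd; apply/polyP => -[|i]; rewrite coef0 //.
  by have /polyP/(_ i) := pd; rewrite coef_drop_poly coef0 addn1.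
have : N * (S0 + S1 * 'X + S2 * 'X^2) = 0 by move: E; rewrite c0 mul0r addr0.
move/eqP; rewrite mulf_eq0 -size_poly_eq0 sN /= => /eqP/IH[]; try exact: sd.
by move=> d0 d1 d2; split; apply: dz.
Qed.
End CubicIndependence.

(** The subfield k(t). *)
Definition rational_in (k L : fieldType) (e : {rmorphism k -> L}) (t h : L) :=
  exists a b : {poly k}, peval e t b != 0 /\ h = peval e t a / peval e t b.

(** k(t) + k(t) y, which is the field k(t, y) as soon as y^2 is in k(t). *)
Definition adjoined (k L : fieldType) (e : {rmorphism k -> L}) (t y h : L) :=
  exists a b c : {poly k}, peval e t c != 0 /\
    h = (peval e t a + peval e t b * y) / peval e t c.

Section RationalIn.
Context (k L : fieldType) (e : {rmorphism k -> L}) (t : L).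
Local Notation rational := (rational_in e t).

Lemma rational_peval a : rational (peval e t a).
Proof. by exists a, 1; rewrite rmorph1 oner_neq0 divr1. Qed.

Lemma rationalD g h : rational g -> rational h -> rational (g + h).
Proof.
move=> [a [b [b0 ->]]] [c [d [d0 ->]]]; exists (a * d + c * b), (b * d).
by rewrite rmorphM mulf_neq0 // rmorphD !rmorphM addf_div.
Qed.

Lemma rationalM g h : rational g -> rational h -> rational (g * h).
Proof.
move=> [a [b [b0 ->]]] [c [d [d0 ->]]]; exists (a * c), (b * d).
by rewrite rmorphM mulf_neq0 // !rmorphM mulf_div.
Qed.

Lemma rationalV g : rational g -> rational g^-1.
Proof.
move=> [a [b [b0 ->]]]; have [a0|a0] := eqVneq (peval e t a) 0.
  by rewrite a0 mul0r invr0 -(rmorph0 (peval e t)); apply: rational_peval.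
by exists b, a; rewrite a0 invf_div.
Qed.

Lemma rational_horner u a : rational u -> rational (peval e u a).
Proof.
move=> ru; elim/poly_ind: a => [|p c IH].
  by rewrite rmorph0 -(rmorph0 (peval e t)); apply: rational_peval.
rewrite rmorphD rmorphM /= pevalX pevalC; apply: rationalD; first exact: rationalM.
by rewrite -(pevalC e t); apply: rational_peval.
Qed.
End RationalIn.

(** For t = N(X) / D(X) with N a cubic, the field k(X) has the basis 1, X, X^2
    over k(t). *)
Section CubicExtension.
Context (k L : fieldType) (e : {rmorphism k -> L}) (f : {poly k}) (X Y : L).
Hypotheses (H : hyperelliptic e f X Y) (span : spans_field e X Y).
Context (N D : {poly k}).
Hypotheses (sN : size N = 4%N) (sD : (size D <= 3)%N) (coND : coprimep N D).
Let t := peval e X N / peval e X D.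

Let D0 : D != 0.
Proof. by apply: contraTneq coND => ->; rewrite coprimep0 -size_poly_eq1 sN. Qed.

Let D1 : peval e X D != 0.
Proof. by apply: contra D0 => /eqP E; apply/eqP/(peval_inj H); rewrite E rmorph0. Qed.

Lemma peval_substitute n (P : {poly k}) : (size P <= n.+1)%N ->
  peval e X (substitute N D n P) = peval e t P * peval e X D ^+ n.
Proof.
move=> sP; rewrite /substitute rmorph_sum /= {2}/peval.
rewrite (@horner_coef_wide _ n.+1) ?size_map_poly // mulr_suml.
apply: eq_bigr => j _; rewrite pevalZ rmorphM !rmorphXn /= coef_map -mulrA; congr (_ * _).
have -> : peval e X D ^+ n = peval e X D ^+ (n - j) * peval e X D ^+ j.
  by rewrite -exprD subnK // -ltnS.
rewrite /t expr_div_n; have : peval e X D ^+ j != 0 by rewrite expf_neq0.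
move: (peval e X N ^+ j) (_ ^+ (n - j)) (_ ^+ j) => u v w w0; by field.
Qed.

Lemma cubic_free_poly (P0 P1 P2 : {poly k}) :
  peval e t P0 + peval e t P1 * X + peval e t P2 * X ^+ 2 = 0 ->
  [/\ P0 = 0, P1 = 0 & P2 = 0].
Proof.
move=> E; pose n := maxn (maxn (size P0) (size P1)) (size P2).
have [s0 s1 s2] : [/\ size P0 <= n, size P1 <= n & size P2 <= n]%N.
  by split; rewrite /n !leq_max leqnn ?orbT.
apply: (@substitute_free _ N D sN coND n) => //; apply: (peval_inj H).
rewrite !(rmorphD, rmorphXn, rmorphM) /= !pevalX rmorph0 !peval_substitute ?leqW //.
rewrite -[RHS](mul0r (peval e X D ^+ n)) -E; ring.
Qed.

Let phi0 a : peval e t a = 0 -> a = 0.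
Proof. by move=> a0; case: (@cubic_free_poly a 0 0) => //; rewrite a0 !rmorph0; ring. Qed.

Lemma rational_hyp_free u v : rational_in e X u -> rational_in e X v ->
  u + v * Y = 0 -> u = 0 /\ v = 0.
Proof.
move=> [a [b [b0 ->]]] [c [d [dn0 ->]]] E.
have /(hyp_free H)[/eqP + /eqP] : qeval e X Y (a * d, c * b) = 0.
  rewrite /qeval /= !rmorphM /= -(mulr0 (peval e X b * peval e X d)) -E; field.
  by rewrite b0 dn0.
have bn0 : b != 0 by apply: contraNneq b0 => ->; rewrite rmorph0.
have d1 : d != 0 by apply: contraNneq dn0 => ->; rewrite rmorph0.
rewrite !mulf_eq0 (negbTE bn0) (negbTE d1) !orbF => /eqP -> /eqP ->.
by rewrite rmorph0 !mul0r.
Qed.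

Section Sigma.
Context (sig : {rmorphism {fraction {poly k}} -> L}).
Hypothesis sigE : forall a, sig (tf a) = peval e t a.

Lemma sig_rational r : rational_in e X (sig r).
Proof.
have [a [b [b0 ->]]] := fracP r; rewrite fmorph_div !sigE.
have rt : rational_in e X t by exists N, D.
by apply: rationalM; [|apply: rationalV]; apply: rational_horner.
Qed.

Lemma cubic_free r0 r1 r2 : sig r0 + sig r1 * X + sig r2 * X ^+ 2 = 0 ->
  [/\ r0 = 0, r1 = 0 & r2 = 0].
Proof.
have [a0 [b0 [n0 ->]]] := fracP r0; have [a1 [b1 [n1 ->]]] := fracP r1.
have [a2 [b2 [n2 ->]]] := fracP r2; rewrite !fmorph_div !sigE => E.
have [m0 m1 m2] : [/\ peval e t b0 != 0, peval e t b1 != 0 & peval e t b2 != 0].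
  by split; [move: n0|move: n1|move: n2]; apply: contra => /eqP/phi0/eqP.
have [] := @cubic_free_poly (a0 * (b1 * b2)) (a1 * (b0 * b2)) (a2 * (b0 * b1)).
  rewrite !rmorphM /= -(mulr0 (peval e t b0 * peval e t b1 * peval e t b2)) -E; field.
  by rewrite m0 m1 m2.
move=> /eqP + /eqP + /eqP; rewrite !mulf_eq0 (negbTE n0) (negbTE n1) (negbTE n2) !orbF.
by move=> /eqP -> /eqP -> /eqP ->; rewrite !rmorph0 !mul0r.
Qed.

Let coef : {rmorphism k -> {fraction {poly k}}} := (@FracField.tofrac {poly k} \o polyC)%FUN.

Lemma peval_sig_map p : peval sig X (map_poly coef p) = peval e X p.
Proof.
rewrite /peval -map_poly_comp; congr (_.[_]); apply: eq_map_poly => c /=.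
by rewrite sigE pevalC.
Qed.

(** X is a root of the cubic m = N - t D.  By the freeness of 1, X, X^2, no
    polynomial of smaller degree over k(t) vanishes at X; hence a polynomial g
    with g(X) <> 0 is prime to m, and a Bezout relation inverts g(X). *)
Lemma cubic_span u : rational_in e X u ->
  exists r0 r1 r2, u = sig r0 + sig r1 * X + sig r2 * X ^+ 2.
Proof.
move=> [a [g [g0 ->]]].
pose m := map_poly coef N - tf 'X *: map_poly coef D.
have szm : size m = 4%N.
  rewrite /m size_polyDl ?size_map_poly // size_polyN sN ltnS.
  by rewrite (leq_trans (size_scale_leq _ _)) // size_map_poly.
have m0 : peval sig X m = 0.
  rewrite rmorphB /= pevalZ !peval_sig_map sigE pevalX.
  by rewrite divfK // subrr.
have low (r : {poly {fraction {poly k}}}) : (size r <= 3)%N -> peval sig X r = sig r`_0 + sig r`_1 * X + sig r`_2 * X ^+ 2.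
  move=> sr; rewrite /peval (@horner_coef_wide _ 3) ?size_map_poly //.
  by rewrite !big_ord_recl big_ord0 !coef_map /= mulr1 addr0 addrA.
have indep (r : {poly {fraction {poly k}}}) : (size r <= 3)%N -> peval sig X r = 0 -> r = 0.
  move=> sr; rewrite low // => /cubic_free[z0 z1 z2]; apply/polyP => -[|[|[|i]]];
  by rewrite coef0 // nth_default // (leq_trans sr).
pose g' := map_poly coef g.
have /Bezout_eq1_coprimepP[[w v] /= wv] : coprimep g' m.
  set d := gcdp g' m; have /dvdpP[q mq] : d %| m by apply: dvdp_gcdr.
  have /dvdpP[q' gq] : d %| g' by apply: dvdp_gcdl.
  have d0 : peval sig X d != 0.
    apply: contra g0 => /eqP d0; rewrite -peval_sig_map -/g' gq rmorphM /= d0.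
    by rewrite mulr0.
  have q0 : peval sig X q = 0.
    by apply/eqP; move/eqP: m0; rewrite mq rmorphM /= mulf_eq0 (negbTE d0) orbF.
  have mn0 : m != 0 by rewrite -size_poly_eq0 szm.
  have [dn0 qn0] : d != 0 /\ q != 0.
    by move: mn0; rewrite mq mulf_eq0 negb_or => /andP[].
  have sq : (3 < size q)%N.
    by rewrite ltnNge; apply: contra qn0 => sq; apply/eqP/indep.
  rewrite /coprimep -/d eqn_leq size_poly_gt0 dn0 andbT.
  have := szm; rewrite mq size_mul // => sE.
  have aux i j : ((i + j).-1 = 4 -> 3 < i -> j <= 1)%N by lia.
  exact: aux sE sq.
have wE : peval sig X w * peval e X g = 1.
  have := congr1 (peval sig X) wv; rewrite rmorphD !rmorphM /= m0 mulr0 addr0.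
  by rewrite rmorph1 peval_sig_map.
pose r := (map_poly coef a * w) %% m.
have sr : (size r <= 3)%N by rewrite -ltnS -szm ltn_modp -size_poly_eq0 szm.
exists r`_0, r`_1, r`_2; rewrite -low //.
have := congr1 (peval sig X) (divp_eq (map_poly coef a * w) m).
rewrite rmorphD !rmorphM /= m0 mulr0 add0r -/r => <-.
by rewrite peval_sig_map; apply: (mulIf g0); rewrite divfK // -mulrA wE mulr1.
Qed.

End Sigma.

(** k(X, Y) = k(X) + k(X) y, and M = k(t) + k(t) y, so a basis of k(X) over
    k(t) is also one of k(X, Y) over M. *)
Lemma cubic_degree (M : L -> Prop) (rho y : L) :
  rational_in e X rho -> rho != 0 -> y = rho * Y ->
  (forall h, M h <-> adjoined e t y h) ->
  extension_degree M 3.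
Proof.
move=> rrho rho0 yE ME.
have [sig sigE] := fraction_lift phi0.
have Msig h : M h <-> exists p q, h = sig p + sig q * y.
  rewrite ME; split=> [[a [b [c [c0 ->]]]]|[p [q ->]]].
    exists (tf a / tf c), (tf b / tf c); rewrite !fmorph_div !sigE; field.
    exact: c0.
  have [a [b [b0 ->]]] := fracP p; have [c [d [dn0 ->]]] := fracP q.
  have b1 : peval e t b != 0 by move: b0; apply: contra => /eqP/phi0/eqP.
  have d1 : peval e t d != 0 by move: dn0; apply: contra => /eqP/phi0/eqP.
  exists (a * d), (c * b), (b * d); rewrite !fmorph_div !sigE !rmorphM mulf_neq0 //; split=> //=.
  by field; rewrite b1 d1.
have sum3 (c : 'rV[L]_3) : \sum_(i < 3) c 0 i * (\row_(j < 3) X ^+ j) 0 i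
    = c 0 0 + c 0 1 * X + c 0 2 * X ^+ 2.
  rewrite !big_ord_recr big_ord0 /= add0r !mxE /= expr0 expr1 mulr1.
  by congr (c 0 _ + c 0 _ * _ + c 0 _ * _); apply: val_inj.
exists (\row_(j < 3) X ^+ j) => h.
have [P [c [c0 hE]]] := span h.
have [p0 [p1 [p2 pE]]] := cubic_span sigE (ex_intro _ P.1 (ex_intro _ c (conj c0 erefl))).
have [q0 [q1 [q2 qE]]] : exists r0 r1 r2, peval e X P.2 / peval e X c / rho =
    sig r0 + sig r1 * X + sig r2 * X ^+ 2.
  apply: (cubic_span sigE); apply: rationalM; last exact: rationalV.
  by exists P.2, c.
have hE' : h = (sig p0 + sig q0 * y) + (sig p1 + sig q1 * y) * X + (sig p2 + sig q2 * y) * X ^+ 2.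
  have -> : h = peval e X P.1 / peval e X c + peval e X P.2 / peval e X c / rho * y.
    by rewrite hE /qeval yE; field; rewrite c0 rho0.
  by rewrite pE qE; ring.
exists (\row_(j < 3) [:: sig p0 + sig q0 * y; sig p1 + sig q1 * y; sig p2 + sig q2 * y]`_j).
split; first split.
- move=> i; apply/Msig; rewrite mxE.
  by case: i => -[|[|[|//]]] hi /=; [exists p0, q0|exists p1, q1|exists p2, q2].
- by rewrite sum3 !mxE.
move=> c' []; rewrite sum3 => Mc hc.
have [a0 [b0 E0]] := (Msig _).1 (Mc 0); have [a1 [b1 E1]] := (Msig _).1 (Mc 1).
have [a2 [b2 E2]] := (Msig _).1 (Mc 2).
pose u := sig (a0 - p0) + sig (a1 - p1) * X + sig (a2 - p2) * X ^+ 2.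
pose v := sig (b0 - q0) + sig (b1 - q1) * X + sig (b2 - q2) * X ^+ 2.
have rX : rational_in e X X by rewrite -{2}(pevalX e X); apply: rational_peval.
have rat3 r0 r1 r2 : rational_in e X (sig r0 + sig r1 * X + sig r2 * X ^+ 2).
  by do ![apply: rationalD|apply: rationalM|exact: sig_rational].
have uv : u + v * rho * Y = 0.
  by rewrite -mulrA -yE /u /v !rmorphB -(subrr h) {1}hc hE' E0 E1 E2; ring.
have [] := rational_hyp_free (rat3 _ _ _) (rationalM (rat3 _ _ _) rrho) uv.
move=> /(cubic_free sigE)[/subr0_eq ea0 /subr0_eq ea1 /subr0_eq ea2] /eqP.
rewrite mulf_eq0 (negbTE rho0) orbF => /eqP/(cubic_free sigE).
move=> [/subr0_eq eb0 /subr0_eq eb1 /subr0_eq eb2].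
apply/rowP => i; rewrite mxE; case: i => -[|[|[|//]]] hi /=.
- by rewrite (_ : Ordinal hi = 0) ?E0 ?ea0 ?eb0 //; apply: val_inj.
- by rewrite (_ : Ordinal hi = 1) ?E1 ?ea1 ?eb1 //; apply: val_inj.
- by rewrite (_ : Ordinal hi = 2) ?E2 ?ea2 ?eb2 //; apply: val_inj.
Qed.

End CubicExtension.

(** * The field of a point *)

Section PointField.
Context (k L : fieldType) (e : {rmorphism k -> L}) (n : nat) (v : 'rV[L]_n).
Local Notation pf := (point_field e v).

Lemma point_field_const a : pf (e a).
Proof.
exists 0%N, (a *: 1), 1; rewrite evZ !ev1 divr1 mulr1 oner_neq0 dhomog1; split=> //.
by apply: dhomogZ; apply: dhomog1.
Qed.

Lemma point_fieldD g h : pf g -> pf h -> pf (g + h).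
Proof.
move=> [d [F [G [hF hG G0 ->]]]] [d' [F' [G' [hF' hG' G0' ->]]]].
exists (d + d')%N, (F * G' + F' * G), (G * G'); rewrite !evE mulf_neq0 // addf_div //.
split=> //; last exact: dhomogM.
by apply: dhomogD; [|rewrite addnC]; apply: dhomogM.
Qed.

Lemma point_fieldM g h : pf g -> pf h -> pf (g * h).
Proof.
move=> [d [F [G [hF hG G0 ->]]]] [d' [F' [G' [hF' hG' G0' ->]]]].
exists (d + d')%N, (F * F'), (G * G'); rewrite !evE mulf_neq0 // mulf_div.
by split=> //; apply: dhomogM.
Qed.

Lemma point_fieldV g : pf g -> pf g^-1.
Proof.
move=> [d [F [G [hF hG G0 ->]]]]; have [F0|F0] := eqVneq (ev e F v) 0.
  by rewrite F0 mul0r invr0 -(rmorph0 e); apply: point_field_const.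
by exists d, G, F; rewrite invf_div.
Qed.

Lemma point_field_ratio i j : v 0 j != 0 -> pf (v 0 i / v 0 j).
Proof. by move=> vj; exists 1%N, 'X_i, 'X_j; rewrite !evX; split; rewrite ?homog_X. Qed.

Lemma point_field_peval t p : pf t -> pf (peval e t p).
Proof.
move=> ft; elim/poly_ind: p => [|p c IH].
  by rewrite rmorph0 -(rmorph0 e); apply: point_field_const.
rewrite rmorphD rmorphM /= pevalX pevalC; apply: point_fieldD; first exact: point_fieldM.
exact: point_field_const.
Qed.

End PointField.

Section Adjoined.
Context (k L : fieldType) (e : {rmorphism k -> L}) (t y : L).
Hypothesis y2 : rational_in e t (y ^+ 2).
Local Notation adj := (adjoined e t y).
Local Notation rational := (rational_in e t).

Lemma adjoinedP h : adj h <-> exists u v, [/\ rational u, rational v & h = u + v * y].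
Proof.
split=> [[a [b [c [c0 ->]]]]|[_ [_ [[a [b [b0 ->]]] [c [d [d0 ->]]] ->]]]].
  exists (peval e t a / peval e t c), (peval e t b / peval e t c).
  by split; [exists a, c|exists b, c|field].
exists (a * d), (c * b), (b * d); rewrite !rmorphM mulf_neq0 //; split=> //=.
by field; rewrite b0 d0.
Qed.

Lemma rational_adjoined u : rational u -> adj u.
Proof.
move=> ru; apply/adjoinedP; exists u, 0; split=> //; last by rewrite mul0r addr0.
by rewrite -(rmorph0 (peval e t)); apply: rational_peval.
Qed.

Lemma adjoined_gen : adj y.
Proof.
apply/adjoinedP; exists 0, 1; split; last by rewrite mul1r add0r.
  by rewrite -(rmorph0 (peval e t)); apply: rational_peval.
by rewrite -(rmorph1 (peval e t)); apply: rational_peval.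
Qed.

Lemma adjoined_const c : adj (e c).
Proof. by apply: rational_adjoined; rewrite -(pevalC e t); apply: rational_peval. Qed.

Lemma adjoinedD g h : adj g -> adj h -> adj (g + h).
Proof.
move=> /adjoinedP[a [b [ra rb ->]]] /adjoinedP[c [d [rc rd ->]]]; apply/adjoinedP.
by exists (a + c), (b + d); split; [apply: rationalD|apply: rationalD|ring].
Qed.

Lemma adjoinedM g h : adj g -> adj h -> adj (g * h).
Proof.
move=> /adjoinedP[a [b [ra rb ->]]] /adjoinedP[c [d [rc rd ->]]]; apply/adjoinedP.
exists (a * c + b * d * y ^+ 2), (a * d + b * c); split; last by ring.
  by apply: rationalD; apply: rationalM => //; apply: rationalM.
by apply: rationalD; apply: rationalM.
Qed.

Lemma adjoinedV g : adj g -> adj g^-1.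
Proof.
move=> /adjoinedP[u [v [ru rv ->]]].
have rN w : rational w -> rational (- w).
  move=> rw; rewrite -mulN1r; apply: rationalM => //.
  by rewrite -(rmorph1 (peval e t)) -rmorphN; apply: rational_peval.
have [E|uv0] := eqVneq (u - v * y) 0.
  have -> : u + v * y = u + u by apply: (eq_lin (u := - 1) E); ring.
  by apply/rational_adjoined/rationalV/rationalD.
have -> : (u + v * y)^-1 = (u - v * y) * (u ^+ 2 - v ^+ 2 * y ^+ 2)^-1.
  have -> : u ^+ 2 - v ^+ 2 * y ^+ 2 = (u - v * y) * (u + v * y) by ring.
  by rewrite invfM mulrA divff // mul1r.
apply: adjoinedM.
  apply: adjoinedD; first exact: rational_adjoined.
  rewrite -mulNr; apply: adjoinedM; last exact: adjoined_gen.
  exact/rational_adjoined/rN.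
apply/rational_adjoined/rationalV/rationalD; rewrite !expr2; first exact: rationalM.
by apply/rN/rationalM => //; apply: rationalM.
Qed.

(** Both inclusions hold because k(t) + k(t) y is a field; by homogeneity v may
    be replaced by a multiple of it. *)
Lemma point_field_adjoined n (v w : 'rV[L]_n) (c : L) :
  c != 0 -> v = c *: w -> (forall i, adj (w 0 i)) ->
  point_field e v t -> point_field e v y ->
  forall h, point_field e v h <-> adj h.
Proof.
move=> c0 vE aw ft fy h; split.
  have aev (F : {mpoly k[n]}) : adj (ev e F w).
    elim/mpoly_closed: F => [a|i|F G IF IG|F G IF IG]; rewrite ?evE //.
    - exact: adjoined_const.
    - exact: adjoinedD.
    - exact: adjoinedM.
  move=> [d [F [G [hF hG G0 ->]]]].
  rewrite vE (ev_scale e w c hF) (ev_scale e w c hG) -mulf_div divff ?expf_neq0 // mul1r.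
  by apply: adjoinedM => //; apply: adjoinedV.
move=> [a [b [d [d0 ->]]]].
apply: point_fieldM; last by apply: point_fieldV; apply: point_field_peval.
apply: point_fieldD; first exact: point_field_peval.
by apply: point_fieldM => //; apply: point_field_peval.
Qed.
End Adjoined.

(** * The Cayleyan as a plane cubic in the dual plane *)

Lemma sum3 (R : nmodType) (F : 'I_3 -> R) : \sum_(i < 3) F i = F 0 + F 1 + F 2.
Proof.
rewrite !big_ord_recr big_ord0 /= add0r.
by congr (F _ + F _ + F _); apply: val_inj.
Qed.

Lemma row3_eq (S : Type) (v w : 'rV[S]_3) :
  v 0 0 = w 0 0 -> v 0 1 = w 0 1 -> v 0 2 = w 0 2 -> v = w.
Proof.
move=> h0 h1 h2; apply/rowP => -[[|[|[|i]]] //= hi];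
by [rewrite (_ : Ordinal hi = 0) //; apply: val_inj
   |rewrite (_ : Ordinal hi = 1) //; apply: val_inj
   |rewrite (_ : Ordinal hi = 2) //; apply: val_inj].
Qed.

Lemma pt3_neq0 (S : fieldType) (x y z : S) :
  [|| x != 0, y != 0 | z != 0] -> pt3 x y z != 0.
Proof.
apply: contraTneq => /rowP E; have := (E 0, E 1, E 2); rewrite !mxE /=.
by move=> [[-> ->] ->]; rewrite !eqxx.
Qed.

Section Cayleyan.
Context (k : fieldType) (A B : k) (s : {rmorphism k -> algC}).
Hypotheses (A0 : A != 0) (d0 : delta A B != 0).
Implicit Types a b l : 'rV[algC]_3.

Lemma meval_map (p : {mpoly k[3]}) b : (map_mpoly s p).@[b 0] = ev s p b.
Proof.
elim/mpoly_closed: p => [c|i|p q IHp IHq|p q IHp IHq].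
- by rewrite map_mpolyC mevalC evC.
- by rewrite map_mpolyX mevalXU evX.
- by rewrite rmorphD mevalD evD IHp IHq.
- by rewrite rmorphM mevalM evM IHp IHq.
Qed.

Lemma mderiv_map (p : {mpoly k[3]}) j : (map_mpoly s p)^`M(j) = map_mpoly s p^`M(j).
Proof.
elim/mpoly_closed: p => [c|i|p q IHp IHq|p q IHp IHq].
- by rewrite map_mpolyC !mderivC rmorph0.
- rewrite map_mpolyX !mderiv_var map_mpolyC; congr (_%:MP).
  by case: eqP => _; apply/esym; [apply: rmorph1|apply: rmorph0].
- by rewrite rmorphD !mderivD IHp IHq rmorphD.
- by rewrite rmorphM !mderivM IHp IHq rmorphD !rmorphM.
Qed.

(** The vanishing of the gradient at b of the polar conic of a, up to constant
    factors.  These equations are symmetric in a and b. *)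
Definition polar_equations a b : Prop :=
  [/\ 3 * a 0 0 * b 0 0 + s A * a 0 2 * b 0 2 = 0,
      a 0 1 * b 0 2 + a 0 2 * b 0 1 = 0
    & a 0 1 * b 0 1 - s A * (a 0 0 * b 0 2 + a 0 2 * b 0 0) - 3 * s B * a 0 2 * b 0 2 = 0].

Lemma conic_singularE a b :
  conic_singular_at (polar_conic A B s a) b <-> b != 0 /\ polar_equations a b.
Proof.
have two : 2 != 0 :> algC by rewrite pnatr_eq0.
have W0 : (weierstrass_form A B)^`M(0) = - (3 *: 'X_0 ^+ 2 + A *: 'X_2 ^+ 2).
  rewrite /weierstrass_form !exprS !expr0 !mulr1 !mderivE /= !mpolyC0 !mpolyC1 -!mul_mpolyC mpolyC_nat; ring.
have W1 : (weierstrass_form A B)^`M(1) = 2 *: ('X_1 * 'X_2).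
  rewrite /weierstrass_form !exprS !expr0 !mulr1 !mderivE /= !mpolyC0 !mpolyC1 -!mul_mpolyC mpolyC_nat; ring.
have W2 : (weierstrass_form A B)^`M(2) = 'X_1 ^+ 2 - (2 * A) *: ('X_0 * 'X_2) - (3 * B) *: 'X_2 ^+ 2.
  rewrite /weierstrass_form !exprS !expr0 !mulr1 !mderivE /= !mpolyC0 !mpolyC1 -!mul_mpolyC !mpolyCM !mpolyC_nat; ring.
have evQ : (polar_conic A B s a).@[b 0] = a 0 0 * - (3 * b 0 0 ^+ 2 + s A * b 0 2 ^+ 2)
    + a 0 1 * (2 * b 0 1 * b 0 2)
    + a 0 2 * (b 0 1 ^+ 2 - 2 * s A * b 0 0 * b 0 2 - 3 * s B * b 0 2 ^+ 2).
  rewrite /polar_conic sum3 !mevalD !mevalZ !meval_map W0 W1 W2 !evE !(rmorphM, rmorph_nat) /=; ring.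
have evQj j : (polar_conic A B s a)^`M(j).@[b 0] =
    a 0 0 * ev s (weierstrass_form A B)^`M(0)^`M(j) b
    + a 0 1 * ev s (weierstrass_form A B)^`M(1)^`M(j) b
    + a 0 2 * ev s (weierstrass_form A B)^`M(2)^`M(j) b.
  rewrite /polar_conic; move: (weierstrass_form A B) => w.
  by rewrite sum3 !mderivD !mderivZ !mderiv_map !mevalD !mevalZ !meval_map.
have Q0 : (polar_conic A B s a)^`M(0).@[b 0] = - 2 * (3 * a 0 0 * b 0 0 + s A * a 0 2 * b 0 2).
  rewrite evQj W0 W1 W2 !expr2 !mderivE /= !evE !(rmorphM, rmorph_nat, rmorph0) /=; ring.
have Q1 : (polar_conic A B s a)^`M(1).@[b 0] = 2 * (a 0 1 * b 0 2 + a 0 2 * b 0 1).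
  rewrite evQj W0 W1 W2 !expr2 !mderivE /= !evE !(rmorphM, rmorph_nat, rmorph0) /=; ring.
have Q2 : (polar_conic A B s a)^`M(2).@[b 0] = 2 * (a 0 1 * b 0 1 - s A * (a 0 0 * b 0 2 + a 0 2 * b 0 0) - 3 * s B * a 0 2 * b 0 2).
  rewrite evQj W0 W1 W2 !expr2 !mderivE /= !evE !(rmorphM, rmorph_nat, rmorph0) /=; ring.
split=> [[b0 _ Q]|[b0 [E0 E1 E2]]].
  split=> //; split.
  - by apply: (mulfI two); apply: (eq_lin (u := - 1) (etrans (esym Q0) (Q 0))); ring.
  - by apply: (mulfI two); apply: (eq_lin (u := 1) (etrans (esym Q1) (Q 1))); ring.
  - by apply: (mulfI two); apply: (eq_lin (u := 1) (etrans (esym Q2) (Q 2))); ring.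
split=> //.
  rewrite evQ; apply: (eq_lin (u := - b 0 0) E0); apply: (eq_lin (u := b 0 1) E1).
  by apply: (eq_lin (u := b 0 2) E2); ring.
move=> j; case: j => -[|[|[|//]]] hj.
- by rewrite (_ : Ordinal hj = 0) ?Q0 ?E0 ?mulr0 //; apply: val_inj.
- by rewrite (_ : Ordinal hj = 1) ?Q1 ?E1 ?mulr0 //; apply: val_inj.
- by rewrite (_ : Ordinal hj = 2) ?Q2 ?E2 ?mulr0 //; apply: val_inj.
Qed.

Lemma hessianE a : hessian A B s a <-> a != 0 /\
  3 * s A * a 0 0 ^+ 2 * a 0 2 + 9 * s B * a 0 0 * a 0 2 ^+ 2
   + 3 * a 0 0 * a 0 1 ^+ 2 - s A ^+ 2 * a 0 2 ^+ 3 = 0.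
Proof.
have E : ev s (hessian_form A B) a = 3 * s A * a 0 0 ^+ 2 * a 0 2
   + 9 * s B * a 0 0 * a 0 2 ^+ 2 + 3 * a 0 0 * a 0 1 ^+ 2 - s A ^+ 2 * a 0 2 ^+ 3.
  by rewrite /hessian_form !evE !(rmorphXn, rmorphM, rmorph_nat) /=; ring.
split=> -[a0 H]; split=> //; first by rewrite -E; apply: H; rewrite inE.
by move=> p; rewrite inE => /eqP ->; rewrite E.
Qed.

(** The equation of the Cayleyan in the dual plane. *)
Definition dual_cubic l : algC :=
  s A * l 0 0 ^+ 3 + 9 * s B * l 0 0 * l 0 1 ^+ 2 + 3 * l 0 0 * l 0 2 ^+ 2
  - 6 * s A * l 0 1 ^+ 2 * l 0 2.

Let A1 : s A != 0. Proof. by rewrite fmorph_eq0. Qed.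
Let sd : 4 * s A ^+ 3 + 27 * s B ^+ 2 != 0.
Proof. by rewrite -rmorph_delta fmorph_eq0. Qed.
Let two0 : 2 != 0 :> algC. Proof. by rewrite pnatr_eq0. Qed.
Let three0 : 3 != 0 :> algC. Proof. by rewrite pnatr_eq0. Qed.

(** On a line l with l_0 <> 0 the middle equation gives (b_1 : b_2) =
    (a_1 : -a_2); then the other two express a_1^2 / a_2^2 in two ways by the
    coordinates of l, and equating them gives the cubic. *)
Lemma polar_line_dual a b l : a != 0 -> b != 0 -> polar_equations a b ->
  joining_line a b l -> dual_cubic l = 0.
Proof.
move=> a0 b0 [E0 E1 E2] [ab l0]; rewrite !sum3 => la lb.
have [xi0|xi] := eqVneq (l 0 0) 0.
  rewrite /dual_cubic xi0; suff /eqP : l 0 1 * l 0 2 = 0.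
    by rewrite mulf_eq0 => /orP[]/eqP ->; ring.
  apply/eqP/negPn/negP; rewrite mulf_eq0 negb_or => /andP[eta zeta].
  have a1 : a 0 1 = - l 0 2 * a 0 2 / l 0 1.
    by apply: (mulfI eta); apply: (eq_lin (u := 1) la); rewrite xi0; field.
  have b1 : b 0 1 = - l 0 2 * b 0 2 / l 0 1.
    by apply: (mulfI eta); apply: (eq_lin (u := 1) lb); rewrite xi0; field.
  have /eqP : a 0 2 * b 0 2 = 0.
    apply: (mulfI zeta); apply: (mulfI two0).
    by apply: (eq_lin (u := - l 0 1) E1); rewrite a1 b1; field.
  rewrite mulf_eq0 => /orP[]/eqP z2.
    have z1 : a 0 1 = 0 by rewrite a1 z2; ring.
    have z0 : a 0 0 != 0.
      by apply: contra a0 => /eqP z0; apply/eqP/row3_eq; rewrite !mxE.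
    have w0 : b 0 0 = 0.
      by apply: (mulfI z0); apply: (mulfI three0); apply: (eq_lin (u := 1) E0); rewrite z2; ring.
    have w2 : b 0 2 = 0.
      apply: (mulfI z0); apply: (mulfI A1); apply: (eq_lin (u := - 1) E2).
      by rewrite z2 z1 w0; ring.
    by case/eqP: b0; apply: row3_eq; rewrite !mxE // b1 w2; ring.
  have z1 : b 0 1 = 0 by rewrite b1 z2; ring.
  have z0 : b 0 0 != 0.
    by apply: contra b0 => /eqP z0; apply/eqP/row3_eq; rewrite !mxE.
  have w0 : a 0 0 = 0.
    by apply: (mulfI z0); apply: (mulfI three0); apply: (eq_lin (u := 1) E0); rewrite z2; ring.
  have w2 : a 0 2 = 0.
    apply: (mulfI z0); apply: (mulfI A1); apply: (eq_lin (u := - 1) E2).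
    by rewrite z2 z1 w0; ring.
  by case/eqP: a0; apply: row3_eq; rewrite !mxE // a1 w2; ring.
have a00 : a 0 0 = - (l 0 1 * a 0 1 + l 0 2 * a 0 2) / l 0 0.
  by apply: (mulfI xi); apply: (eq_lin (u := 1) la); field.
have b00 : b 0 0 = - (l 0 1 * b 0 1 + l 0 2 * b 0 2) / l 0 0.
  by apply: (mulfI xi); apply: (eq_lin (u := 1) lb); field.
have det : a 0 1 * b 0 2 - a 0 2 * b 0 1 != 0.
  apply/negP => /eqP det; apply: ab.
  have [a1|a1] := eqVneq (a 0 1) 0.
    have a2 : a 0 2 != 0.
      apply: contra a0 => /eqP a2; apply/eqP/row3_eq; rewrite !mxE // a00 a1 a2; ring.
    have b1 : b 0 1 = 0 by apply: (mulfI a2); apply: (eq_lin (u := - 1) det); rewrite a1; ring.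
    exists (b 0 2 / a 0 2).
      apply: contra b0; rewrite mulf_eq0 invr_eq0 (negbTE a2) orbF => /eqP b2.
      by apply/eqP/row3_eq; rewrite !mxE // b00 b1 b2; ring.
    by apply: row3_eq; rewrite !mxE ?a00 ?b00 ?a1 ?b1; field; rewrite ?a2 ?xi.
  have b2 : b 0 2 = a 0 2 * b 0 1 / a 0 1.
    by apply: (mulfI a1); apply: (eq_lin (u := 1) det); field.
  exists (b 0 1 / a 0 1).
    apply: contra b0; rewrite mulf_eq0 invr_eq0 (negbTE a1) orbF => /eqP b1.
    by apply/eqP/row3_eq; rewrite !mxE // ?b00 ?b2 b1; ring.
  by apply: row3_eq; rewrite !mxE ?a00 ?b00 ?b2; field; rewrite ?a1 ?xi.
have a1b2 : a 0 1 * b 0 2 != 0.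
  apply: contra det => /eqP E; apply/eqP.
  by apply: (mulfI two0); apply: (eq_lin (u := - 2) E1); apply: (eq_lin (u := 4) E); ring.
have [a1 b2] : a 0 1 != 0 /\ b 0 2 != 0.
  by move: a1b2; rewrite mulf_eq0 negb_or => /andP[].
have a2 : a 0 2 != 0.
  apply: contra a1b2 => /eqP a2; apply/eqP; apply: (eq_lin (u := 1) E1).
  by rewrite a2; ring.
have b1 : b 0 1 = - a 0 1 * b 0 2 / a 0 2.
  by apply: (mulfI a2); apply: (eq_lin (u := 1) E1); field.
have r : a 0 1 ^+ 2 = (2 * s A * l 0 2 / l 0 0 - 3 * s B) * a 0 2 ^+ 2.
  apply: (mulfI b2); apply: (eq_lin (u := - a 0 2) E2).
  by rewrite a00 b00 b1; field; rewrite a2 xi.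
apply: (mulfI a2); apply: (mulfI a2); apply: (mulfI b2).
apply: (eq_lin (u := l 0 0 ^+ 3 * a 0 2) E0).
apply: (eq_lin (u := 3 * l 0 0 * l 0 1 ^+ 2 * b 0 2) r).
by rewrite /dual_cubic a00 b00 b1; field; rewrite a2 xi.
Qed.

(** The polar equations say that the Hessian matrix at a kills b, so its
    determinant vanishes at a. *)
Lemma polar_hessian a b : b != 0 -> polar_equations a b ->
  3 * s A * a 0 0 ^+ 2 * a 0 2 + 9 * s B * a 0 0 * a 0 2 ^+ 2
   + 3 * a 0 0 * a 0 1 ^+ 2 - s A ^+ 2 * a 0 2 ^+ 3 = 0.
Proof.
move=> b0 [E0 E1 E2].
pose h := 3 * s A * a 0 0 ^+ 2 * a 0 2 + 9 * s B * a 0 0 * a 0 2 ^+ 2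
   + 3 * a 0 0 * a 0 1 ^+ 2 - s A ^+ 2 * a 0 2 ^+ 3.
have h0 : h * b 0 0 = 0.
  apply: (eq_lin (u := s A * a 0 0 * a 0 2 + 3 * s B * a 0 2 ^+ 2 + a 0 1 ^+ 2) E0).
  apply: (eq_lin (u := - s A * a 0 2 * a 0 1) E1).
  by apply: (eq_lin (u := s A * a 0 2 ^+ 2) E2); rewrite /h; ring.
have h1 : h * b 0 1 = 0.
  apply: (eq_lin (u := s A * a 0 1 * a 0 2) E0).
  apply: (eq_lin (u := 3 * s A * a 0 0 ^+ 2 + 9 * s B * a 0 0 * a 0 2 - s A ^+ 2 * a 0 2 ^+ 2) E1).
  by apply: (eq_lin (u := 3 * a 0 0 * a 0 1) E2); rewrite /h; ring.
have h2 : h * b 0 2 = 0.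
  apply: (eq_lin (u := - s A * a 0 2 ^+ 2) E0).
  apply: (eq_lin (u := 3 * a 0 0 * a 0 1) E1).
  by apply: (eq_lin (u := - 3 * a 0 0 * a 0 2) E2); rewrite /h; ring.
apply/eqP/negPn/negP => hn0; case/eqP: b0; apply: row3_eq; rewrite !mxE;
by apply: (mulfI hn0); rewrite mulr0.
Qed.

(** Conversely the two points are found by a square root: the pair
    (rho : 1), (rho : -1) for the last two coordinates when l_0 <> 0, the two
    roots of x^2 + (3B/A) x - A/3 on the line y = 0, and two coordinate points
    on the line z = 0.  They are distinct since delta <> 0. *)
Lemma dual_cubic_polar l : l != 0 -> dual_cubic l = 0 ->
  exists a b, [/\ a != 0, b != 0, polar_equations a b & joining_line a b l].
Proof.
move=> l0; rewrite /dual_cubic => E.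
have [xi0|xi] := eqVneq (l 0 0) 0.
  have [eta0|eta] := eqVneq (l 0 1) 0.
    exists (pt3 1 0 0), (pt3 0 1 0); split.
    - by apply: pt3_neq0; rewrite oner_neq0.
    - by apply: pt3_neq0; rewrite oner_neq0 orbT.
    - by split; rewrite !mxE /=; ring.
    split=> //; rewrite ?sum3 ?xi0 ?eta0 ?mxE /=; try ring.
    by case=> c c0 /rowP/(_ 1); rewrite !mxE /= mulr0 => /eqP; rewrite oner_eq0.
  have zeta : l 0 2 = 0.
    apply: (mulfI eta); apply: (mulfI eta); apply: (mulfI A1); apply: (mulfI (mulf_neq0 two0 three0)).
    by apply: (eq_lin (u := - 1) E); rewrite xi0; ring.
  pose D := (3 * s B / s A) ^+ 2 + 4 * s A / 3.
  have D0 : sqrtC D != 0.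
    rewrite sqrtC_eq0; apply: contra sd => /eqP D0; apply/eqP.
    by apply: (eq_lin (u := 3 * s A ^+ 2) D0); rewrite /D; field.
  have DD : sqrtC D ^+ 2 = D := sqrtCK D.
  exists (pt3 ((- (3 * s B / s A) + sqrtC D) / 2) 0 1), (pt3 ((- (3 * s B / s A) - sqrtC D) / 2) 0 1); split.
  - by apply: pt3_neq0; rewrite oner_neq0 !orbT.
  - by apply: pt3_neq0; rewrite oner_neq0 !orbT.
  - split; rewrite !mxE /=.
    + by apply: (eq_lin (u := - 3 / 4) DD); rewrite /D; field.
    + by ring.
    + by field.
  split=> //; rewrite ?sum3 ?xi0 ?zeta ?mxE /=; try ring.
  case=> c c0 /rowP Ec; have := Ec 2; rewrite !mxE /= mulr1 => c1.
  have := Ec 0; rewrite !mxE /= -c1 mul1r => Eq; case/eqP: D0.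
  by apply: (eq_lin (u := - 1) Eq); field.
pose rho := sqrtC (2 * s A * l 0 2 / l 0 0 - 3 * s B).
have rr : rho ^+ 2 = 2 * s A * l 0 2 / l 0 0 - 3 * s B := sqrtCK _.
exists (pt3 (- (l 0 1 * rho + l 0 2) / l 0 0) rho 1),
  (pt3 (- (l 0 1 * rho - l 0 2) / l 0 0) rho (- 1)); split.
- by apply: pt3_neq0; rewrite oner_neq0 !orbT.
- by apply: pt3_neq0; rewrite oppr_eq0 oner_neq0 !orbT.
- split; rewrite !mxE /=.
  + apply: (eq_lin (u := 3 * l 0 1 ^+ 2 / l 0 0 ^+ 2) rr).
    by apply: (eq_lin (u := - (l 0 0 ^- 3)) E); field.
  + by ring.
  + by apply: (eq_lin (u := 1) rr); field.
split=> //; rewrite ?sum3 ?mxE /=; try by field.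
case=> c c0 /rowP Ec; have := Ec 2; rewrite !mxE /= mulr1 => c1.
have := Ec 1; rewrite !mxE /= -c1 => Er.
have rho0 : rho = 0 by apply: (mulfI two0); apply: (eq_lin (u := 1) Er); ring.
have z : l 0 2 = 3 * s B * l 0 0 / (2 * s A).
  have : rho ^+ 2 = 0 by rewrite rho0 expr0n.
  rewrite rr => E'; apply: (mulfI two0); apply: (mulfI A1).
  by apply: (eq_lin (u := l 0 0) E'); field; rewrite ?A1 ?xi.
case/eqP: sd; apply: (mulfI xi); apply: (mulfI xi); apply: (mulfI xi).
apply: (eq_lin (u := 4 * s A ^+ 2) E); rewrite z; field.
exact: A1.
Qed.

Lemma cayleyanE l : cayleyan A B s l <-> l != 0 /\ dual_cubic l = 0.
Proof.
split=> [[a [b [/hessianE[a0 _] /conic_singularE[b0 Eab] Hl]]]|[l0 El]].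
  by split; [case: Hl|apply: polar_line_dual Hl].
have [a [b [a0 b0 Eab Hl]]] := dual_cubic_polar l0 El.
exists a, b; split=> //; last exact/conic_singularE.
by apply/hessianE; split=> //; apply: polar_hessian Eab.
Qed.

End Cayleyan.

(** * Morphisms given by two tuples of forms *)

Definition row3 (R : nmodType) (a b c : R) : 'rV[R]_3 := \row_(j < 3) [:: a; b; c]`_j.

Lemma evs_row3 (R S : fieldType) (e : {rmorphism R -> S}) n (a b c : {mpoly R[n]}) v :
  evs e (row3 a b c) v = pt3 (ev e a v) (ev e b v) (ev e c v).
Proof. by apply: row3_eq; rewrite !mxE. Qed.

Lemma proj_eq_refl (S : fieldType) n (v : 'rV[S]_n) : proj_eq v v.
Proof. by exists 1; rewrite ?oner_neq0 ?scale1r. Qed.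

(** This compares two tuples of forms through polynomial identities only. *)
Lemma proj_eq_minors (S : fieldType) n (v w : 'rV[S]_n) :
  v != 0 -> w != 0 -> (forall i j, v 0 i * w 0 j = v 0 j * w 0 i) -> proj_eq v w.
Proof.
move=> v0 w0 vw; have /rV0Pn[i vi] := v0.
have wE : w = (w 0 i / v 0 i) *: v.
  by apply/rowP => j; rewrite mxE mulrAC; apply: (canRL (mulfK vi)); rewrite mulrC -vw mulrC.
exists (w 0 i / v 0 i) => //.
by apply: contra w0 => /eqP E; rewrite wE E scale0r.
Qed.

Section Morphisms.
Context (k : fieldType) (s : {rmorphism k -> algC}) (n m : nat).
Context (V : 'rV[algC]_n -> Prop) (W : 'rV[algC]_m -> Prop).

Lemma morphism_forms (phi : 'rV[{mpoly k[n]}]_m) : forms phi ->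
  (forall P, V P -> evs s phi P != 0 /\ W (evs s phi P)) ->
  morphism s V W (evs s phi).
Proof.
move=> fphi VW P VP; have [P0 WP] := VW P VP; split=> //.
by exists phi => //; split=> // Q _ _; apply: proj_eq_refl.
Qed.

(** A tuple of forms representing a morphism may vanish at some points; there
    the second tuple takes over. *)
Definition glued_map (phi phi' : 'rV[{mpoly k[n]}]_m) (P : 'rV[algC]_n) :=
  if evs s phi P != 0 then evs s phi P else evs s phi' P.

Context (phi phi' : 'rV[{mpoly k[n]}]_m).
Hypotheses (fphi : forms phi) (fphi' : forms phi').
Hypothesis minors : forall P, V P -> forall i j,
  evs s phi P 0 i * evs s phi' P 0 j = evs s phi P 0 j * evs s phi' P 0 i.

Lemma glued_map_represents : represents s V (glued_map phi phi') phi.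
Proof. by split=> // Q VQ Q0; rewrite /glued_map Q0; apply: proj_eq_refl. Qed.

Lemma glued_map_morphism :
  (forall P, V P -> evs s phi P != 0 -> W (evs s phi P)) ->
  (forall P, V P -> evs s phi P = 0 -> evs s phi' P != 0 /\ W (evs s phi' P)) ->
  morphism s V W (glued_map phi phi').
Proof.
move=> W1 W2 P VP; rewrite /glued_map; case: (boolP (evs s phi P != 0)) => [P0|].
  split; first exact: W1.
  by exists phi => //; apply: glued_map_represents.
rewrite negbK => /eqP P0; have [P0' WP] := W2 P VP P0; split=> //.
exists phi' => //; split=> // Q VQ Q0; case: ifP => [Q1|_]; last exact: proj_eq_refl.
by apply: proj_eq_minors => // i j; apply: minors.
Qed.
End Morphisms.

Lemma evs_scale (R S : fieldType) (e : {rmorphism R -> S}) n m d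
  (phi : 'rV[{mpoly R[n]}]_m) c (v : 'rV[S]_n) :
  (forall j, phi 0 j \is d.-homog) -> evs e phi (c *: v) = c ^+ d *: evs e phi v.
Proof. by move=> h; apply/rowP => j; rewrite !mxE (ev_scale _ _ _ (h j)). Qed.

(** * The Weierstrass form of the Cayleyan *)

Section PlaneCubics.
Context (k : fieldType) (A B : k) (s : {rmorphism k -> algC}).

Lemma curve_E0E v : curve_E0 A B s v <-> v != 0 /\
  v 0 1 ^+ 2 * v 0 2 = v 0 0 ^+ 3 + s A * v 0 0 * v 0 2 ^+ 2 + s B * v 0 2 ^+ 3.
Proof.
have E : ev s (weierstrass_form A B) v = v 0 1 ^+ 2 * v 0 2 -
    (v 0 0 ^+ 3 + s A * v 0 0 * v 0 2 ^+ 2 + s B * v 0 2 ^+ 3).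
  by rewrite /weierstrass_form !evE; ring.
split=> -[v0 H]; split=> //.
  by apply/eqP; rewrite -subr_eq0 -E; apply/eqP/H; rewrite inE.
by move=> p; rewrite inE => /eqP ->; rewrite E H subrr.
Qed.

Lemma curve_E0_scale c v : c != 0 -> curve_E0 A B s v -> curve_E0 A B s (c *: v).
Proof.
move=> c0 /curve_E0E[v0 E]; apply/curve_E0E; rewrite scaler_eq0 negb_or c0 v0; split=> //.
by rewrite !mxE; apply: (eq_lin (u := c ^+ 3) E); ring.
Qed.

Definition weierstrass_cubic (x y z : algC) : algC :=
  - 3 * y ^+ 2 * z - (x ^+ 3 - 18 * s B * x ^+ 2 * z + 3 * s (delta A B) * x * z ^+ 2).

Lemma cayleyan_weierstrassE v : cayleyan_weierstrass A B s v <-> v != 0 /\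
  weierstrass_cubic (v 0 0) (v 0 1) (v 0 2) = 0.
Proof.
have E : ev s (cayleyan_weierstrass_form A B) v = weierstrass_cubic (v 0 0) (v 0 1) (v 0 2).
  rewrite /cayleyan_weierstrass_form /weierstrass_cubic; move: (delta A B) => d.
  by rewrite !evE !(rmorphN, rmorphM, rmorph_nat) /=; ring.
split=> -[v0 H]; split=> //; first by rewrite -E; apply: H; rewrite inE.
by move=> p; rewrite inE => /eqP ->; rewrite E.
Qed.

Lemma dual_cubic_weierstrass x y z :
  dual_cubic A B s (pt3 (2 * s A * x) y (3 * s B * x - s (delta A B) * z)) =
  - 2 * s A * s (delta A B) * weierstrass_cubic x y z.
Proof. by rewrite /dual_cubic /weierstrass_cubic !mxE /= rmorph_delta; ring. Qed.

Lemma dual_cubic_scale c l : dual_cubic A B s (c *: l) = c ^+ 3 * dual_cubic A B s l.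
Proof. by rewrite /dual_cubic !mxE; ring. Qed.

Hypotheses (A0 : A != 0) (d0 : delta A B != 0).
Let A1 : s A != 0. Proof. by rewrite fmorph_eq0. Qed.
Let d1 : s (delta A B) != 0. Proof. by rewrite fmorph_eq0. Qed.
Let two0 : 2 != 0 :> algC. Proof. by rewrite pnatr_eq0. Qed.

(** The linear change of coordinates with which the dual cubic takes its
    Weierstrass form: z = 0 is the tangent 3B xi = 2A zeta at the inflection point (0 : 1 : 0). *)
Definition weierstrass_forms : 'rV[{mpoly k[3]}]_3 :=
  row3 (delta A B *: 'X_0) ((2 * A * delta A B) *: 'X_1) ((3 * B) *: 'X_0 - (2 * A) *: 'X_2).

(** The inverse of [weierstrass_forms], up to the factor 2 A delta. *)
Definition dual_forms : 'rV[{mpoly k[3]}]_3 :=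
  row3 ((2 * A) *: 'X_0) 'X_1 ((3 * B) *: 'X_0 - delta A B *: 'X_2).

Lemma evs_weierstrass l : evs s weierstrass_forms l =
  pt3 (s (delta A B) * l 0 0) (2 * s A * s (delta A B) * l 0 1) (3 * s B * l 0 0 - 2 * s A * l 0 2).
Proof. by rewrite evs_row3; move: (delta A B) => d; rewrite !evE !(rmorphM, rmorph_nat). Qed.

Lemma evs_dual w : evs s dual_forms w =
  pt3 (2 * s A * w 0 0) (w 0 1) (3 * s B * w 0 0 - s (delta A B) * w 0 2).
Proof. by rewrite evs_row3; move: (delta A B) => d; rewrite !evE !(rmorphM, rmorph_nat). Qed.

Lemma dualK l : evs s dual_forms (evs s weierstrass_forms l) = (2 * s A * s (delta A B)) *: l.
Proof. by rewrite evs_dual evs_weierstrass; apply: row3_eq; rewrite !mxE /=; ring. Qed.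

Lemma weierstrassK w : evs s weierstrass_forms (evs s dual_forms w) = (2 * s A * s (delta A B)) *: w.
Proof. by rewrite evs_weierstrass evs_dual; apply: row3_eq; rewrite !mxE /=; ring. Qed.

Lemma linear_form_homog (a b : k) (i j : 'I_3) : a *: 'X_i - b *: 'X_j \is 1.-homog.
Proof. by apply: dhomogD; rewrite ?dhomogN; apply: dhomogZ; apply: homog_X. Qed.

Lemma evs0 n (phi : 'rV[{mpoly k[n]}]_3) d : (0 < d)%N ->
  (forall j, phi 0 j \is d.-homog) -> evs s phi 0 = 0.
Proof. by move=> dn0 h; rewrite -(scale0r 0) (evs_scale _ _ _ h) expr0n -(prednK dn0) scale0r. Qed.

Lemma cayleyan_isomorphism :
  pointed_isomorphism s (cayleyan A B s) (pt3 0 1 0)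
    (cayleyan_weierstrass A B s) (pt3 0 1 0) (evs s weierstrass_forms).
Proof.
have c0 : 2 * s A * s (delta A B) != 0 by rewrite !mulf_neq0.
have hW j : weierstrass_forms 0 j \is 1.-homog.
  by rewrite mxE; case: j => -[|[|[|//]]] hj; rewrite /= ?linear_form_homog //; apply: dhomogZ; apply: homog_X.
have hD j : dual_forms 0 j \is 1.-homog.
  by rewrite mxE; case: j => -[|[|[|//]]] hj; rewrite /= ?linear_form_homog ?homog_X //; apply: dhomogZ; apply: homog_X.
have proj n (c : algC) (v : 'rV[algC]_n) : c != 0 -> proj_eq (c *: v) v.
  by move=> cn0; exists c^-1; rewrite ?invr_eq0 // scalerA mulVf // scale1r.
split; first split.
- apply: morphism_forms => [|l /cayleyanE[//|//|l0 El]]; first by exists 1%N.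
  have W0 : evs s weierstrass_forms l != 0.
    apply: contra l0 => /eqP E; have := dualK l; rewrite E (evs0 (ltn0Sn 0) hD).
    by move/esym/eqP; rewrite scaler_eq0 (negbTE c0).
  split=> //; apply/cayleyan_weierstrassE; split=> //.
  have := dual_cubic_weierstrass (evs s weierstrass_forms l 0 0) (evs s weierstrass_forms l 0 1) (evs s weierstrass_forms l 0 2).
  rewrite -evs_dual dualK dual_cubic_scale El mulr0 => /esym/eqP.
  by rewrite mulf_eq0 -mulrA mulNr oppr_eq0 mulrA (negbTE c0) => /eqP.
- exists (evs s dual_forms); split=> [|P _|Q _].
  + apply: morphism_forms => [|w /cayleyan_weierstrassE[w0 Ew]]; first by exists 1%N.
    have W0 : evs s dual_forms w != 0.
      apply: contra w0 => /eqP E; have := weierstrassK w; rewrite E (evs0 (ltn0Sn 0) hW).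
      by move/esym/eqP; rewrite scaler_eq0 (negbTE c0).
    split=> //; apply/cayleyanE => //; split=> //.
    by rewrite evs_dual dual_cubic_weierstrass Ew mulr0.
  + by rewrite dualK; apply: proj.
  + by rewrite weierstrassK; apply: proj.
- apply/cayleyanE => //; split; first by apply: pt3_neq0; rewrite oner_neq0 orbT.
  by rewrite /dual_cubic !mxE /=; ring.
- apply/cayleyan_weierstrassE; split; first by apply: pt3_neq0; rewrite oner_neq0 orbT.
  by rewrite /weierstrass_cubic !mxE /=; ring.
have -> : evs s weierstrass_forms (pt3 0 1 0) = (2 * s A * s (delta A B)) *: pt3 0 1 0.
  by rewrite evs_weierstrass; apply: row3_eq; rewrite !mxE /=; ring.
exact: proj.
Qed.

End PlaneCubics.

(** * The morphisms psi1 and psi2 *)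

Section Coverings.
Context (k : fieldType) (A B : k) (s : {rmorphism k -> algC}).
Hypotheses (A0 : A != 0) (d0 : delta A B != 0).
Local Notation C := (curve_C A B s).
Let A1 : s A != 0. Proof. by rewrite fmorph_eq0. Qed.
Let d1 : s (delta A B) != 0. Proof. by rewrite fmorph_eq0. Qed.
Let sd : 4 * s A ^+ 3 + 27 * s B ^+ 2 != 0. Proof. by rewrite -rmorph_delta. Qed.
Let two0 : 2 != 0 :> algC. Proof. by rewrite pnatr_eq0. Qed.
Let three0 : 3 != 0 :> algC. Proof. by rewrite pnatr_eq0. Qed.

Definition cubic_form : {mpoly k[5]} := 'X_3 + A *: 'X_1 + B *: 'X_0.
Definition quadratic_form : {mpoly k[5]} := 3 *: 'X_2 + (4 * A) *: 'X_0.
Definition derivative_form : {mpoly k[5]} := 3 *: 'X_2 + A *: 'X_0.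
Definition psi1_x_form : {mpoly k[5]} := 'X_3 + (4 * B) *: 'X_0.
Definition psi1_y_form : {mpoly k[5]} := 'X_3 + (4 * A) *: 'X_1 - (8 * B) *: 'X_0.

(** The formula for psi1 multiplied by q^2, where q = 3 X^2 + 4 A. *)
Definition psi1_forms : 'rV[{mpoly k[5]}]_3 :=
  row3 (- psi1_x_form * quadratic_form) (psi1_y_form * 'X_4) (quadratic_form * quadratic_form).
(** The first tuple times - Y / q, rewritten with the equation of C.  It represents
    psi1 at the roots of q and at infinity. *)
Definition psi1_forms' : 'rV[{mpoly k[5]}]_3 :=
  row3 (psi1_x_form * 'X_4) (psi1_y_form * cubic_form) (- quadratic_form * 'X_4).

(** From Weierstrass coordinates to the dual plane, as in [dual_forms]. *)
Definition to_dual (x y z : {mpoly k[5]}) : 'rV[{mpoly k[5]}]_3 :=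
  row3 ((2 * A) *: x) y ((3 * B) *: x - delta A B *: z).
(** The formula for psi2 multiplied by 9 f^2, where f = X^3 + A X + B. *)
Definition psi2_forms : 'rV[{mpoly k[5]}]_3 :=
  to_dual ((3 * delta A B) *: (cubic_form * 'X_0)) (delta A B *: (derivative_form * 'X_4))
          (9 *: (cubic_form * cubic_form)).
(** The first tuple times Y / f, rewritten with the equation of C.  It represents
    psi2 at the roots of f. *)
Definition psi2_forms' : 'rV[{mpoly k[5]}]_3 :=
  to_dual ((3 * delta A B) *: ('X_4 * 'X_0)) (- delta A B *: (derivative_form * quadratic_form))
          (9 *: (cubic_form * 'X_4)).

Lemma linear_forms_homog : [/\ cubic_form \is 1.-homog, quadratic_form \is 1.-homog,
  derivative_form \is 1.-homog, psi1_x_form \is 1.-homog & psi1_y_form \is 1.-homog].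
Proof.
have hZ (a : k) (i : 'I_5) : a *: 'X_i \is 1.-homog by apply: dhomogZ; apply: homog_X.
split; rewrite /cubic_form /quadratic_form /derivative_form /psi1_x_form /psi1_y_form;
by do ![apply: dhomogD|rewrite dhomogN|exact: homog_X|exact: hZ].
Qed.

Let hM (p q : {mpoly k[5]}) : p \is 1.-homog -> q \is 1.-homog -> p * q \is 2.-homog.
Proof. by move=> hp hq; apply: (dhomogM hp hq). Qed.

Lemma psi1_homog j : psi1_forms 0 j \is 2.-homog /\ psi1_forms' 0 j \is 2.-homog.
Proof.
have [h1 h2 h3 h4 h5] := linear_forms_homog; rewrite !mxE.
by case: j => -[|[|[|//]]] hj /=; split; apply: hM; rewrite ?dhomogN ?homog_X.
Qed.

Lemma to_dual_homog x y z : x \is 2.-homog -> y \is 2.-homog -> z \is 2.-homog ->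
  forall j, to_dual x y z 0 j \is 2.-homog.
Proof.
move=> hx hy hz j; rewrite mxE; case: j => -[|[|[|//]]] hj //=; first exact: dhomogZ.
by apply: dhomogD; rewrite ?dhomogN; apply: dhomogZ.
Qed.

Lemma psi2_homog j : psi2_forms 0 j \is 2.-homog /\ psi2_forms' 0 j \is 2.-homog.
Proof.
have [h1 h2 h3 h4 h5] := linear_forms_homog.
by split; apply: to_dual_homog; apply: dhomogZ; apply: hM; rewrite ?homog_X.
Qed.

Section Values.
Context (S : fieldType) (e : {rmorphism k -> S}) (x y : S).
Let q := 3 * x ^+ 2 + 4 * e A.
Let f := x ^+ 3 + e A * x + e B.
Let d := e (delta A B).

Lemma psi1_forms_affine : evs e psi1_forms (chart_pt true x y) =
  pt3 (- (x ^+ 3 + 4 * e B) * q) ((x ^+ 3 + 4 * e A * x - 8 * e B) * y) (q ^+ 2).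
Proof.
rewrite evs_row3 /psi1_x_form /psi1_y_form /quadratic_form /q.
apply: row3_eq; rewrite !mxE /= !evE !mxE /= !(rmorphM, rmorph_nat) /=; ring.
Qed.

Lemma psi1_forms'_affine : evs e psi1_forms' (chart_pt true x y) =
  pt3 ((x ^+ 3 + 4 * e B) * y) ((x ^+ 3 + 4 * e A * x - 8 * e B) * f) (- q * y).
Proof.
rewrite evs_row3 /psi1_x_form /psi1_y_form /quadratic_form /cubic_form /q /f.
apply: row3_eq; rewrite !mxE /= !evE !mxE /= !(rmorphM, rmorph_nat) /=; ring.
Qed.

Lemma evs_to_dual u v w p : evs e (to_dual u v w) p =
  pt3 (2 * e A * ev e u p) (ev e v p) (3 * e B * ev e u p - d * ev e w p).
Proof. by rewrite evs_row3 /d; move: (delta A B) => dd; rewrite !evE !(rmorphM, rmorph_nat). Qed.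

Lemma psi2_forms_affine : evs e psi2_forms (chart_pt true x y) =
  pt3 (2 * e A * (3 * d * f)) (d * (3 * x ^+ 2 + e A) * y) (3 * e B * (3 * d * f) - d * (9 * f ^+ 2)).
Proof.
rewrite evs_to_dual /cubic_form /derivative_form /f /d; move: (delta A B) => dd.
apply: row3_eq; rewrite !mxE /= !evE !mxE /= !(rmorphM, rmorph_nat) /=; ring.
Qed.

Lemma psi2_forms'_affine : evs e psi2_forms' (chart_pt true x y) =
  pt3 (2 * e A * (3 * d * y)) (- d * (3 * x ^+ 2 + e A) * q) (3 * e B * (3 * d * y) - d * (9 * f * y)).
Proof.
rewrite evs_to_dual /cubic_form /derivative_form /quadratic_form /f /q /d; move: (delta A B) => dd.
apply: row3_eq; rewrite !mxE /= !evE !mxE /= !(rmorphM, rmorphN, rmorph_nat) /=; ring.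
Qed.

Lemma psi1_forms_infinity : evs e psi1_forms (chart_pt false 0 0) = 0 /\
  evs e psi1_forms' (chart_pt false 0 0) = pt3 0 1 0.
Proof.
split; rewrite evs_row3 /psi1_x_form /psi1_y_form /quadratic_form /cubic_form;
apply: row3_eq; rewrite !mxE /= !evE !mxE /= !(rmorphM, rmorph_nat) /=; ring.
Qed.

Lemma psi2_forms_infinity : evs e psi2_forms (chart_pt false 0 0) = pt3 0 0 (- 9 * d) /\
  evs e psi2_forms' (chart_pt false 0 0) = 0.
Proof.
split; rewrite evs_to_dual /cubic_form /derivative_form /quadratic_form /d; move: (delta A B) => dd;
apply: row3_eq; rewrite !mxE /= !evE !mxE /= !(rmorphM, rmorphN, rmorph_nat) /=; ring.
Qed.
End Values.

(** What is stable under scaling need only be checked at the affine points and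
    at the point at infinity. *)
Lemma curve_C_ind (T : 'rV[algC]_5 -> Prop) :
  (forall c P, c != 0 -> T P -> T (c *: P)) ->
  (forall x y, affine_C A B s x y -> T (chart_pt true x y)) ->
  T (chart_pt false 0 0) -> forall P, C P -> T P.
Proof.
move=> Tc Ta Ti P /curve_C_points[[_ [c [x [y [c0 xy ->]]]]]|[_ [c c0 ->]]];
by apply: Tc => //; apply: Ta.
Qed.

Lemma scale_rV_neq0 n (c : algC) (v : 'rV[algC]_n) : c != 0 -> (c *: v != 0) = (v != 0).
Proof. by move=> c0; rewrite scaler_eq0 (negbTE c0). Qed.

Lemma minors_scale n m d (phi phi' : 'rV[{mpoly k[n]}]_m) (P : 'rV[algC]_n) c :
  (forall j, phi 0 j \is d.-homog /\ phi' 0 j \is d.-homog) ->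
  (forall i j, evs s phi P 0 i * evs s phi' P 0 j = evs s phi P 0 j * evs s phi' P 0 i) ->
  forall i j, evs s phi (c *: P) 0 i * evs s phi' (c *: P) 0 j =
    evs s phi (c *: P) 0 j * evs s phi' (c *: P) 0 i.
Proof.
move=> h M i j; rewrite (evs_scale s c P (fun j => (h j).1)) (evs_scale s c P (fun j => (h j).2)).
have E (v : 'rV[algC]_m) l : (c ^+ d *: v) 0 l = c ^+ d * v 0 l by rewrite mxE.
by rewrite !E mulrACA M mulrACA.
Qed.

Lemma psi1_minors P : C P -> forall i j,
  evs s psi1_forms P 0 i * evs s psi1_forms' P 0 j =
  evs s psi1_forms P 0 j * evs s psi1_forms' P 0 i.
Proof.
elim/curve_C_ind => {P} [c P c0 IH|x y xy|] i j; first exact: (minors_scale c psi1_homog IH).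
  rewrite psi1_forms_affine psi1_forms'_affine !mxE; move: xy; rewrite /affine_C => xy.
  case: i => -[|[|[|//]]] hi; case: j => -[|[|[|//]]] hj //=; try ring.
  - by apply: (eq_lin (u := - (x ^+ 3 + 4 * s B) * (x ^+ 3 + 4 * s A * x - 8 * s B)) xy); ring.
  - by apply: (eq_lin (u := (x ^+ 3 + 4 * s B) * (x ^+ 3 + 4 * s A * x - 8 * s B)) xy); ring.
  - by apply: (eq_lin (u := - (x ^+ 3 + 4 * s A * x - 8 * s B) * (3 * x ^+ 2 + 4 * s A)) xy); ring.
  - by apply: (eq_lin (u := (x ^+ 3 + 4 * s A * x - 8 * s B) * (3 * x ^+ 2 + 4 * s A)) xy); ring.
by have [-> _] := psi1_forms_infinity s; rewrite !mxE !mul0r.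
Qed.

Lemma psi2_minors P : C P -> forall i j,
  evs s psi2_forms P 0 i * evs s psi2_forms' P 0 j =
  evs s psi2_forms P 0 j * evs s psi2_forms' P 0 i.
Proof.
elim/curve_C_ind => {P} [c P c0 IH|x y xy|] i j; first exact: (minors_scale c psi2_homog IH).
  rewrite psi2_forms_affine psi2_forms'_affine !mxE; move: (s (delta A B)) => d.
  move: xy; rewrite /affine_C => xy.
  case: i => -[|[|[|//]]] hi; case: j => -[|[|[|//]]] hj //=; try ring.
  - by apply: (eq_lin (u := - (2 * s A * (3 * d)) * d * (3 * x ^+ 2 + s A)) xy); ring.
  - by apply: (eq_lin (u := (2 * s A * (3 * d)) * d * (3 * x ^+ 2 + s A)) xy); ring.
  - by apply: (eq_lin (u := d * (3 * x ^+ 2 + s A) * (3 * s B * (3 * d) - d * 9 * (x ^+ 3 + s A * x + s B))) xy); ring.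
  - by apply: (eq_lin (u := - d * (3 * x ^+ 2 + s A) * (3 * s B * (3 * d) - d * 9 * (x ^+ 3 + s A * x + s B))) xy); ring.
by have [_ ->] := psi2_forms_infinity s; rewrite !mxE !mulr0.
Qed.

Definition psi1 := glued_map s psi1_forms psi1_forms'.
Definition psi2 := glued_map s psi2_forms psi2_forms'.

Lemma psi_forms : [/\ forms psi1_forms, forms psi1_forms', forms psi2_forms & forms psi2_forms'].
Proof. by split; exists 2 => j; have [] := psi1_homog j; have [] := psi2_homog j. Qed.

(** Where the first tuple vanishes, q = 0 and Y = 0; the middle coordinate of
    the second tuple is then nonzero because q is prime to both its factors. *)
Lemma psi1_morphism : morphism s C (curve_E0 A B s) psi1.
Proof.
have [h1 h1' _ _] := psi_forms.
apply: glued_map_morphism => //; first exact: psi1_minors.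
  apply: curve_C_ind => [c P c0 IH|x y xy|].
  - rewrite (evs_scale _ _ _ (fun j => (psi1_homog j).1)) scale_rV_neq0 ?expf_neq0 //.
    by move=> /IH; apply: curve_E0_scale; rewrite expf_neq0.
  - move=> P0; apply/curve_E0E; split=> //; rewrite psi1_forms_affine !mxE /=.
    move: xy; rewrite /affine_C => xy.
    by apply: (eq_lin (u := (x ^+ 3 + 4 * s A * x - 8 * s B) ^+ 2 * (3 * x ^+ 2 + 4 * s A) ^+ 2) xy); ring.
  - by have [-> _] := psi1_forms_infinity s; rewrite eqxx.
apply: curve_C_ind => [c P c0 IH|x y xy|].
- rewrite (evs_scale _ _ _ (fun j => (psi1_homog j).1)) (evs_scale _ _ _ (fun j => (psi1_homog j).2)).
  rewrite scale_rV_neq0 ?expf_neq0 // => /eqP; rewrite scaler_eq0 expf_eq0 (negbTE c0) /= => /eqP/IH[n0 EP].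
  by split=> //; apply: curve_E0_scale; rewrite ?expf_neq0.
- rewrite psi1_forms_affine => /rowP/(_ 2); rewrite !mxE /= => /eqP; rewrite expf_eq0 /= => /eqP q0.
  have nz : evs s psi1_forms' (chart_pt true x y) != 0.
    rewrite psi1_forms'_affine; apply: pt3_neq0; apply/or3P/Or32.
    have h := quadratic_cubic_coprime sd three0 q0.
    rewrite mulf_neq0 //.
      apply: contra h => /eqP E; apply/eqP; apply: (mulfI two0); apply: (mulfI two0); apply: (mulfI two0).
      by apply: (eq_lin (u := - 1) E); apply: (eq_lin (u := x / 3) q0); field.
    apply: contra h => /eqP E; apply/eqP.
    by apply: (eq_lin (u := 1) E); apply: (eq_lin (u := - x / 3) q0); field.
  split=> //; apply/curve_E0E; split=> //; rewrite psi1_forms'_affine !mxE /=.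
  have y0 : y = 0.
    by move: xy; rewrite /affine_C q0 oppr0 mul0r => /eqP; rewrite sqrf_eq0 => /eqP.
  by rewrite y0; ring.
- move=> _; have [_ ->] := psi1_forms_infinity s.
  have nz : pt3 0 1 0 != 0 :> 'rV[algC]_3 by apply: pt3_neq0; rewrite oner_neq0 orbT.
  by split=> //; apply/curve_E0E; split=> //; rewrite !mxE /=; ring.
Qed.

Lemma cayleyan_scale c l : c != 0 -> cayleyan A B s l -> cayleyan A B s (c *: l).
Proof.
move=> c0 /(cayleyanE _ A0 d0)[l0 El]; apply/(cayleyanE _ A0 d0).
by rewrite scale_rV_neq0 // dual_cubic_scale El mulr0.
Qed.

(** Where the first tuple vanishes, X^3 + A X + B and Y do; then neither
    3 X^2 + A nor 3 X^2 + 4 A vanishes. *)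
Lemma psi2_morphism : morphism s C (cayleyan A B s) psi2.
Proof.
have [_ _ h2 h2'] := psi_forms.
apply: glued_map_morphism => //; first exact: psi2_minors.
  apply: curve_C_ind => [c P c0 IH|x y xy|].
  - rewrite (evs_scale _ _ _ (fun j => (psi2_homog j).1)) scale_rV_neq0 ?expf_neq0 //.
    by move=> /IH; apply: cayleyan_scale; rewrite expf_neq0.
  - move=> P0; apply/(cayleyanE _ A0 d0); split=> //; rewrite psi2_forms_affine.
    rewrite dual_cubic_weierstrass; move: xy; rewrite /affine_C => xy.
    apply/eqP; rewrite mulf_eq0; apply/orP; right; apply/eqP.
    rewrite /weierstrass_cubic rmorph_delta.
    apply: (eq_lin (u := - 27 * (4 * s A ^+ 3 + 27 * s B ^+ 2) ^+ 2 * (3 * x ^+ 2 + s A) ^+ 2 *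
      (x ^+ 3 + s A * x + s B) ^+ 2) xy).
    by ring.
  - move=> P0; apply/(cayleyanE _ A0 d0); split=> //.
    by have [-> _] := psi2_forms_infinity s; rewrite /dual_cubic !mxE /=; ring.
apply: curve_C_ind => [c P c0 IH|x y xy|].
- rewrite (evs_scale _ _ _ (fun j => (psi2_homog j).1)) (evs_scale _ _ _ (fun j => (psi2_homog j).2)).
  rewrite scale_rV_neq0 ?expf_neq0 // => /eqP; rewrite scaler_eq0 expf_eq0 (negbTE c0) /= => /eqP/IH[n0 EP].
  by split=> //; apply: cayleyan_scale; rewrite ?expf_neq0.
- rewrite psi2_forms_affine => /rowP/(_ 0); rewrite !mxE /= => E.
  have f0 : x ^+ 3 + s A * x + s B = 0.
    apply: (mulfI d1); apply: (mulfI A1); apply: (mulfI two0); apply: (mulfI three0).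
    by apply: (eq_lin (u := 1) E); ring.
  have q0 : 3 * x ^+ 2 + 4 * s A != 0.
    apply/eqP => q0; case/eqP: (quadratic_cubic_coprime sd three0 q0).
    by apply: (eq_lin (u := 1) f0); apply: (eq_lin (u := - x / 3) q0); field.
  have nz : evs s psi2_forms' (chart_pt true x y) != 0.
    rewrite psi2_forms'_affine; apply: pt3_neq0; apply/or3P/Or32.
    by rewrite !mulf_neq0 ?oppr_eq0 // (cubic_separable sd).
  split=> //; apply/(cayleyanE _ A0 d0); split=> //; rewrite psi2_forms'_affine.
  have y0 : y = 0.
    by move: xy; rewrite /affine_C f0 mulr0 => /eqP; rewrite sqrf_eq0 => /eqP.
  by rewrite /dual_cubic !mxE /= y0; ring.
- have [-> _] := psi2_forms_infinity s => /rowP/(_ 2); rewrite !mxE /= => /eqP.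
  by rewrite mulf_eq0 oppr_eq0 (negbTE d1) orbF pnatr_eq0.
Qed.

Lemma psi1_formula X Y : affine_C A B s X Y ->
  let q := 3 * X ^+ 2 + 4 * s A in q != 0 ->
  proj_eq (psi1 (pt_C X Y)) (pt3 (- (X ^+ 3 + 4 * s B) / q)
     ((X ^+ 3 + 4 * s A * X - 8 * s B) * Y / q ^+ 2) 1).
Proof.
move=> XY q q0; rewrite -chart_ptC /psi1 /glued_map.
have nz : evs s psi1_forms (chart_pt true X Y) != 0.
  by rewrite psi1_forms_affine; apply: pt3_neq0; rewrite expf_neq0 ?orbT.
rewrite nz psi1_forms_affine -/q; exists (q ^- 2); first by rewrite invr_eq0 expf_neq0.
by apply: row3_eq; rewrite !mxE /=; field.
Qed.

Lemma psi2_formula X Y : affine_C A B s X Y ->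
  let f := X ^+ 3 + s A * X + s B in f != 0 ->
  proj_eq (evs s (weierstrass_forms A B) (psi2 (pt_C X Y)))
    (pt3 (s (delta A B) / (3 * f))
       (s (delta A B) * (3 * X ^+ 2 + s A) * Y / (9 * f ^+ 2)) 1).
Proof.
move=> XY f fn0; rewrite -chart_ptC /psi2 /glued_map.
have nz : evs s psi2_forms (chart_pt true X Y) != 0.
  by rewrite psi2_forms_affine; apply: pt3_neq0; apply/or3P/Or31; rewrite !mulf_neq0.
rewrite nz psi2_forms_affine -/f evs_weierstrass.
have nine : 9 != 0 :> algC by rewrite pnatr_eq0.
exists (2 * s A * s (delta A B) * (9 * f ^+ 2))^-1.
  by rewrite invr_eq0 !mulf_neq0 ?expf_neq0.
apply: row3_eq; rewrite !mxE /=; field; rewrite ?fn0 ?A1 ?d1 //.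
Qed.

End Coverings.

(** * The degrees of psi1 and psi2 *)

Section Degrees.
Context (k : fieldType) (A B : k) (s : {rmorphism k -> algC}).
Hypotheses (A0 : A != 0) (d0 : delta A B != 0).
Local Notation C := (curve_C A B s).

Context (L : fieldType) (e : {rmorphism k -> L}) (X Y : L).
Hypothesis H : hyperelliptic e (chart_poly A B true) X Y.
Hypothesis span : spans_field e X Y.
Let f0 := chart_poly_neq0 A B s.
Let Lf : function_field s C := curve_function_field s f0 H span.
Let nL n : n.+1%:R != 0 :> L := natrL_neq0 s e n.
Let A1 : e A != 0. Proof. by rewrite fmorph_eq0. Qed.
Let d1 : e (delta A B) != 0. Proof. by rewrite fmorph_eq0. Qed.

Let yf : Y ^+ 2 = - (3 * X ^+ 2 + 4 * e A) * (X ^+ 3 + e A * X + e B).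
Proof. by rewrite (hyp_eq H) chart_polyE. Qed.

Let q_poly : {poly k} := 3 *: 'X^2 + (4 * A)%:P.
Let f_poly : {poly k} := 'X^3 + A *: 'X + B%:P.
Let n_poly : {poly k} := 'X^3 + (4 * B)%:P.

Lemma peval_factors (S : fieldType) (i : {rmorphism k -> S}) x :
  [/\ peval i x q_poly = 3 * x ^+ 2 + 4 * i A,
      peval i x f_poly = x ^+ 3 + i A * x + i B
    & peval i x n_poly = x ^+ 3 + 4 * i B].
Proof.
rewrite /q_poly /f_poly /n_poly !rmorphD /= !pevalZ !pevalC !(rmorphXn, rmorphM, rmorph_nat) /= !pevalX.
by [].
Qed.

Lemma coprime_psi1 : coprimep n_poly q_poly.
Proof.
have sd : 4 * s A ^+ 3 + 27 * s B ^+ 2 != 0 by rewrite -rmorph_delta fmorph_eq0.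
have three0 : 3 != 0 :> algC by rewrite pnatr_eq0.
rewrite -(coprimep_map s); apply/negPn/negP.
rewrite /coprimep => /closed_rootP[z]; rewrite root_gcd => /andP[/rootP nz /rootP qz].
have [qE _ nE] := peval_factors s z; move: nz qz; rewrite -/(peval s z _) nE -/(peval s z _) qE => nz qz.
case/eqP: (quadratic_cubic_coprime sd three0 qz).
have four0 : 4 != 0 :> algC by rewrite pnatr_eq0.
apply: (mulfI four0); apply: (eq_lin (u := 1) nz).
by apply: (eq_lin (u := - z / 3) qz); field.
Qed.

Let poly_neq0 (p : {poly k}) : p != 0 -> peval e X p != 0.
Proof. by apply: contra => /eqP E; apply/eqP/(peval_inj H); rewrite E rmorph0. Qed.

Let three0 : 3 != 0 :> k. Proof. exact: natr_neq0 s 2. Qed.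
Let two0 : 2 != 0 :> k. Proof. exact: natr_neq0 s 1. Qed.

Let q0 : 3 * X ^+ 2 + 4 * e A != 0.
Proof.
have [<- _ _] := peval_factors e X; apply: poly_neq0.
by rewrite -size_poly_eq0 size_quadratic_factor.
Qed.

Let fn0 : X ^+ 3 + e A * X + e B != 0.
Proof.
have [_ <- _] := peval_factors e X; apply: poly_neq0.
by rewrite -size_poly_eq0 size_cubic_factor.
Qed.

(** Here t = (X^3 + 4B) / (3 X^2 + 4A) = - x, and y is Y times a function of X. *)
Lemma psi1_degree : has_degree s C (psi1 A B s) 3.
Proof.
exists Lf, (psi1_forms A B); split.
- by have [h1 _ h2 _] := psi_forms A B; apply: glued_map_represents.
- rewrite /= psi1_forms_affine; apply/rV0Pn; exists 2.
  by rewrite !mxE /= expf_neq0.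
rewrite /= psi1_forms_affine; set v := pt3 _ _ _.
pose g_poly : {poly k} := 'X^3 + (4 * A) *: 'X - (8 * B)%:P.
have gE : peval e X g_poly = X ^+ 3 + 4 * e A * X - 8 * e B.
  rewrite /g_poly !(rmorphD, rmorphN) /= !(pevalZ, pevalC).
  by rewrite !(rmorphXn, rmorphM, rmorph_nat) /= !pevalX.
have g0 : peval e X g_poly != 0.
  apply: poly_neq0; rewrite -size_poly_eq0 /g_poly.
  by rewrite -polyCN size_cubic_factor.
have [qE fE nE] := peval_factors e X.
pose rho := peval e X g_poly / peval e X (q_poly ^+ 2).
pose y := rho * Y.
have q20 : peval e X (q_poly ^+ 2) != 0 by rewrite rmorphXn /= qE expf_neq0.
apply: (@cubic_degree k L e _ X Y H span n_poly q_poly _ _ coprime_psi1 _ rho y) => //.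
- by rewrite size_polyDl ?size_polyXn // ltnS (leq_trans (size_polyC_leq1 _)).
- by rewrite size_quadratic_factor.
- by exists g_poly, (q_poly ^+ 2).
- by rewrite mulf_neq0 ?invr_eq0.
set t := _ / _; have tE : t = (X ^+ 3 + 4 * e B) / (3 * X ^+ 2 + 4 * e A).
  by rewrite /t nE qE.
have v2 : v 0 2 = (3 * X ^+ 2 + 4 * e A) ^+ 2 by rewrite !mxE.
have v20 : v 0 2 != 0 by rewrite v2 expf_neq0.
apply: (@point_field_adjoined _ _ e t y _ 3 v (pt3 (- t) y 1) (v 0 2)) => //.
- have -> : y ^+ 2 = peval e t (- 'X^3 - A *: 'X + B%:P).
    rewrite !(rmorphD, rmorphN) /= pevalZ rmorphXn /= !pevalX pevalC tE.
    rewrite /y /rho rmorphXn /= gE qE exprMn yf; field; exact: q0.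
  exact: rational_peval.
- apply: row3_eq; rewrite !mxE /= ?mulr1 ?tE /y /rho ?rmorphXn /= ?gE ?qE; last by [].
    by field; exact: q0.
  by rewrite mulrA mulrCA divff ?mulr1 ?expf_neq0.
- have rt : rational_in e t t by rewrite -{2}(pevalX e t); apply: rational_peval.
  move=> i; rewrite mxE; case: i => -[|[|[|//]]] hi /=.
  + apply: rational_adjoined; have -> : - t = peval e t (- 'X) by rewrite rmorphN /= pevalX.
    exact: rational_peval.
  + exact: adjoined_gen.
  + by apply: rational_adjoined; rewrite -(rmorph1 (peval e t)); apply: rational_peval.
- have -> : t = e (- 1) * (v 0 0 / v 0 2).
    by rewrite rmorphN rmorph1 tE !mxE /=; field; exact: q0.
  by apply: point_fieldM; [apply: point_field_const|apply: point_field_ratio].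
have -> : y = v 0 1 / v 0 2.
  by rewrite /y /rho rmorphXn /= gE qE !mxE /=; field; exact: q0.
exact: point_field_ratio.
Qed.

(** Here t = X^3 + A X + B = delta / 3x, and y is Y times a function of X. *)
Lemma psi2_degree : has_degree s C (psi2 A B s) 3.
Proof.
exists Lf, (psi2_forms A B); split.
- by have [h1 _ h2 _] := psi_forms A B; apply: glued_map_represents.
- rewrite /= psi2_forms_affine; apply/rV0Pn; exists 0.
  by rewrite !mxE /= !mulf_neq0.
rewrite /= psi2_forms_affine; set v := pt3 _ _ _.
have [qE fE nE] := peval_factors e X.
pose rho := peval e X (delta A B *: (3 *: 'X^2 + A%:P)) / peval e X (9 *: f_poly ^+ 2).
have dE : peval e X (3 *: 'X^2 + A%:P) = 3 * X ^+ 2 + e A.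
  by rewrite rmorphD /= pevalZ pevalC !(rmorphXn, rmorph_nat) /= pevalX.
have dn0 : 3 * X ^+ 2 + e A != 0.
  by rewrite -dE; apply: poly_neq0; rewrite -size_poly_eq0 size_quadratic_factor.
have rhoE : rho = e (delta A B) * (3 * X ^+ 2 + e A) / (9 * (X ^+ 3 + e A * X + e B) ^+ 2).
  by rewrite /rho !pevalZ dE rmorphXn /= fE rmorph_nat.
pose y := rho * Y.
have f20 : peval e X (9 *: f_poly ^+ 2) != 0.
  by rewrite pevalZ rmorphXn /= fE rmorph_nat mulf_neq0 ?expf_neq0.
apply: (@cubic_degree k L e _ X Y H span f_poly 1 _ _ _ _ rho y) => //.
- by rewrite size_cubic_factor.
- by rewrite size_poly1.
- exact: coprimep1.
- by exists (delta A B *: (3 *: 'X^2 + A%:P)), (9 *: f_poly ^+ 2).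
- by rewrite rhoE mulf_neq0 ?invr_eq0 ?mulf_neq0 ?expf_neq0.
set t := _ / _; have tE : t = X ^+ 3 + e A * X + e B by rewrite /t fE rmorph1 divr1.
have t0 : t != 0 by rewrite tE.
pose c := 9 * (X ^+ 3 + e A * X + e B) ^+ 2.
have c0 : c != 0 by rewrite mulf_neq0 ?expf_neq0.
pose x := e (delta A B) / (3 * t).
have x0 : x != 0 by apply: mulf_neq0 => //; rewrite invr_eq0 mulf_neq0 // (nL 2).
have ratp p : rational_in e t (peval e t p) by apply: rational_peval.
have ratc a : rational_in e t (e a) by rewrite -(pevalC e t).
have rt : rational_in e t t by rewrite -{2}(pevalX e t).
have ratn n : rational_in e t n%:R by rewrite -(rmorph_nat e).
have rx : rational_in e t x.
  by apply: rationalM; [exact: ratc|apply: rationalV; apply: rationalM; [exact: ratn|exact: rt]].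
have y2 : rational_in e t (y ^+ 2).
  have -> : y ^+ 2 = e (- 3^-1) * (x * (x * x + e (- 18 * B) * x + e (3 * delta A B))).
    rewrite /x tE /y rhoE exprMn yf rmorph_delta.
    rewrite !(rmorphN, rmorphM, fmorphV, rmorph_nat) rmorph_delta /=; field.
    by rewrite fn0 (nL 2) (nL 8).
  apply: rationalM; first exact: ratc.
  apply: rationalM; first exact: rx.
  apply: rationalD; last exact: ratc.
  by apply: rationalD; apply: rationalM.
have v0 : v 0 0 = 2 * e A * x * c by rewrite !mxE /= /x /c tE; field; rewrite (nL 2) fn0.
have v1 : v 0 1 = y * c.
  by rewrite !mxE /= /y rhoE /c; field; rewrite (nL 8) fn0.
have v2 : v 0 2 = (3 * e B * x - e (delta A B)) * c.
  by rewrite !mxE /= /x /c tE; field; rewrite (nL 2) fn0.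
pose w := pt3 (2 * e A * x) y (3 * e B * x - e (delta A B)).
(* the line of [weierstrass_forms] which recovers the coordinate z *)
pose G : {mpoly k[3]} := (3 * B) *: 'X_0 - (2 * A) *: 'X_2.
have GE : ev e G v = 2 * e A * e (delta A B) * c.
  rewrite /G !evE v0 v2 !(rmorphM, rmorph_nat) /=; ring.
have G0 : ev e G v != 0 by rewrite GE !mulf_neq0 // (nL 1).
have pfx : point_field e v x.
  exists 1%N, (delta A B *: 'X_0), G; split=> //.
  - by apply: dhomogZ; apply: homog_X.
  - exact: linear_form_homog.
  by rewrite GE !evE v0; field; rewrite c0 d1 A1 (nL 1).
have pfy : point_field e v y.
  exists 1%N, ((2 * A * delta A B) *: 'X_1), G; split=> //.
  - by apply: dhomogZ; apply: homog_X.
  - exact: linear_form_homog.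
  rewrite GE evZ evX v1; move: (delta A B) d1 => d dn1; rewrite !(rmorphM, rmorph_nat) /=.
  by field; rewrite c0 dn1 A1 (nL 1).
apply: (@point_field_adjoined _ _ e t y _ 3 v w c) => //.
- by apply: row3_eq; rewrite [RHS]mxE [RHS]mulrC; [rewrite v0|rewrite v1|rewrite v2]; rewrite mxE.
- move=> i; rewrite mxE; case: i => -[|[|[|//]]] hi /=.
  + by apply: rational_adjoined; apply: rationalM => //; apply: rationalM.
  + exact: adjoined_gen.
  + apply: rational_adjoined; apply: rationalD.
      by apply: rationalM => //; apply: rationalM.
    by rewrite -rmorphN.
have -> : t = e (delta A B / 3) * x^-1.
  rewrite /x; move: (delta A B) d1 => d dn1; rewrite fmorph_div rmorph_nat; field.
  by rewrite dn1 t0 (nL 2).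
by apply: point_fieldM; [apply: point_field_const|apply: point_fieldV].
Qed.

End Degrees.

(** * The curve C and its two coverings of degree 3 *)

Theorem proposition6p2 (k : fieldExtType rat) (s : {rmorphism k -> algC})
    (A B : k)
    (E0_elliptic : nonsingular s [:: weierstrass_form A B])
    (A_neq0 : A != 0) :
  exists Phi : 'rV[algC]_3 -> 'rV[algC]_3,
    [/\ pointed_isomorphism s (cayleyan A B s) (pt3 0 1 0)
          (cayleyan_weierstrass A B s) (pt3 0 1 0) Phi,
        smooth_projective_curve s (curve_C_eqs A B) /\ affine_chart_C A B s,
        has_genus s (curve_C A B s) 2,
        exists psi1 : 'rV[algC]_5 -> 'rV[algC]_3,
          [/\ morphism s (curve_C A B s) (curve_E0 A B s) psi1,
              has_degree s (curve_C A B s) psi1 3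
            & forall X Y : algC, affine_C A B s X Y ->
                let q := 3 * X ^+ 2 + 4 * s A in
                q != 0 ->
                proj_eq (psi1 (pt_C X Y))
                  (pt3 (- (X ^+ 3 + 4 * s B) / q)
                       ((X ^+ 3 + 4 * s A * X - 8 * s B) * Y / q ^+ 2)
                       1)]
      & exists psi2 : 'rV[algC]_5 -> 'rV[algC]_3,
          [/\ morphism s (curve_C A B s) (cayleyan A B s) psi2,
              has_degree s (curve_C A B s) psi2 3
            & forall X Y : algC, affine_C A B s X Y ->
                let f := X ^+ 3 + s A * X + s B in
                f != 0 ->
                proj_eq (Phi (psi2 (pt_C X Y)))
                  (pt3 (s (delta A B) / (3 * f))
                       (s (delta A B) * (3 * X ^+ 2 + s A) * Y / (9 * f ^+ 2))
                       1)]].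
Proof.
have d0 := elliptic_delta A_neq0 E0_elliptic.
have [|//|L [e [X [Y [H span]]]]] := @hyperelliptic_exists _ (chart_poly A B true).
- by rewrite size_chart_poly // (natr_neq0 s 2).
- exact: chart_poly_neq0 s.
exists (evs s (weierstrass_forms A B)); split.
- exact: cayleyan_isomorphism.
- split; [exact: curve_C_smooth|exact: affine_chart].
- exact: (@curve_C_genus k A B s A_neq0 d0 L e X Y H span).
- exists (psi1 A B s); split; [exact: psi1_morphism|exact: (psi1_degree s d0 H span)|exact: psi1_formula].
- exists (psi2 A B s); split; [exact: psi2_morphism|exact: (psi2_degree s A_neq0 d0 H span)|exact: psi2_formula].
Qed.
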